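(* Let $$\alpha=N\big(a+\tfrac12\big)-\tfrac32,\qquad \beta\equiv\beta(m)=1-m-N\big(a+\tfrac12\big),\qquad t=\frac{2r^2}{N\bar x^2}-1,$$ where $\bar x=\frac1N\sum_i x_i$ and $r^2=\sum_i x_i^2$. The Hamiltonian $H_0$ possesses the following families of spin eigenfunctions (i.e. each function $\Psi$ below satisfies $H_0\Psi=E_{lm}\Psi$) with eigenvalue $E_{lm}=E_0+2\omega(2l+m)$, where $E_0=N\omega(2a+1)$, $l\ge0$ is an integer, and the integer $m$ is as indicated in each case: \begin{align*} \Psi^{(0)}_{lm}&=\mu\,\bar x^mL^{-\beta}_l(\omega r^2)P^{(\alpha,\beta)}_{[\frac m2]}(t)\,\Phi^{(0)},\qquad m\ge0,\\ \Psi^{(1)}_{lm}&=\mu\,\bar x^{m-1}L^{-\beta}_l(\omega r^2)P^{(\alpha+1,\beta)}_{[\frac{m-1}2]}(t)\big(\Phi^{(1)}-\bar x\,\Phi^{(0)}\big),\qquad m\ge1,\\ \Psi^{(2)}_{lm}&=\mu\,\bar x^{m-2}L^{-\beta}_l(\omega r^2)\Big[P^{(\alpha+2,\beta)}_{[\frac m2]-1}(t)\big(\Phi^{(2)}-2\bar x\,\Phi^{(1)}\big)\\ &\qquad+\bar x^2\Big(P^{(\alpha+2,\beta)}_{[\frac m2]-1}(t)-\frac{2(\alpha+1)}{2[\frac{m-1}2]+1}P^{(\alpha+1,\beta)}_{[\frac m2]-1}(t)\Big)\Phi^{(0)}\Big],\qquad m\ge2,\\ \widetilde\Psi^{(2)}_{lm}&=\mu\,\bar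 x^{m-2}L^{-\beta}_l(\omega r^2)\Big[P^{(\alpha+2,\beta)}_{[\frac m2]-1}(t)\big(\widetilde\Phi^{(2)}-2\bar x\,\Phi^{(1)}\big)\\ &\qquad+\bar x^2\Big(P^{(\alpha+2,\beta)}_{[\frac m2]-1}(t)+\frac{2(\alpha+1)}{(2[\frac{m-1}2]+1)(N-1)}P^{(\alpha+1,\beta)}_{[\frac m2]-1}(t)\Big)\Phi^{(0)}\Big],\qquad m\ge2,\\ \Psi^{(3)}_{lm}&=\mu\,\bar x^{m-3}L^{-\beta}_l(\omega r^2)\Big[\frac2{3N}P^{(\alpha+3,\beta)}_{[\frac{m-3}2]}(t)\sum_ix_i^3+\bar x^3\varphi_m(t)\Big]\Phi^{(0)},\qquad m\ge3,\\ \widehat\Psi^{(3)}_{lm}&=\mu\,\bar x^{m-3}L^{-\beta}_l(\omega r^2)\Big[P^{(\alpha+3,\beta)}_{[\frac{m-3}2]}(t)\big(\widehat\Phi^{(3)}-2\bar x\,\Phi^{(2)}\big)\\ &\qquad+2\bar x^2\Big(P^{(\alpha+3,\beta)}_{[\frac{m-3}2]}(t)+\frac{2(\alpha+2)}{2[\frac m2]-1}P^{(\alpha+2,\beta)}_{[\frac{m-3}2]}(t)\Big)\Phi^{(1)}\\ &\qquad-2\bar x^3\Big(\frac13P^{(\alpha+3,\beta)}_{[\frac{m-3}2]}(t)+\frac1{2[\frac m2]-1}P^{(\alpha+2,\beta)}_{[\frac{m-3}2]}(t)+\frac{2\alpha+3}{m(m-2)}\,\varepsilon(m)P^{(\alpha+1,\beta)}_{\frac{m-3}2}(t)\Big)\Phi^{(0)}\Big],\qquad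 m\ge3,\\ \Psi^{(4)}_{lm}&=\mu\,\bar x^{m-4}L^{-\beta}_l(\omega r^2)\Big[\frac3{2([\frac{m-3}2]+\frac12)}\,\bar x^2P^{(\alpha+3,\beta)}_{[\frac m2]-2}(t)\,\Phi^{(2)}\\ &\qquad+\Big(\frac32\bar x^3\phi_m(t)-\frac1NP^{(\alpha+4,\beta)}_{[\frac m2]-2}(t)\sum_ix_i^3\Big)\Phi^{(1)}\\ &\qquad+\Big(\frac1N\bar xP^{(\alpha+4,\beta)}_{[\frac m2]-2}(t)\sum_ix_i^3+\frac32\bar x^4\chi_m(t)\Big)\Phi^{(0)}\Big],\qquad m\ge4. \end{align*} Here $[\,\cdot\,]$ is the integer part, $\varepsilon(m)=(1-(-1)^m)/2$, and $\Phi^{(k)}=\Lambda(x_1^k|s\rangle)$, $\widetilde\Phi^{(2)}=\Lambda(x_1x_2|s\rangle)$, $\widehat\Phi^{(3)}=\Lambda(x_1x_2(x_1-x_2)|s\rangle)$, where $|s\rangle\in\Sigma$ is arbitrary, except that $|s\rangle$ is symmetric under $S_{12}$ and belongs to $\Sigma'$ for $\widetilde\Psi^{(2)}_{lm}$, and $|s\rangle$ is antisymmetric under $S_{12}$ for $\widehat\Psi^{(3)}_{lm}$. The polynomials $\varphi_m,\phi_m,\chi_m$ (in $t$) are, for even $m$, \begin{align*} \varphi_m&=\tfrac{m+2\alpha+2}{m-1}P^{(\alpha+2,\beta-2)}_{\frac m2}-P^{(\alpha+3,\beta-1)}_{\frac m2-1}-\tfrac{4\alpha+7}{m-1}P^{(\alpha+2,\beta-1)}_{\frac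 m2-1}+\tfrac13P^{(\alpha+3,\beta)}_{\frac m2-2},\\ \phi_m&=P^{(\alpha+4,\beta-1)}_{\frac m2-1}-2P^{(\alpha+3,\beta-1)}_{\frac m2-1}-\tfrac{m+2\alpha+3}{(m-1)(m-3)}P^{(\alpha+2,\beta-1)}_{\frac m2-1}-\tfrac13P^{(\alpha+4,\beta)}_{\frac m2-2}+\tfrac{m+2\alpha-1}{m-3}P^{(\alpha+3,\beta)}_{\frac m2-2},\\ \chi_m&=\tfrac{3m+2\alpha}{(m-1)(m-3)}P^{(\alpha+2,\beta-1)}_{\frac m2-1}+\tfrac{2m-7}{m-3}P^{(\alpha+3,\beta-1)}_{\frac m2-1}-P^{(\alpha+4,\beta-1)}_{\frac m2-1}\\ &\qquad-\tfrac{m+2\alpha+2}{(m-1)(m-3)}P^{(\alpha+2,\beta)}_{\frac m2-2}-\tfrac{m+2\alpha}{m-3}P^{(\alpha+3,\beta)}_{\frac m2-2}+\tfrac13P^{(\alpha+4,\beta)}_{\frac m2-2}, \end{align*} and, for odd $m$, \begin{align*} \varphi_m&=2P^{(\alpha+2,\beta-1)}_{\frac{m-1}2}-P^{(\alpha+3,\beta-1)}_{\frac{m-1}2}+\tfrac13P^{(\alpha+3,\beta)}_{\frac{m-3}2}+\tfrac{m+2\alpha+2}{m(m-2)}P^{(\alpha+1,\beta)}_{\frac{m-3}2}-\tfrac{m+2\alpha+2}{m-2}P^{(\alpha+2,\beta)}_{\frac{m-3}2},\\ \phi_m&=P^{(\alpha+4,\beta-1)}_{\frac{m-3}2}-\tfrac{2m-5}{m-2}P^{(\alpha+3,\beta-1)}_{\frac{m-3}2}-\tfrac13P^{(\alpha+4,\beta)}_{\frac{m-5}2}+\tfrac{m+2\alpha-1}{m-2}P^{(\alpha+3,\beta)}_{\frac{m-5}2},\\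 \chi_m&=\tfrac{2m-3}{m(m-2)}P^{(\alpha+2,\beta-1)}_{\frac{m-3}2}+\tfrac{2(m-3)}{m-2}P^{(\alpha+3,\beta-1)}_{\frac{m-3}2}-P^{(\alpha+4,\beta-1)}_{\frac{m-3}2}\\ &\qquad-\tfrac{m+2\alpha+1}{m(m-2)}P^{(\alpha+2,\beta)}_{\frac{m-5}2}-\tfrac{m+2\alpha}{m-2}P^{(\alpha+3,\beta)}_{\frac{m-5}2}+\tfrac13P^{(\alpha+4,\beta)}_{\frac{m-5}2}. \end{align*} Moreover, for every $n=0,1,\dots$, the eigenfunctions $\Psi^{(0)}_{lm}$, $\Psi^{(1)}_{lm}$, $\Psi^{(2)}_{lm}$, $\widetilde\Psi^{(2)}_{lm}$, $\Psi^{(3)}_{lm}$, $\widehat\Psi^{(3)}_{lm}$, $\Psi^{(4)}_{lm}$ with $2l+m\le n$ (for all admissible $|s\rangle$) span the whole $H_0$-invariant space $\mu\,\mathcal H^n_0$.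
   Context: $N\ge3$ is an integer, $a>1/2$ and $\omega>0$ are real; sums and products run over $1,\dots,N$ with cyclic indices ($x_0\equiv x_N$, $x_{N+1}\equiv x_1$, $S_{N,N+1}\equiv S_{N,1}$). The configuration space is $x_1<\dots<x_N$. Spin space: for a fixed $M\in\frac12\mathbb N$, $\Sigma$ is the complex vector space with basis $|s_1\dots s_N\rangle$, $s_i\in\{-M,\dots,M\}$; $S_N$ acts by permuting spin components ($\pi$ moves the component in position $k$ to position $\pi(k)$), and $S_{ij}$ is the transposition of spins $i,j$. $\Lambda$ is the projector onto states totally symmetric under simultaneous permutations of coordinates and spins (average over $S_N$ of the simultaneous action). For $|s\rangle\in\Sigma$ and $i\ne j$, $|s^{+}_{ij}\rangle=\frac1{N!}\sum_{\pi\in S_N,\,\pi(1)=i,\,\pi(2)=j}\pi(1+S_{12})|s\rangle$, and $\Sigma'=\{|s\rangle\in\Sigma:\sum_i|s^+_{i,i+1}\rangle\in\Lambda(\Sigma)\}$. Hamiltonian, acting on $\Sigma$-valued smooth functions of $\mathbf x=(x_1,\dots,x_N)$: $$H_0=-\sum_i\partial_{x_i}^2+\omega^2r^2+\sum_i\frac{2a^2}{(x_i-x_{i-1})(x_i-x_{i+1})}+\sum_i\frac{2a}{(x_i-x_{i+1})^2}(a-S_{i,i+1}).$$ Gauge factor: $\mu(\mathbf x)=e^{-\frac\omega2r^2}\prod_i|x_i-x_{i+1}|^a$. Invariant space: with $\sigma_k=\sum_ix_i^k$, $f_{33}=\partial^2f/\partial\sigma_3^2$ and $\deg$ the total degree in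 $\mathbf x$, $\mathcal H^n_0$ is the linear span of the functions $f(\sigma_1,\sigma_2,\sigma_3)\Lambda|s\rangle$, $g(\sigma_1,\sigma_2,\sigma_3)\Lambda(x_1|s\rangle)$, $h(\sigma_1,\sigma_2)\Lambda(x_1^2|s\rangle)$, $\tilde h(\sigma_1,\sigma_2)\Lambda(x_1x_2|s'\rangle)$, $w(\sigma_1,\sigma_2)\Lambda(x_1x_2(x_1-x_2)|s\rangle)$ with $|s\rangle\in\Sigma$, $|s'\rangle\in\Sigma'$, $f,g,h,\tilde h,w$ polynomials, $f_{33}=g_{33}=0$, $\deg f\le n$, $\deg g\le n-1$, $\deg h,\deg\tilde h\le n-2$, $\deg w\le n-3$. $L^\lambda_\nu$ are the generalized Laguerre polynomials, and $P^{(\gamma,\delta)}_\nu$ are the Jacobi polynomials, defined for arbitrary real $\gamma,\delta$ by $$P^{(\gamma,\delta)}_\nu(t)=\frac1{\nu!}\sum_{k=0}^\nu\frac{1}{2^kk!}(-\nu)_k(\gamma+\delta+\nu+1)_k(\gamma+k+1)_{\nu-k}(1-t)^k,\qquad (x)_k=x(x+1)\cdots(x+k-1).$$ Products such as $\bar x^jP(t)$ appearing in the statement are polynomials in $\bar x$ and $r^2$ and are understood as such (also at $\bar x=0$). A listed function may vanish identically for special choices of $|s\rangle$; it is an eigenfunction when nonzero. *)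

(* Defs.v *)
From mathcomp Require Import all_boot all_order all_algebra all_fingroup.
From mathcomp Require Import complex.
From mathcomp Require Import ring.
From mathcomp Require mpoly.

Set Implicit Arguments.
Unset Strict Implicit.
Unset Printing Implicit Defensive.

(* The notations of multinomials and of MathComp-Analysis cannot be active
   together; this module confines the former. *)
Module PowerSums.
Import mpoly GRing.Theory.
Local Open Scope ring_scope.

Definition poly_in (K : comNzRingType) (n : nat) : Type := {mpoly K[n]}.

Definition psum (K : comNzRingType) (N k : nat) : {mpoly K[N]} :=
  \sum_(i < N) 'X_i ^+ k.

(* f(sigma_1, ..., sigma_n) as a polynomial in x_1, ..., x_N. *)
Definition of_psums (K : comNzRingType) (N n : nat) (f : poly_in K n) :
    poly_in K N :=
  f \mPo [tuple psum K N i.+1 | i < n].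

Definition eval (K : comNzRingType) (N : nat) (p : poly_in K N)
    (v : 'I_N -> K) : K :=
  p.@[v].

(* deg p < d for the total degree, with deg 0 = -oo. *)
Definition deg_lt (K : comNzRingType) (N : nat) (p : poly_in K N) (d : nat) :
    bool :=
  (msize p <= d)%N.

(* The variable of index ord_max of a polynomial in three variables is the one
   replaced by sigma_3 in of_psums. *)
Definition d33_eq0 (K : comNzRingType) (f : poly_in K 3) : bool :=
  (f : {mpoly K[3]})^`M(ord_max)^`M(ord_max) == 0.

End PowerSums.

From mathcomp Require Import all_classical all_reals all_analysis.
Import Order.TTheory GRing.Theory Num.Theory.
Import numFieldNormedType.Exports.

Local Open Scope ring_scope.
Local Open Scope complex_scope.

Section ClassicalPolynomials.
Variable R : realType.
Implicit Types (g d z : R) (n k : nat).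

(* Rising factorial (z)_k. *)
Definition pochhammer z k : R := \prod_(j < k) (z + j%:R).

Definition jacobi g d n : {poly R} :=
  (n`!%:R)^-1 *: \sum_(k < n.+1)
    ((2 ^+ k * k`!%:R)^-1 * pochhammer (- n%:R) k
       * pochhammer (g + d + n%:R + 1) k
       * pochhammer (g + k%:R + 1) (n - k)) *: (1 - 'X) ^+ k.

(* The coefficient of 'X^k is (-1)^k binom(n + z, n - k) / k!, the generalized
   binomial coefficient being (z + k + 1)_(n - k) / (n - k)!. *)
Definition laguerre z n : {poly R} :=
  \sum_(k < n.+1)
    ((-1) ^+ k * (pochhammer (z + k%:R + 1) (n - k) / (n - k)`!%:R)
       / k`!%:R) *: 'X^k.

End ClassicalPolynomials.

Section SpinModel.
Variables (R : realType) (N : nat) (hN : (2 < N)%N).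

(* twoM is 2M; the value j : 'I_twoM.+1 of a component encodes s_i = j - M. *)
Variable twoM : nat.

Definition coords := 'rV[R]_N.
Definition spincfg := {ffun 'I_N -> 'I_twoM.+1}.

(* A spin vector is the function giving its coefficients in the basis
   |s_1 ... s_N>. *)
Definition Sigma := {ffun spincfg -> R[i]}.
Definition wavefun := coords -> Sigma.

Implicit Types (x : coords) (s u v : Sigma) (F : wavefun) (i j : 'I_N).

Definition first : 'I_N := Ordinal (ltnW (ltnW hN)).
Definition second : 'I_N := Ordinal (ltnW hN).

Definition config x : Prop := forall i j, (i < j)%N -> x 0 i < x 0 j.

Definition xbar x : R := N%:R^-1 * \sum_i x 0 i.
Definition rsq x : R := \sum_i x 0 i ^+ 2.
Definition cubes x : R := \sum_i x 0 i ^+ 3.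

(* p moves the component in position k to position p k: it sends the basis
   vector |c o p> to |c>. *)
Definition spin_perm (p : 'S_N) s : Sigma :=
  [ffun c : spincfg => s [ffun k => c (p k)]].

Definition spin_swap i j s : Sigma := spin_perm (tperm i j) s.

Definition Lambda F : wavefun := fun x =>
  (N`!%:R)^-1 *: \sum_(p : 'S_N) spin_perm p (F (col_perm p x)).

Definition splus s i j : Sigma :=
  (N`!%:R)^-1 *: \sum_(p : 'S_N | (p first == i) && (p second == j))
    spin_perm p (s + spin_swap first second s).

Definition Sigma' s : Prop :=
  exists u, forall x, \sum_i splus s i (ordS i) = Lambda (fun=> u) x.

(* The partial derivative, computed on the real and imaginary parts of each
   spin component. *)
Definition dpart i F : wavefun := fun x =>
  [ffun c : spincfg =>
     ('D_(delta_mx 0 i) (fun y : coords => complex.Re (F y c)) x)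
     +i* ('D_(delta_mx 0 i) (fun y : coords => complex.Im (F y c)) x)].

(* All iterated partial derivatives exist and are differentiable, hence
   continuous, at each point of the (open) configuration space. *)
Definition smooth F : Prop :=
  forall (l : seq 'I_N) (c : spincfg) x, config x ->
    differentiable (fun y : coords => complex.Re (foldr dpart F l y c)) x /\
    differentiable (fun y : coords => complex.Im (foldr dpart F l y c)) x.

Variables a omega : R.

Definition H0 F : wavefun := fun x =>
  - (\sum_i dpart i (dpart i F) x)
  + (omega ^+ 2 * rsq x)%:C *: F x
  + (\sum_i 2 * a ^+ 2 / ((x 0 i - x 0 (ord_pred i))
                          * (x 0 i - x 0 (ordS i))))%:C *: F x
  + \sum_i (2 * a / (x 0 i - x 0 (ordS i)) ^+ 2)%:C *:
      (a%:C *: F x - spin_swap i (ordS i) (F x)).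

Definition mu x : R :=
  expR (- (omega / 2) * rsq x) * \prod_i `|x 0 i - x 0 (ordS i)| `^ a.

Definition E0 : R := N%:R * omega * (2 * a + 1).
Definition E l m : R := E0 + 2 * omega * (2 * l + m)%:R.

(* The zero function is not excluded. *)
Definition eigenfunction F (e : R) : Prop :=
  smooth F /\ forall x, config x -> H0 F x = e%:C *: F x.

Definition Phi k s : wavefun := Lambda (fun x => (x 0 first ^+ k)%:C *: s).
Definition Phi2t s : wavefun :=
  Lambda (fun x => (x 0 first * x 0 second)%:C *: s).
Definition Phi3h s : wavefun :=
  Lambda (fun x =>
    (x 0 first * x 0 second * (x 0 first - x 0 second))%:C *: s).

(* The homogeneous polynomial xbar^d p(t), t = 2 r^2 / (N xbar^2) - 1, for p of
   degree at most d/2; see xbar_timesE. *)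
Definition xbar_times (d : nat) (p : {poly R}) x : R :=
  \sum_(k < size p)
    p`_k * (2 * rsq x / N%:R - xbar x ^+ 2) ^+ k * xbar x ^+ (d - 2 * k).

Lemma xbar_timesE (d : nat) (p : {poly R}) x :
  xbar x != 0 -> (size p <= (d./2).+1)%N ->
  xbar_times d p x = xbar x ^+ d * p.[2 * rsq x / (N%:R * xbar x ^+ 2) - 1].
Proof.
move=> x0 sp; rewrite horner_coef mulr_sumr; apply: eq_bigr => k _.
have kj : (2 * k <= d)%N.
  by rewrite mul2n -geq_half_double -ltnS (leq_trans (ltn_ord k) sp).
have -> : 2 * rsq x / N%:R - xbar x ^+ 2 =
    xbar x ^+ 2 * (2 * rsq x / (N%:R * xbar x ^+ 2) - 1).
  have N0 : N%:R != 0 :> R by rewrite pnatr_eq0 -lt0n (ltn_trans _ hN).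
  by field; rewrite x0 N0.
rewrite exprMn -exprM -[in RHS](subnK kj) exprD.
ring.
Qed.

Definition alpha : R := N%:R * (a + 2^-1) - 3 / 2.
Definition beta (m : nat) : R := 1 - m%:R - N%:R * (a + 2^-1).

(* P_n^(alpha + b, beta(m) + c) *)
Definition P (m : nat) (b c : R) n : {poly R} :=
  jacobi (alpha + b) (beta m + c) n.

Definition varphi_even (m : nat) : {poly R} :=
  ((m%:R + 2 * alpha + 2) / (m%:R - 1)) *: P m 2 (-2) (m./2)
  - P m 3 (-1) (m./2 - 1)
  - ((4 * alpha + 7) / (m%:R - 1)) *: P m 2 (-1) (m./2 - 1)
  + 3^-1 *: P m 3 0 (m./2 - 2).

Definition phi_even (m : nat) : {poly R} :=
  P m 4 (-1) (m./2 - 1)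
  - 2 *: P m 3 (-1) (m./2 - 1)
  - ((m%:R + 2 * alpha + 3) / ((m%:R - 1) * (m%:R - 3)))
      *: P m 2 (-1) (m./2 - 1)
  - 3^-1 *: P m 4 0 (m./2 - 2)
  + ((m%:R + 2 * alpha - 1) / (m%:R - 3)) *: P m 3 0 (m./2 - 2).

Definition chi_even (m : nat) : {poly R} :=
  ((3 * m%:R + 2 * alpha) / ((m%:R - 1) * (m%:R - 3)))
    *: P m 2 (-1) (m./2 - 1)
  + ((2 * m%:R - 7) / (m%:R - 3)) *: P m 3 (-1) (m./2 - 1)
  - P m 4 (-1) (m./2 - 1)
  - ((m%:R + 2 * alpha + 2) / ((m%:R - 1) * (m%:R - 3)))
      *: P m 2 0 (m./2 - 2)
  - ((m%:R + 2 * alpha) / (m%:R - 3)) *: P m 3 0 (m./2 - 2)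
  + 3^-1 *: P m 4 0 (m./2 - 2).

Definition varphi_odd (m : nat) : {poly R} :=
  2 *: P m 2 (-1) (m.-1)./2
  - P m 3 (-1) (m.-1)./2
  + 3^-1 *: P m 3 0 (m - 3)./2
  + ((m%:R + 2 * alpha + 2) / (m%:R * (m%:R - 2))) *: P m 1 0 (m - 3)./2
  - ((m%:R + 2 * alpha + 2) / (m%:R - 2)) *: P m 2 0 (m - 3)./2.

Definition phi_odd (m : nat) : {poly R} :=
  P m 4 (-1) (m - 3)./2
  - ((2 * m%:R - 5) / (m%:R - 2)) *: P m 3 (-1) (m - 3)./2
  - 3^-1 *: P m 4 0 (m - 5)./2
  + ((m%:R + 2 * alpha - 1) / (m%:R - 2)) *: P m 3 0 (m - 5)./2.

Definition chi_odd (m : nat) : {poly R} :=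
  ((2 * m%:R - 3) / (m%:R * (m%:R - 2))) *: P m 2 (-1) (m - 3)./2
  + (2 * (m%:R - 3) / (m%:R - 2)) *: P m 3 (-1) (m - 3)./2
  - P m 4 (-1) (m - 3)./2
  - ((m%:R + 2 * alpha + 1) / (m%:R * (m%:R - 2))) *: P m 2 0 (m - 5)./2
  - ((m%:R + 2 * alpha) / (m%:R - 2)) *: P m 3 0 (m - 5)./2
  + 3^-1 *: P m 4 0 (m - 5)./2.

Definition varphi m : {poly R} := if odd m then varphi_odd m else varphi_even m.
Definition phi m : {poly R} := if odd m then phi_odd m else phi_even m.
Definition chi m : {poly R} := if odd m then chi_odd m else chi_even m.

(* mu L_l^(-beta)(omega r^2) *)
Definition radial (l m : nat) x : R :=
  mu x * (laguerre (- beta m) l).[omega * rsq x].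

(* In the eigenfunctions below the powers of xbar are distributed over the
   bracket, so that each product xbar^d p(t) is the polynomial xbar_times d p;
   an index [m/2] - 1 or [(m-3)/2] is a natural number for the admissible m. *)

Definition Psi0 l m s : wavefun := fun x =>
  (radial l m x)%:C *: ((xbar_times m (P m 0 0 m./2) x)%:C *: Phi 0 s x).

Definition Psi1 l m s : wavefun := fun x =>
  (radial l m x)%:C *:
    ((xbar_times (m - 1) (P m 1 0 (m - 1)./2) x)%:C *:
       (Phi 1 s x - (xbar x)%:C *: Phi 0 s x)).

Definition Psi2 l m s : wavefun := fun x =>
  (radial l m x)%:C *:
    ((xbar_times (m - 2) (P m 2 0 (m./2 - 1)) x)%:C *:
       (Phi 2 s x - (2 * xbar x)%:C *: Phi 1 s x)
     + (xbar_times m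
          (P m 2 0 (m./2 - 1)
           - (2 * (alpha + 1) / (2 * ((m - 1)./2)%:R + 1))
               *: P m 1 0 (m./2 - 1)) x)%:C *: Phi 0 s x).

Definition Psi2t l m s : wavefun := fun x =>
  (radial l m x)%:C *:
    ((xbar_times (m - 2) (P m 2 0 (m./2 - 1)) x)%:C *:
       (Phi2t s x - (2 * xbar x)%:C *: Phi 1 s x)
     + (xbar_times m
          (P m 2 0 (m./2 - 1)
           + (2 * (alpha + 1) / ((2 * ((m - 1)./2)%:R + 1) * (N%:R - 1)))
               *: P m 1 0 (m./2 - 1)) x)%:C *: Phi 0 s x).

Definition Psi3 l m s : wavefun := fun x =>
  (radial l m x)%:C *:
    ((2 / (3 * N%:R) * xbar_times (m - 3) (P m 3 0 (m - 3)./2) x * cubes x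
      + xbar_times m (varphi m) x)%:C *: Phi 0 s x).

Definition Psi3h l m s : wavefun := fun x =>
  (radial l m x)%:C *:
    ((xbar_times (m - 3) (P m 3 0 (m - 3)./2) x)%:C *:
       (Phi3h s x - (2 * xbar x)%:C *: Phi 2 s x)
     + (2 * xbar_times (m - 1)
          (P m 3 0 (m - 3)./2
           + (2 * (alpha + 2) / (2 * (m./2)%:R - 1))
               *: P m 2 0 (m - 3)./2) x)%:C *: Phi 1 s x
     - (2 * xbar_times m
          (3^-1 *: P m 3 0 (m - 3)./2
           + (2 * (m./2)%:R - 1)^-1 *: P m 2 0 (m - 3)./2
           + ((2 * alpha + 3) / (m%:R * (m%:R - 2)) * (odd m)%:R)
               *: P m 1 0 (m - 3)./2) x)%:C *: Phi 0 s x).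

Definition Psi4 l m s : wavefun := fun x =>
  (radial l m x)%:C *:
    ((3 / (2 * (((m - 3)./2)%:R + 2^-1))
        * xbar_times (m - 2) (P m 3 0 (m./2 - 2)) x)%:C *: Phi 2 s x
     + (3 / 2 * xbar_times (m - 1) (phi m) x
        - N%:R^-1 * xbar_times (m - 4) (P m 4 0 (m./2 - 2)) x * cubes x)%:C
         *: Phi 1 s x
     + (N%:R^-1 * xbar_times (m - 3) (P m 4 0 (m./2 - 2)) x * cubes x
        + 3 / 2 * xbar_times m (chi m) x)%:C *: Phi 0 s x).

Inductive spin_eigenfamily (l m : nat) : wavefun -> Prop :=
| Fam0 s : spin_eigenfamily l m (Psi0 l m s)
| Fam1 s of (1 <= m)%N : spin_eigenfamily l m (Psi1 l m s)
| Fam2 s of (2 <= m)%N : spin_eigenfamily l m (Psi2 l m s)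
| Fam2t s of (2 <= m)%N & spin_swap first second s = s & Sigma' s :
    spin_eigenfamily l m (Psi2t l m s)
| Fam3 s of (3 <= m)%N : spin_eigenfamily l m (Psi3 l m s)
| Fam3h s of (3 <= m)%N & spin_swap first second s = - s :
    spin_eigenfamily l m (Psi3h l m s)
| Fam4 s of (4 <= m)%N : spin_eigenfamily l m (Psi4 l m s).

(* Complex linear span, for functions on the configuration space. *)
Definition lin_span (G : wavefun -> Prop) F : Prop :=
  exists (k : nat) (c : 'I_k -> R[i]) (g : 'I_k -> wavefun),
    (forall i : 'I_k, G (g i)) /\
    forall x, config x -> F x = \sum_(i < k) c i *: g i x.

Definition psum_fun n (f : PowerSums.poly_in R[i] n) x : R[i] :=
  PowerSums.eval (PowerSums.of_psums N f) (fun i => (x 0 i)%:C).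

(* deg f(sigma_1, ..., sigma_n) <= d - k, read as f = 0 when d < k. *)
Definition deg_le n (f : PowerSums.poly_in R[i] n) (d k : nat) : bool :=
  PowerSums.deg_lt (PowerSums.of_psums N f) (d.+1 - k).

Inductive Hspace_gen (n : nat) : wavefun -> Prop :=
| Gen_f (f : PowerSums.poly_in R[i] 3) s of
    PowerSums.d33_eq0 f & deg_le f n 0 :
    Hspace_gen n (fun x => psum_fun f x *: Phi 0 s x)
| Gen_g (g : PowerSums.poly_in R[i] 3) s of
    PowerSums.d33_eq0 g & deg_le g n 1 :
    Hspace_gen n (fun x => psum_fun g x *: Phi 1 s x)
| Gen_h (h : PowerSums.poly_in R[i] 2) s of deg_le h n 2 :
    Hspace_gen n (fun x => psum_fun h x *: Phi 2 s x)
| Gen_ht (h : PowerSums.poly_in R[i] 2) s of deg_le h n 2 & Sigma' s :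
    Hspace_gen n (fun x => psum_fun h x *: Phi2t s x)
| Gen_w (w : PowerSums.poly_in R[i] 2) s of deg_le w n 3 :
    Hspace_gen n (fun x => psum_fun w x *: Phi3h s x).

Definition Hspace (n : nat) : wavefun -> Prop := lin_span (Hspace_gen n).

Definition mu_Hspace (n : nat) F : Prop :=
  exists2 G, Hspace n G & forall x, config x -> F x = (mu x)%:C *: G x.

End SpinModel.

(* Main.v *)
(* Conjugating by mu turns H0, on symmetric states, into E0 + 2 omega eul - T0,
   with eul the Euler operator and T0 a second order differential-difference
   operator on scalar polynomials that lowers degrees by two.  A T0-harmonic
   state homogeneous of degree m, multiplied by a Laguerre polynomial in r^2,
   is thus an eigenstate.  If q is a translation-invariant harmonic polynomial
   of degree d, T0 acts on (polynomial in xbar and r^2) q as a hypergeometric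
   operator, so that xbar^(m-d) P^(alpha+d,beta)_[(m-d)/2](t) q is harmonic;
   the seven families are linear combinations of such products, by contiguity
   relations between Jacobi polynomials.
   As beta(m) < - m, the leading Jacobi polynomials do not vanish at t = -1, where
   r^2 = 0.  The families in degree m are therefore triangular, with nonzero
   diagonal, in the generators of the invariant space modulo multiples of r^2,
   and completeness follows by induction on the degree. *)

Require Import Defs.
From mathcomp Require Import all_boot all_order all_algebra all_fingroup.
From mathcomp Require Import zify ring lra complex.
From mathcomp Require mpoly.

Set Implicit Arguments.
Unset Strict Implicit.
Unset Printing Implicit Defensive.
Import GRing.Theory Num.Theory.
Local Open Scope ring_scope.

(** * The scalar operator *)

Module ScalarOperator.
Import mpoly.

Section Operator.
Variables (R : realFieldType) (N : nat) (hN : (2 < N)%N) (a : R).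
Local Notation poly_x := {mpoly R[N]}.
Implicit Types (f g p q : poly_x) (i j k : 'I_N) (x : 'I_N -> R).

(** Symmetrization makes the problem scalar: Lambda (G |s>) is a sum over permutations p of the spin
    vectors p|s>, with coefficients G evaluated on permuted coordinates, and on such sums a spin
    exchange acts as an exchange of coordinates in the coefficients. The vectors p|s> may be
    linearly dependent, however, so harmonicity is required of the whole sum and not of each
    coefficient. This matters for x_1 x_2 only: interactions couple neighbours alone, hence T0 sees
    whether two sites are adjacent, and the condition defining Sigma' is what allows the adjacency
    to be replaced by its average 1 / (N - 1). Two systems of variables are used. For the
    eigenfunctions they are xbar and the variance v = r^2 / N - xbar^2, whose gradients are
    orthogonal; there t = 1 + 2 v / xbar^2, and all Jacobi identities are proved in w = v / xbar^2.
    For completeness they are xbar and r^2, with t + 1 = 2 r^2 / (N xbar^2). Invariance of the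
    spaces under H0 is a consequence of their being spanned by eigenfunctions. *)

Definition ev q x : R := q.@[x].
Definition dv i q : poly_x := q^`M(i).
Definition var i : poly_x := 'X_i.
Definition scal (c : R) : poly_x := c%:MP.

Lemma evD p q x : ev (p + q) x = ev p x + ev q x. Proof. exact: mevalD. Qed.
Lemma evN p x : ev (- p) x = - ev p x. Proof. exact: mevalN. Qed.
Lemma evB p q x : ev (p - q) x = ev p x - ev q x. Proof. exact: mevalB. Qed.
Lemma evM p q x : ev (p * q) x = ev p x * ev q x. Proof. exact: mevalM. Qed.
Lemma evZ c p x : ev (c *: p) x = c * ev p x. Proof. exact: mevalZ. Qed.
Lemma ev1 x : ev 1 x = 1. Proof. exact: meval1. Qed.
Lemma ev0 x : ev 0 x = 0. Proof. exact: meval0. Qed.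
Lemma evV i x : ev (var i) x = x i. Proof. exact: mevalXU. Qed.
Lemma evC c x : ev (scal c) x = c. Proof. exact: mevalC. Qed.
Lemma evX p n x : ev (p ^+ n) x = ev p x ^+ n.
Proof. by elim: n => [|n IH]; rewrite ?expr0 ?ev1 // !exprS evM IH. Qed.
Lemma ev_nat n x : ev n%:R x = n%:R.
Proof. by elim: n => [|n IH]; rewrite ?ev0 // !mulrS evD ev1 IH. Qed.
Lemma ev_sum (I : Type) (r : seq I) (P : pred I) F x :
  ev (\sum_(i <- r | P i) F i) x = \sum_(i <- r | P i) ev (F i) x.
Proof.
by elim/big_rec2: _ => [|i u w _ <-]; rewrite ?ev0 ?evD.
Qed.
Definition evE := (evD, evB, evN, evZ, evM, evX, ev1, ev0, evV, evC, ev_nat).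

Lemma dvD i p q : dv i (p + q) = dv i p + dv i q. Proof. exact: mderivD. Qed.
Lemma dvN i p : dv i (- p) = - dv i p. Proof. exact: mderivN. Qed.
Lemma dvB i p q : dv i (p - q) = dv i p - dv i q. Proof. exact: mderivB. Qed.
Lemma dvZ i c p : dv i (c *: p) = c *: dv i p. Proof. exact: mderivZ. Qed.
Lemma dvM i p q : dv i (p * q) = dv i p * q + p * dv i q.
Proof. exact: mderivM. Qed.
Lemma dv0 i : dv i 0 = 0. Proof. exact: mderiv0. Qed.
Lemma dvC i c : dv i (scal c) = 0. Proof. exact: mderivC. Qed.
Lemma dv1 i : dv i 1 = 0. Proof. by rewrite -[1]mpolyC1 dvC. Qed.
Lemma dvV i j : dv i (var j) = (i == j)%:R.
Proof.
rewrite /dv /var mderivX mnm1E eq_sym.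
case: eqP => [->|_]; last by rewrite scale0r.
have -> : (U_(j) - U_(j) = 0%MM :> 'X_{1..N})%MM.
  by apply/mnmP => l; rewrite mnmBE subnn mnm0E.
by rewrite mpolyX0 scale1r.
Qed.
Lemma dv_sum i (I : Type) (r : seq I) (P : pred I) F :
  dv i (\sum_(l <- r | P l) F l) = \sum_(l <- r | P l) dv i (F l).
Proof. by elim/big_rec2: _ => [|l u w _ <-]; rewrite ?dv0 ?dvD. Qed.
Lemma dvX i p n : dv i (p ^+ n) = n%:R * p ^+ n.-1 * dv i p.
Proof.
elim: n => [|n IH]; first by rewrite expr0 dv1 !mul0r.
rewrite exprS dvM IH; case: n {IH} => [|n] /=; first by rewrite expr0; ring.
by rewrite exprS [n.+2%:R]mulrS; ring.
Qed.

Lemma poly_ind (P : poly_x -> Prop) :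
  (forall c, P (scal c)) -> (forall i, P (var i)) ->
  (forall p q, P p -> P q -> P (p + q)) ->
  (forall p q, P p -> P q -> P (p * q)) -> forall p, P p.
Proof.
move=> Pc Pv PD PM; elim/mpolyind => [|c m p _ _ Pp].
  by rewrite -mpolyC0; exact: Pc.
apply: (PD) => //; rewrite -mul_mpolyC; apply: (PM); first exact: Pc.
rewrite mpolyXE_id; apply: (big_ind P) => //; first by rewrite -mpolyC1; exact: Pc.
move=> i _; elim: (m i) => [|n IH]; first by rewrite expr0 -mpolyC1; exact: Pc.
by rewrite exprS; apply: (PM) => //; exact: Pv.
Qed.

Definition sw (s : 'S_N) q : poly_x := msym s q.
Lemma swD s p q : sw s (p + q) = sw s p + sw s q. Proof. exact: msymD. Qed.
Lemma swB s p q : sw s (p - q) = sw s p - sw s q. Proof. exact: msymB. Qed.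
Lemma swM s p q : sw s (p * q) = sw s p * sw s q. Proof. exact: msymM. Qed.
Lemma swZ s c p : sw s (c *: p) = c *: sw s p. Proof. exact: msymZ. Qed.
Lemma sw1 s : sw s 1 = 1. Proof. exact: msym1. Qed.
Lemma sw0 s : sw s 0 = 0. Proof. exact: msym0. Qed.
Lemma swV s i : sw s (var i) = var (s i).
Proof. by rewrite /sw /msym /var mmapX mmap1U. Qed.
Lemma swX s p n : sw s (p ^+ n) = sw s p ^+ n.
Proof. by elim: n => [|n IH]; rewrite ?expr0 ?sw1 // !exprS swM IH. Qed.
Lemma sw_sum s (I : Type) (r : seq I) (P : pred I) F :
  sw s (\sum_(l <- r | P l) F l) = \sum_(l <- r | P l) sw s (F l).
Proof. by elim/big_rec2: _ => [|l u w _ <-]; rewrite ?sw0 ?swD. Qed.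

Definition symm f := forall s, sw s f = f.
Lemma symmM f g : symm f -> symm g -> symm (f * g).
Proof. by move=> hf hg s; rewrite swM hf hg. Qed.
Lemma symmZ c f : symm f -> symm (c *: f).
Proof. by move=> hf s; rewrite swZ hf. Qed.
Lemma symmB f g : symm f -> symm g -> symm (f - g).
Proof. by move=> hf hg s; rewrite swB hf hg. Qed.
Lemma symmX f n : symm f -> symm (f ^+ n).
Proof. by move=> hf s; rewrite swX hf. Qed.
Lemma symm1 : symm 1. Proof. by move=> s; rewrite sw1. Qed.

Definition xb : poly_x := N%:R^-1 *: \sum_i var i.
Definition s2 : poly_x := \sum_i var i ^+ 2.
Definition s3 : poly_x := \sum_i var i ^+ 3.
(** The variance of the coordinates. It is translation-invariant, so its gradient is orthogonal to
    that of [xb], and t = 1 + 2 vv / xb^2. *)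
Definition vv : poly_x := N%:R^-1 *: s2 - xb ^+ 2.
(* sum_i (x_i - xb)^3, in terms of power sums. *)
Definition c3 : poly_x := s3 - (3 * N%:R) *: (xb * vv) - N%:R *: xb ^+ 3.

Lemma symm_psum (k : nat) : symm (\sum_(i < N) var i ^+ k).
Proof.
move=> s; rewrite sw_sum [RHS](reindex_inj (@perm_inj _ s)) /=.
by apply: eq_bigr => i _; rewrite swX swV.
Qed.
Lemma symm_xb : symm xb.
Proof.
apply: symmZ; have := symm_psum 1.
by under eq_bigr do rewrite expr1.
Qed.
Lemma symm_s2 : symm s2. Proof. exact: symm_psum. Qed.
Lemma symm_s3 : symm s3. Proof. exact: symm_psum. Qed.
Lemma symm_vv : symm vv.
Proof. by apply: symmB; [apply/symmZ/symm_s2 | apply/symmX/symm_xb]. Qed.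
Lemma symm_c3 : symm c3.
Proof.
apply: symmB; last by apply/symmZ/symmX/symm_xb.
apply: symmB; first exact: symm_s3.
by apply/symmZ/symmM; [exact: symm_xb | exact: symm_vv].
Qed.

Definition al : R := N%:R * (a + 2^-1) - 3 / 2.

Lemma N_neq0 : N%:R != 0 :> R.
Proof. by rewrite pnatr_eq0 -lt0n (ltn_trans _ hN). Qed.
Lemma dv_xb i : dv i xb = scal N%:R^-1.
Proof.
rewrite dvZ dv_sum (bigD1 i) //= dvV eqxx big1 ?addr0 => [|j /negPf ji].
  by rewrite -mul_mpolyC mulr1.
by rewrite dvV eq_sym ji.
Qed.
Lemma dv_psum i (k : nat) : dv i (\sum_(j < N) var j ^+ k) = k%:R * var i ^+ k.-1.
Proof.
rewrite dv_sum (bigD1 i) //= big1 ?addr0 => [|j /negPf ji].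
  by rewrite dvX dvV eqxx mulr1.
by rewrite dvX dvV eq_sym ji mulr0.
Qed.
Lemma dv_nat i n : dv i n%:R = 0.
Proof. by elim: n => [|n IH]; rewrite ?dv0 // mulrS dvD dv1 IH addr0. Qed.

Lemma ordS_neq i : ordS i != i.
Proof.
rewrite -val_eqE /=; case: (ltngtP i.+1 N) (ltn_ord i) => // h _.
- by rewrite modn_small // gtn_eqF.
- by rewrite h modnn; apply/eqP => i0; move: h hN; rewrite -i0 => <-.
Qed.

(* The translation-invariant, T0-harmonic polynomials (harmonic only after
   averaging for q2t, where Sigma' is needed) from which all families arise. *)
Definition yy j : poly_x := var j - xb.
Definition q2 j : poly_x := yy j ^+ 2 - vv.
Definition q2t j k : poly_x := yy j * yy k + (N%:R - 1)^-1 *: vv.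
Definition q3h j k : poly_x := (yy j - yy k) * (yy j * yy k + vv).
Definition q4 j : poly_x :=
  c3 * yy j - (3 * N%:R / (2 * (al + 3))) *: (vv * q2 j).

Lemma sw_yy s j : sw s (yy j) = yy (s j).
Proof. by rewrite swB swV symm_xb. Qed.
Lemma sw_q2 s j : sw s (q2 j) = q2 (s j).
Proof. by rewrite /q2 swB swX sw_yy symm_vv. Qed.
Lemma sw_q2t s j k : sw s (q2t j k) = q2t (s j) (s k).
Proof. by rewrite /q2t swD swM swZ !sw_yy symm_vv. Qed.
Lemma sw_q3h s j k : sw s (q3h j k) = q3h (s j) (s k).
Proof. by rewrite /q3h swM swB !sw_yy swD swM !sw_yy symm_vv. Qed.
Lemma sw_q4 s j : sw s (q4 j) = q4 (s j).
Proof. by rewrite /q4 swB swZ !swM sw_yy sw_q2 symm_vv symm_c3. Qed.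

(** The homogenization xb^e c(vv / xb^2). The exponent e - 2k is a true difference only when c has
    degree at most e/2, whence the bounds on [size c] below. *)
Definition hom (e : nat) (c : {poly R}) : poly_x :=
  \sum_(k < size c) c`_k *: (xb ^+ (e - 2 * k) * vv ^+ k).
Definition rad (om : R) (c : {poly R}) : poly_x :=
  \sum_(k < size c) (c`_k * om ^+ k) *: s2 ^+ k.

Lemma sum_size_widen (V : lmodType R) (c : {poly R}) n (F : nat -> V) :
  (size c <= n)%N -> \sum_(k < size c) c`_k *: F k = \sum_(k < n) c`_k *: F k.
Proof.
move=> cn; rewrite -(big_mkord xpredT (fun k : nat => c`_k *: F k)).
rewrite -(big_mkord xpredT (fun k : nat => c`_k *: F k)).
rewrite [RHS](big_cat_nat _ cn) //= [X in _ = _ + X]big1_seq ?addr0 // => k.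
by rewrite mem_index_iota => /andP[_ /andP[h _]]; rewrite nth_default ?scale0r.
Qed.
Lemma homE e (c : {poly R}) n : (size c <= n)%N ->
  hom e c = \sum_(k < n) c`_k *: (xb ^+ (e - 2 * k) * vv ^+ k).
Proof. exact: (sum_size_widen (fun k : nat => xb ^+ (e - 2 * k) * vv ^+ k)). Qed.
Lemma radE om (c : {poly R}) n : (size c <= n)%N ->
  rad om c = \sum_(k < n) (c`_k * om ^+ k) *: s2 ^+ k.
Proof.
move=> cn; under eq_bigr do rewrite -scalerA.
rewrite -(sum_size_widen (fun k : nat => om ^+ k *: s2 ^+ k) cn).
by apply: eq_bigr => k _; rewrite scalerA.
Qed.
Lemma symm_sum (I : Type) (r : seq I) (P : pred I) (F : I -> poly_x) :
  (forall i : I, symm (F i)) -> symm (\sum_(i <- r | P i) F i).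
Proof. by move=> h s; rewrite sw_sum; apply: eq_bigr => i _; rewrite h. Qed.
Lemma symm_hom e c : symm (hom e c).
Proof.
apply: symm_sum => k; apply/symmZ/symmM; apply: symmX; [exact: symm_xb|].
exact: symm_vv.
Qed.
Lemma symm_rad om c : symm (rad om c).
Proof. by apply: symm_sum => k; apply/symmZ/symmX/symm_s2. Qed.

(** * The conjugated Hamiltonian at a point with distinct neighbouring coordinates *)

Section AtPoint.
Variables (x : 'I_N -> R) (hx : forall i, x i != x (ordS i)).
Local Notation "[ q ]" := (ev q x).

Let dx i := x i - x (ordS i).
Let dx0 i : dx i != 0. Proof. by rewrite subr_eq0 hx. Qed.

(* mu^-1 H0 mu = E0 + 2 omega eul - T0 on symmetric states, where exchanging
   the coordinates i and i + 1 replaces the spin operator S_(i,i+1). *)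
Definition bond i q : R :=
  ([dv i q] - [dv (ordS i) q]) / dx i
  - ([q] - [sw (tperm i (ordS i)) q]) / dx i ^+ 2.
Definition T0 q : R :=
  \sum_i [dv i (dv i q)] + 2 * a * \sum_i bond i q.
Definition gam f g : R := \sum_i [dv i f] * [dv i g].
Definition eul q : R := \sum_i x i * [dv i q].

Lemma T0_linear c p q : T0 (c *: p + q) = c * T0 p + T0 q.
Proof.
rewrite /T0.
rewrite (eq_bigr (fun i => c * [dv i (dv i p)] + [dv i (dv i q)])); last first.
  by move=> i _; rewrite !(dvD, dvZ, evE).
rewrite [X in _ + _ * X](eq_bigr (fun i => c * bond i p + bond i q)); last first.
  by move=> i _; rewrite /bond !(dvD, dvZ, swD, swZ, evE); field; rewrite dx0.
by rewrite big_split [X in _ + _ * X]big_split /= -!mulr_sumr; ring.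
Qed.
Lemma T0D p q : T0 (p + q) = T0 p + T0 q.
Proof. by rewrite -[p]scale1r T0_linear mul1r scale1r. Qed.
Lemma T0_0 : T0 0 = 0.
Proof. by have := T0D 0 0; rewrite addr0 => /eqP; rewrite -subr_eq0 opprD addNKr oppr_eq0 => /eqP. Qed.
Lemma T0Z c p : T0 (c *: p) = c * T0 p.
Proof. by rewrite -[c *: p]addr0 T0_linear T0_0 addr0. Qed.
Lemma T0N p : T0 (- p) = - T0 p.
Proof. by rewrite -scaleN1r T0Z mulN1r. Qed.
Lemma T0B p q : T0 (p - q) = T0 p - T0 q.
Proof. by rewrite T0D T0N. Qed.
Lemma T0_sum (I : Type) (r : seq I) (P : pred I) F :
  T0 (\sum_(l <- r | P l) F l) = \sum_(l <- r | P l) T0 (F l).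
Proof. by elim/big_rec2: _ => [|l u w _ <-]; rewrite ?T0_0 ?T0D. Qed.

(** A symmetric f commutes with all exchanges, so [bond] obeys the Leibniz rule on f * q and the
    only cross term is the one of the Laplacian. *)
Lemma T0M f q : symm f -> T0 (f * q) = [f] * T0 q + [q] * T0 f + 2 * gam f q.
Proof.
move=> sf; rewrite /T0 /gam.
rewrite (eq_bigr (fun i => [f] * [dv i (dv i q)] + [q] * [dv i (dv i f)]
    + 2 * ([dv i f] * [dv i q]))); last first.
  by move=> i _; rewrite !(dvM, dvD, evE); ring.
rewrite [X in _ + _ * X = _](eq_bigr (fun i => [f] * bond i q + [q] * bond i f)); last first.
  by move=> i _; rewrite /bond !(dvM, swM, sf, evE); field; rewrite dx0.
rewrite [X in _ + _ * X = _]big_split [X in X + _ = _]big_split /=.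
by rewrite [X in X + _ + _ = _]big_split /= -!mulr_sumr; ring.
Qed.

Lemma gamC f g : gam f g = gam g f.
Proof. by apply: eq_bigr => i _; rewrite mulrC. Qed.
Lemma gamM f g q : gam f (g * q) = [g] * gam f q + [q] * gam f g.
Proof.
rewrite /gam !mulr_sumr -big_split /=; apply: eq_bigr => i _.
by rewrite dvM !evE; ring.
Qed.
Lemma gamD f g q : gam f (g + q) = gam f g + gam f q.
Proof. by rewrite /gam -big_split /=; apply: eq_bigr => i _; rewrite dvD !evE; ring. Qed.
Lemma gamB f g q : gam f (g - q) = gam f g - gam f q.
Proof. by rewrite /gam -sumrB /=; apply: eq_bigr => i _; rewrite dvB !evE; ring. Qed.
Lemma gamZ f c q : gam f (c *: q) = c * gam f q.
Proof. by rewrite /gam mulr_sumr; apply: eq_bigr => i _; rewrite dvZ !evE; ring. Qed.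
Lemma gamX f g n : gam f (g ^+ n) = n%:R * [g] ^+ n.-1 * gam f g.
Proof. by rewrite /gam mulr_sumr; apply: eq_bigr => i _; rewrite dvX !evE; ring. Qed.

Lemma eulD p q : eul (p + q) = eul p + eul q.
Proof. by rewrite /eul -big_split /=; apply: eq_bigr => i _; rewrite dvD !evE; ring. Qed.
Lemma eulB p q : eul (p - q) = eul p - eul q.
Proof. by rewrite /eul -sumrB /=; apply: eq_bigr => i _; rewrite dvB !evE; ring. Qed.
Lemma eulZ c p : eul (c *: p) = c * eul p.
Proof. by rewrite /eul mulr_sumr; apply: eq_bigr => i _; rewrite dvZ !evE; ring. Qed.
Lemma eulM p q : eul (p * q) = [p] * eul q + [q] * eul p.
Proof.
rewrite /eul !mulr_sumr -big_split /=; apply: eq_bigr => i _.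
by rewrite dvM !evE; ring.
Qed.
Lemma eul1 : eul 1 = 0.
Proof. by rewrite /eul big1 // => i _; rewrite dv1 ev0 mulr0. Qed.
Lemma eul0 : eul 0 = 0.
Proof. by rewrite /eul big1 // => i _; rewrite dv0 ev0 mulr0. Qed.
Lemma eulV i : eul (var i) = x i.
Proof.
rewrite /eul (bigD1 i) //= dvV eqxx ev1 mulr1 big1 ?addr0 // => j /negPf ji.
by rewrite dvV ji ev0 mulr0.
Qed.
Lemma eul_sum (I : Type) (r : seq I) (P : pred I) F :
  eul (\sum_(l <- r | P l) F l) = \sum_(l <- r | P l) eul (F l).
Proof. by elim/big_rec2: _ => [|l u w _ <-]; rewrite ?eul0 ?eulD. Qed.
Lemma eulX p n d : eul p = d%:R * [p] -> eul (p ^+ n) = (d * n)%:R * [p ^+ n].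
Proof.
move=> h; elim: n => [|n IH]; first by rewrite expr0 eul1 muln0 mul0r.
by rewrite exprS eulM IH h mulnS natrD !evE; ring.
Qed.

(** The predecessors of n are truncated only where the coefficient in front of the power is zero. *)
Lemma T0_exp f n : symm f ->
  T0 (f ^+ n) = n%:R * [f] ^+ n.-1 * T0 f
    + (n * n.-1)%:R * [f] ^+ n.-2 * gam f f.
Proof.
have T01 : T0 1 = 0.
  rewrite /T0 !big1 ?mulr0 ?addr0 // => i _; last by rewrite dv1 dv0 ev0.
  by rewrite /bond sw1 !dv1 !subrr !mul0r subrr.
move=> sf; elim: n => [|n IH]; first by rewrite expr0 T01 !mul0r addr0.
rewrite exprS T0M // IH gamX evX.
case: n {IH} => [|[|n]] /=; rewrite ?expr0; [ring|ring|].
by rewrite !exprS !natrM -[n.+3%:R]natr1 -[n.+2%:R]natr1; ring.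
Qed.

Let N0 := N_neq0.

Lemma sum_ordS (F : 'I_N -> R) : \sum_i F (ordS i) = \sum_i F i.
Proof. by rewrite [RHS](reindex_inj (can_inj (@ordSK N))). Qed.
Lemma sumr_ord_const (c : R) : \sum_(i < N) c = N%:R * c.
Proof. by rewrite sumr_const card_ord mulr_natl. Qed.

Lemma gam_xb q : gam xb q = N%:R^-1 * \sum_i [dv i q].
Proof. by rewrite mulr_sumr; apply: eq_bigr => i _; rewrite dv_xb evC. Qed.
Lemma gam_s2 q : gam s2 q = 2 * eul q.
Proof.
rewrite mulr_sumr; apply: eq_bigr => i _.
by rewrite dv_psum !evE /= ?expr0 ?expr1; ring.
Qed.
Lemma gam_vv q : gam vv q = N%:R^-1 * (2 * eul q) - 2 * [xb] * gam xb q.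
Proof.
rewrite gamC /vv gamB gamZ gamX /= expr1 gamC gam_s2 (gamC q xb).
by ring.
Qed.
Lemma eul_psum (k : nat) : eul (\sum_(i < N) var i ^+ k) = k%:R * [\sum_(i < N) var i ^+ k].
Proof.
rewrite eul_sum ev_sum mulr_sumr; apply: eq_bigr => i _.
by have := @eulX (var i) k 1%N; rewrite mul1n; apply; rewrite eulV evV mul1r.
Qed.
Lemma eul_xb : eul xb = [xb].
Proof. by rewrite eulZ eul_sum evZ ev_sum; under eq_bigr do rewrite eulV -evV. Qed.
Lemma eul_s2 : eul s2 = 2 * [s2]. Proof. exact: eul_psum. Qed.
Lemma eul_s3 : eul s3 = 3 * [s3]. Proof. exact: eul_psum. Qed.
Lemma eul_vv : eul vv = 2 * [vv].
Proof.
rewrite eulB eulZ eul_s2 (@eulX _ _ 1%N) ?mul1n ?mul1r ?eul_xb // !evE.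
by ring.
Qed.
Lemma eul_c3 : eul c3 = 3 * [c3].
Proof.
rewrite !eulB !eulZ eul_s3 (@eulX _ _ 1%N) ?mul1n ?mul1r ?eul_xb //.
by rewrite eulM eul_vv eul_xb !evE; ring.
Qed.
Lemma gam_xb_xb : gam xb xb = N%:R^-1.
Proof.
rewrite gam_xb (eq_bigr (fun=> N%:R^-1)) => [|i _]; last by rewrite dv_xb evC.
by rewrite sumr_ord_const; field.
Qed.
Lemma gam_xb_vv : gam xb vv = 0.
Proof. by rewrite gamC gam_vv gam_xb_xb eul_xb; field. Qed.
Lemma gam_vv_vv : gam vv vv = 4 / N%:R * [vv].
Proof. by rewrite gam_vv gam_xb_vv eul_vv; field. Qed.
Lemma gam_xb_s3 : gam xb s3 = 3 / N%:R * [s2].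
Proof.
rewrite gam_xb ev_sum !mulr_sumr; apply: eq_bigr => i _.
by rewrite dv_psum !evE /=; field.
Qed.
Lemma gam_xb_c3 : gam xb c3 = 0.
Proof.
rewrite !gamB !gamZ gam_xb_s3 gamM gamX gam_xb_vv gam_xb_xb /= !evE; field.
exact: N0.
Qed.

Lemma T0_xb : T0 xb = 0.
Proof.
rewrite /T0 !big1 ?mulr0 ?addr0 // => i _; last by rewrite dv_xb dvC ev0.
by rewrite /bond !dv_xb symm_xb !subrr !mul0r subrr.
Qed.
Lemma T0_s2 : T0 s2 = N%:R * 2 * (1 + 2 * a).
Proof.
rewrite /T0 (eq_bigr (fun=> 2)) => [|i _]; last first.
  by rewrite dv_psum dvM dv_nat dvX dvV eqxx !evE /= ?expr0 ?expr1; ring.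
rewrite [X in _ + _ * X = _](eq_bigr (fun=> 2)) => [|i _]; last first.
  by rewrite /bond /dx symm_s2 !dv_psum !evE /=; field; exact: dx0.
by rewrite !sumr_ord_const; ring.
Qed.
Lemma T0_s3 : T0 s3 = N%:R * 6 * (1 + 2 * a) * [xb].
Proof.
rewrite /T0 (eq_bigr (fun i => 6 * x i)) => [|i _]; last first.
  by rewrite dv_psum dvM dv_nat dvX dvV eqxx !evE /= ?expr0 ?expr1; ring.
rewrite [X in _ + _ * X = _](eq_bigr (fun i => 3 * (x i + x (ordS i)))) => [|i _]; last first.
  by rewrite /bond /dx symm_s3 !dv_psum !evE /=; field; exact: dx0.
rewrite -!mulr_sumr big_split /= sum_ordS /xb evZ ev_sum.
under [in RHS]eq_bigr do rewrite evV.
by field.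
Qed.
(** This value is the origin of alpha: the Laplacian and the bonds give 2 (1 + 2a) - 2 / N, which is
    4 / N times N (a + 1/2) - 1/2. *)
Lemma T0_vv : T0 vv = 4 / N%:R * (1 + al).
Proof.
rewrite T0B T0Z T0_s2 T0_exp ?T0_xb ?gam_xb_xb /=; last exact: symm_xb.
by rewrite /al ?expr0; field.
Qed.
Lemma T0_c3 : T0 c3 = 0.
Proof.
rewrite !T0B !T0Z T0_s3 T0_exp ?T0_xb ?gam_xb_xb /=; last exact: symm_xb.
rewrite T0M; last exact: symm_xb.
by rewrite T0_xb T0_vv gam_xb_vv /al; field.
Qed.

(** No mixed term appears, because the gradient of [xb] is orthogonal to those of [vv] and q. By
    Euler's formula the pairing of [vv] with q only adds the degree d to al, which is why the Jacobi
    parameter becomes alpha + d. *)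
Lemma T0_mono A B (d : nat) q : eul q = d%:R * [q] -> gam xb q = 0 ->
  T0 (xb ^+ A * vv ^+ B * q) =
    N%:R^-1 * ((A * A.-1)%:R * ([xb] ^+ A.-2 * [vv] ^+ B)
      + 4 * B%:R * (B%:R + al + d%:R) * ([xb] ^+ A * [vv] ^+ B.-1)) * [q]
    + [xb] ^+ A * [vv] ^+ B * T0 q.
Proof.
move=> dq tq.
have [sA sB] := (symmX A symm_xb, symmX B symm_vv).
rewrite T0M; last exact: symmM.
rewrite T0M // !T0_exp; [|exact: symm_xb|exact: symm_vv].
rewrite T0_xb gam_xb_xb T0_vv gam_vv_vv [gam _ q]gamC gamM !gamX.
rewrite (gamC _ xb) (gamC _ vv) tq (gamC _ vv) gamX (gamC vv xb) gam_xb_vv.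
rewrite gam_vv dq tq !evE.
case: B {sB} => [|[|B]] /=; rewrite ?expr0 ?expr1; [by field|by field|].
by rewrite !exprS !natrM -[B.+2%:R]natr1 -[B.+1%:R]natr1; field.
Qed.

(** The divided difference across the bond (i, i+1). It measures the failure of [bond] to be a
    derivation, see [bondM]. *)
Definition cd i q : R := ([q] - [sw (tperm i (ordS i)) q]) / dx i.
Definition del i j : R := (i == j)%:R - (ordS i == j)%:R.

Lemma bondM i p q :
  bond i (p * q) = [p] * bond i q + [q] * bond i p + cd i p * cd i q.
Proof.
rewrite /bond /cd /dx !(dvM, swM, evE).
by field; exact: dx0.
Qed.
Lemma bondB i p q : bond i (p - q) = bond i p - bond i q.
Proof. by rewrite /bond /dx !(dvB, swB, evE); field; exact: dx0. Qed.
(** The factor [[p] - cd i p * dx i] is the value of p after the exchange. *)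
Lemma cdM i p q :
  cd i (p * q) = cd i p * [q] + ([p] - cd i p * dx i) * cd i q.
Proof. by rewrite /cd /dx !(swM, evE); field; exact: dx0. Qed.
Lemma cd_var i j : cd i (var j) = del i j.
Proof.
rewrite /cd swV !evV /del; case: tpermP => [->|->|/eqP ji /eqP jSi].
- by rewrite eqxx (negPf (ordS_neq i)) subr0; exact: divff (dx0 i).
- rewrite eqxx [i == _]eq_sym (negPf (ordS_neq i)) sub0r -opprB mulNr.
  by congr (- _); exact: divff (dx0 i).
- by rewrite ![_ == j]eq_sym (negPf ji) (negPf jSi) !subrr mul0r.
Qed.
Lemma bond_var i j : bond i (var j) = 0.
Proof.
have := cd_var i j; rewrite /cd /bond !dvV !ev_nat -/(del i j) => <-.
by rewrite /dx; field; exact: dx0.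
Qed.
Lemma del_sqr i j : del i j ^+ 2 = (i == j)%:R + (ordS i == j)%:R.
Proof.
rewrite /del; case: eqP => [->|_]; case: eqP => [/eqP h|_] /=; try by ring.
by rewrite (negPf (ordS_neq _)) in h.
Qed.
Lemma sum_delta (j : 'I_N) : \sum_i (i == j)%:R = 1 :> R.
Proof.
by rewrite (bigD1 j) //= eqxx big1 ?addr0 // => i /negPf ->.
Qed.
Lemma sum_del_sqr j : \sum_i del i j ^+ 2 = 2.
Proof.
rewrite (eq_bigr _ (fun i _ => del_sqr i j)) big_split /= sum_delta.
by rewrite (sum_ordS (fun i => (i == j)%:R)) sum_delta.
Qed.

Lemma T0_var j : T0 (var j) = 0.
Proof.
rewrite /T0 !big1 ?mulr0 ?addr0 // => i _; first by rewrite bond_var.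
by rewrite dvV dv_nat ev0.
Qed.
Lemma T0_varX2 j : T0 (var j ^+ 2) = 2 + 4 * a.
Proof.
rewrite /T0 (eq_bigr (fun i => 2 * (i == j)%:R)) => [|i _]; last first.
  rewrite expr2 dvM !(dvD, dvM, dvV, dv_nat) !evE.
  by case: eqP => _ /=; ring.
rewrite [X in _ + _ * X = _](eq_bigr (fun i => del i j ^+ 2)) => [|i _]; last first.
  by rewrite expr2 bondM bond_var cd_var; ring.
by rewrite -mulr_sumr sum_delta sum_del_sqr; ring.
Qed.
(** Only a bond joining j and k contributes to the sum, and it contributes -1: the result depends on
    whether the two sites are neighbours. This is the obstruction that Sigma' removes. *)
Lemma T0_varM j k : j != k ->
  T0 (var j * var k) = 2 * a * \sum_i del i j * del i k.
Proof.
move=> jk; rewrite /T0 big1 ?add0r => [|i _].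
  by congr (_ * _); apply: eq_bigr => i _; rewrite bondM !bond_var !cd_var; ring.
rewrite !(dvD, dvM, dvV, dv_nat) !evE.
by case: eqP => [->|_]; rewrite ?(negPf jk) /=; ring.
Qed.
(** Here adjacency drops out: a bond joining j and k contributes x_k - x_j, the same as one bond
    touching j alone together with one touching k alone. *)
Lemma T0_varX2M j k : j != k ->
  T0 (var j * var k * (var j - var k)) = - (2 + 4 * a) * (x j - x k).
Proof.
move=> jk; rewrite /T0.
rewrite (eq_bigr (fun i => 2 * x k * (i == j)%:R - 2 * x j * (i == k)%:R)) => [|i _]; last first.
  rewrite !(dvD, dvN, dvM, dvV, dv_nat, dv0) !evE.
  by case: (i =P j) => [->|_]; rewrite ?(negPf jk) /=; case: (i =P k) => _ /=; ring.
rewrite [X in _ + _ * X = _](eq_bigr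
    (fun i => x k * del i j ^+ 2 - x j * del i k ^+ 2)) => [|i _]; last first.
  rewrite bondM bondB !bondM !bond_var !cdM !cd_var.
  have -> : cd i (var j - var k) = del i j - del i k.
    by rewrite -!cd_var /cd swB !evE -mulrBl; congr (_ * _); ring.
  rewrite !evE; have [ij|ij] := eqVneq i j; have [Sij|Sij] := eqVneq (ordS i) j.
  - by move: (ordS_neq i); rewrite Sij ij eqxx.
  - have [Sik|Sik] := eqVneq (ordS i) k.
      by rewrite -ij -Sik /del /dx !eqxx ![i == _]eq_sym (negPf (ordS_neq i)) /=; ring.
    by rewrite /del (negPf Sij) (negPf Sik) ij eqxx (negPf jk) /=; ring.
  - have [ik|ik] := eqVneq i k.
      by rewrite -Sij -ik /del /dx !eqxx ![i == _]eq_sym (negPf (ordS_neq i)) /=; ring.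
    by rewrite /del Sij (negPf ij) (negPf ik) eqxx (negPf jk) /dx Sij /=; ring.
  - by rewrite /del (negPf Sij) (negPf ij) /=; ring.
rewrite !sumrB -!mulr_sumr !sum_delta !sum_del_sqr; ring.
Qed.

Lemma gam_xb_var j : gam xb (var j) = N%:R^-1.
Proof.
rewrite gam_xb; under eq_bigr do rewrite dvV ev_nat.
by rewrite sum_delta mulr1.
Qed.
Lemma gam_xb_yy j : gam xb (yy j) = 0.
Proof. by rewrite gamB gam_xb_xb gam_xb_var subrr. Qed.
Lemma eul_yy j : eul (yy j) = [yy j].
Proof. by rewrite eulB eulV eul_xb !evE. Qed.
Lemma T0_yy j : T0 (yy j) = 0.
Proof. by rewrite T0B T0_xb T0_var subrr. Qed.

Lemma gam_xb_q2 j : gam xb (q2 j) = 0.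
Proof. by rewrite gamB gamX gam_xb_yy gam_xb_vv mulr0 subrr. Qed.
Lemma eul_q2 j : eul (q2 j) = 2 * [q2 j].
Proof.
by rewrite eulB (@eulX _ _ 1%N) ?mul1n ?mul1r ?eul_yy // eul_vv !evE; ring.
Qed.
Lemma T0_xbM q : T0 (xb * q) = [xb] * T0 q + 2 * gam xb q.
Proof. by rewrite T0M ?T0_xb ?mulr0 ?addr0 //; exact: symm_xb. Qed.
Lemma T0_xbX2 : T0 (xb ^+ 2) = 2 / N%:R.
Proof. by rewrite expr2 T0_xbM T0_xb gam_xb_xb mulr0 add0r. Qed.
Lemma T0_q2 j : T0 (q2 j) = 0.
Proof.
have -> : q2 j = var j ^+ 2 - 2 *: (xb * var j) + xb ^+ 2 - vv.
  by rewrite /q2 /yy -mul_mpolyC mpolyC_nat; ring.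
rewrite T0B T0D T0B T0Z T0_varX2 T0_xbX2 T0_xbM T0_var gam_xb_var T0_vv /al.
by field.
Qed.

Lemma gam_xb_q2t j k : gam xb (q2t j k) = 0.
Proof. by rewrite gamD gamM !gam_xb_yy gamZ gam_xb_vv !mulr0 !addr0. Qed.
Lemma eul_q2t j k : eul (q2t j k) = 2 * [q2t j k].
Proof. by rewrite eulD eulM !eul_yy eulZ eul_vv !evE; ring. Qed.
Let N1 : N%:R - 1 != 0 :> R.
Proof. by rewrite subr_eq0 pnatr_eq1 gtn_eqF // (ltn_trans _ hN). Qed.
(** The multiple of [vv] in [q2t] is chosen for the right-hand side to vanish on average: over
    ordered pairs of distinct sites, each of the two adjacencies has frequency 1 / (N - 1), so the
    sum has mean -2 / (N - 1). *)
Lemma T0_q2t j k : j != k ->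
  T0 (q2t j k) = 2 * a * (\sum_i del i j * del i k + 2 / (N%:R - 1)).
Proof.
move=> jk.
have -> : q2t j k = var j * var k - xb * var j - xb * var k + xb ^+ 2
   + (N%:R - 1)^-1 *: vv by rewrite /q2t /yy; ring.
rewrite !T0D !T0N T0Z T0_varM // T0_xbX2 !T0_xbM !T0_var !gam_xb_var T0_vv /al.
by field; rewrite N0 N1.
Qed.

Lemma gam_xb_q3h j k : gam xb (q3h j k) = 0.
Proof.
by rewrite gamM gamB gamD gamM !gam_xb_yy gam_xb_vv subr0 !mulr0 !addr0 mulr0.
Qed.
Lemma eul_q3h j k : eul (q3h j k) = 3 * [q3h j k].
Proof. by rewrite eulM eulB eulD eulM !eul_yy eul_vv !evE; ring. Qed.
Lemma T0_q3h j k : j != k -> T0 (q3h j k) = 0.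
Proof.
move=> jk.
have -> : q3h j k = var j * var k * (var j - var k)
   - xb * (var j ^+ 2 - var k ^+ 2) + xb ^+ 2 * (var j - var k)
   + vv * (var j - var k) by rewrite /q3h /yy; ring.
have g1 l n : gam xb (var l ^+ n) = n%:R * x l ^+ n.-1 / N%:R.
  by rewrite gamX gam_xb_var evV.
rewrite !T0D T0N T0_varX2M // T0_xbM T0B !T0_varX2 gamB !g1.
rewrite T0M; last by apply/symmX/symm_xb.
rewrite T0M; last exact: symm_vv.
have g2 : gam xb (var j - var k) = 0 by rewrite gamB !gam_xb_var subrr.
rewrite T0B !T0_var T0_xbX2 T0_vv (gamC (xb ^+ 2)) gamX (gamC _ xb) gam_vv g2.
rewrite eulB !eulV !evE /al /=; field.
exact: N0.
Qed.

Lemma gam_xb_q4 j : gam xb (q4 j) = 0.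
Proof.
rewrite gamB gamZ !gamM gam_xb_c3 gam_xb_yy gam_xb_vv gam_xb_q2.
by rewrite !mulr0 !addr0 mulr0 subr0.
Qed.
Lemma eul_q4 j : eul (q4 j) = 4 * [q4 j].
Proof. by rewrite eulB eulZ !eulM eul_c3 eul_yy eul_vv eul_q2 !evE; ring. Qed.
Lemma gam_var q j : gam (var j) q = [dv j q].
Proof.
rewrite /gam (bigD1 j) //= dvV eqxx ev1 mul1r big1 ?addr0 // => i /negPf ij.
by rewrite dvV ij ev0 mul0r.
Qed.
(** The product c3 * yy j misses harmonicity only by twice its gradient pairing, 6 q2. Since T0 (vv
    * q2) = (4 / N) (al + 3) q2, the correction with coefficient 3 N / (2 (al + 3)) cancels it. *)
Lemma T0_q4 j : al + 3 != 0 -> T0 (q4 j) = 0.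
Proof.
move=> al3.
rewrite T0B T0Z T0M; last exact: symm_c3.
rewrite T0M; last exact: symm_vv.
rewrite T0_yy T0_c3 T0_q2 T0_vv gam_vv gam_xb_q2 eul_q2.
have -> : gam c3 (yy j) = 3 * [q2 j].
  rewrite gamB [gam c3 xb]gamC gam_xb_c3 gamC gam_var.
  rewrite !(dvB, dvZ, dvM, dvX, dv_psum, dv_xb) !evE /=.
  by field.
by field; rewrite N0 al3.
Qed.

Lemma gamX_l f q n : gam (f ^+ n) q = n%:R * [f] ^+ n.-1 * gam f q.
Proof. by rewrite gamC gamX (gamC q). Qed.

Lemma eul_hom e (c : {poly R}) : (size c <= e./2.+1)%N -> eul (hom e c) = e%:R * [hom e c].
Proof.
move=> ce; rewrite (homE e ce) eul_sum ev_sum mulr_sumr.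
apply: eq_bigr => k _; have ke : (2 * k <= e)%N.
  by rewrite mul2n -geq_half_double -ltnS.
rewrite eulZ eulM (@eulX _ _ 2) ?eul_vv // (@eulX _ _ 1%N) ?eul_xb ?mul1r //.
have -> : e%:R = (e - 2 * k)%:R + (2 * k)%:R :> R by rewrite -natrD subnK.
by rewrite mul1n !evE; ring.
Qed.

(** The xb part of T0 on the term k and the vv part on the term k + 1 produce the same monomial; the
    hypothesis on the coefficients, a hypergeometric recurrence, says that they cancel. *)
Lemma T0_hom e (c : {poly R}) (d : nat) q :
    (size c <= e./2.+1)%N ->
    (forall k : nat, (k < e./2)%N ->
       c`_k * ((e - 2 * k) * (e - 2 * k).-1)%:R
         + 4 * k.+1%:R * (k.+1%:R + al + d%:R) * c`_k.+1 = 0) ->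
    eul q = d%:R * [q] -> gam xb q = 0 ->
  T0 (hom e c * q) = [hom e c] * T0 q.
Proof.
move=> ce cc dq tq; rewrite (homE e ce) mulr_suml T0_sum ev_sum mulr_suml.
pose A (k : nat) := c`_k * (N%:R^-1 * ((e - 2 * k) * (e - 2 * k).-1)%:R
  * ([xb] ^+ (e - 2 * k).-2 * [vv] ^+ k) * [q]).
pose B (k : nat) := c`_k * (N%:R^-1 * (4 * k%:R * (k%:R + al + d%:R))
  * ([xb] ^+ (e - 2 * k) * [vv] ^+ k.-1) * [q]).
rewrite (eq_bigr (fun k : 'I_ _ => (A k + B k) +
   [c`_k *: (xb ^+ (e - 2 * k) * vv ^+ k)] * T0 q)) => [|k _]; last first.
  by rewrite -scalerAl T0Z (T0_mono _ _ dq tq) [in RHS]evZ [in RHS]evM !evX /A /B; ring.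
rewrite big_split /= -[RHS]add0r; congr (_ + _).
rewrite big_split /= big_ord_recr /= [X in _ + X]big_ord_recl /=.
(* The difference e - 2 [e/2] is 0 or 1, so the second derivative in xb of the last term
   vanishes. *)
have -> : A e./2 = 0.
  rewrite /A; have -> : ((e - 2 * e./2) * (e - 2 * e./2).-1 = 0)%N.
    by rewrite -[X in (X - _)%N]odd_double_half mul2n addnK; case: (odd e).
  by rewrite mulr0 !mul0r mulr0.
have -> : B 0 = 0 by rewrite /B !(mulr0, mul0r).
rewrite addr0 add0r -big_split /= big1 // => k _; rewrite /bump /= add1n /A /B.
have -> : (e - 2 * k.+1 = (e - 2 * k).-2)%N by rewrite mulnS addnC subnDA subn2.
rewrite /=; have := cc k (ltn_ord k).
set u := [xb] ^+ _ * _; set s := (_ * _)%:R => h.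
transitivity ((c`_k * s + 4 * k.+1%:R * (k.+1%:R + al + d%:R) * c`_k.+1)
  * (N%:R^-1 * u * [q])); first by ring.
by rewrite h mul0r.
Qed.

(** [A k] is what 2 om eul leaves of the term k after subtraction of the eigenvalue, and [B k] is
    what T0 makes of the power s2^k. The recurrence identifies [A k] with [B k.+1], while [A L] and
    [B 0] are zero. *)
Lemma T0_rad om (c : {poly R}) (m L : nat) Q :
    (size c <= L.+1)%N ->
    (forall k : nat, (k < L)%N ->
       k.+1%:R * (N%:R * (a + 2^-1) + m%:R + k%:R) * c`_k.+1
         = (k%:R - L%:R) * c`_k) ->
    eul Q = m%:R * [Q] ->
  2 * om * eul (rad om c * Q) - T0 (rad om c * Q)
    = 2 * om * (2 * L + m)%:R * [rad om c * Q] - [rad om c] * T0 Q.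
Proof.
move=> cL cc mQ; rewrite (radE om cL) mulr_suml T0_sum eul_sum !ev_sum.
rewrite [X in _ = _ - X]mulr_suml [X in _ = X - _]mulr_sumr mulr_sumr -!sumrB.
pose A (k : nat) := 4 * om * (k%:R - L%:R) * c`_k * om ^+ k * [s2] ^+ k * [Q].
pose B (k : nat) := c`_k * om ^+ k * k%:R
  * (2 * N%:R * (1 + 2 * a) + 4 * k.-1%:R + 4 * m%:R) * [s2] ^+ k.-1 * [Q].
apply/eqP; rewrite -subr_eq0 -sumrB.
rewrite (eq_bigr (fun k : 'I_ _ => A k - B k)) => [|k _]; last first.
  rewrite -!scalerAl T0Z eulZ eulM (@eulX _ _ 2) ?eul_s2 // mQ.
  rewrite T0M; last exact/symmX/symm_s2.
  rewrite (T0_exp _ symm_s2) T0_s2 gam_s2 gamX_l gam_s2 eul_s2 mQ !evE /A /B.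
  case: (nat_of_ord k) => [|[|n]] /=; rewrite ?expr0 ?expr1.
  - by rewrite !natrD; ring.
  - by rewrite !natrD; ring.
  by rewrite !natrD !natrM !exprS; ring.
rewrite sumrB big_ord_recr /= [X in _ - X]big_ord_recl /=.
have -> : A L = 0 by rewrite /A subrr !(mulr0, mul0r).
have -> : B 0 = 0 by rewrite /B !(mulr0, mul0r).
rewrite addr0 add0r -sumrB /= big1 // => k _; rewrite /bump /= add1n /A /B /=.
transitivity (4 * om * om ^+ k * [s2] ^+ k * [Q] * ((k%:R - L%:R) * c`_k
   - k.+1%:R * (N%:R * (a + 2^-1) + m%:R + k%:R) * c`_k.+1)).
  by rewrite exprS; field.
by rewrite (cc _ (ltn_ord k)) subrr mulr0.
Qed.
End AtPoint.
End Operator.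
End ScalarOperator.

(** * Degrees of polynomials in the power sums *)

Module PowerSumMonomials.
Import mpoly.

Section Monomials.
Variables (K : comNzRingType) (N : nat).

(** The total degree in x of the monomial after substitution: the variable of index i is replaced by
    the power sum of degree i + 1. *)
Definition wt n (m : 'X_{1..n}) : nat := \sum_(i < n) i.+1 * m i.

Lemma dhomog_psum k : PowerSums.psum K N k \is k.-homog.
Proof.
apply: rpred_sum => i _; have := @dhomogMn N K mdeg 1 'X_i k.
by rewrite mul1n; apply; rewrite dhomogX /= mdeg1.
Qed.

Lemma dhomog_prodX n (m : 'X_{1..n}) :
  'X_[K, m] \mPo [tuple PowerSums.psum K N i.+1 | i < n] \is (wt m).-homog.
Proof.
rewrite comp_mpolyX /wt; elim/big_rec2: _ => [|i d p _ hp]; first exact: dhomog1.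
rewrite tnth_mktuple; apply: dhomogM => //; apply: dhomogMn; exact: dhomog_psum.
Qed.

Lemma dhomog_msize d (p : {mpoly K[N]}) : p \is d.-homog -> (msize p <= d.+1)%N.
Proof.
move=> /dhomogP hp; rewrite msizeE; apply/bigmax_leqP_seq => m mp _.
by rewrite ltnS (hp m mp).
Qed.

(** Substitution maps the part of f of weight d to the homogeneous component of degree d of the
    result. A bound on the degree of the result therefore makes each part of weight at least D sum
    to zero. *)
Lemma of_psums_trunc n (f : {mpoly K[n]}) D v :
  (msize (PowerSums.of_psums N f) <= D)%N ->
  PowerSums.eval (PowerSums.of_psums N f) v
  = \sum_(m <- msupp f | (wt m < D)%N)
      f@_m * \prod_(i < n) (\sum_(l < N) v l ^+ i.+1) ^+ m i.
Proof.
move=> hD.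
have E : PowerSums.of_psums N f = \sum_(m <- msupp f | (wt m < D)%N)
    f@_m *: ('X_[K, m] \mPo [tuple PowerSums.psum K N i.+1 | i < n]).
  rewrite {1}[PowerSums.of_psums N f](pihomog_partitionE hD).
  have fE : PowerSums.of_psums N f = \sum_(m <- msupp f)
      f@_m *: ('X_[K, m] \mPo [tuple PowerSums.psum K N i.+1 | i < n]).
    by rewrite /PowerSums.of_psums comp_mpolyEX.
  rewrite (eq_bigr (fun d : 'I_D => \sum_(m <- msupp f | wt m == d)
     f@_m *: ('X_[K, m] \mPo [tuple PowerSums.psum K N i.+1 | i < n]))) => [|d _].
    rewrite (exchange_big_dep (fun m => wt m < D)%N) /=; last first.
      by move=> d m _ /eqP ->.
    apply: eq_bigr => m mD; by rewrite (big_pred1 (Ordinal mD)).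
  rewrite fE raddf_sum /= [RHS]big_mkcond; apply: eq_bigr => m _.
  rewrite linearZ /=; case: eqP => [<-|/eqP wd].
    by rewrite pihomog_dE // dhomog_prodX.
  by rewrite (pihomog_ne0 wd) ?dhomog_prodX // scaler0.
rewrite E /PowerSums.eval raddf_sum /=; apply: eq_bigr => m _.
rewrite mevalZ comp_mpolyX rmorph_prod /=; congr (_ * _); apply: eq_bigr => i _.
rewrite rmorphXn /= tnth_mktuple raddf_sum /=; congr (_ ^+ _).
by apply: eq_bigr => l _; rewrite rmorphXn /= mevalXU.
Qed.

End Monomials.

Section FewVariables.
Variables (K : numDomainType) (N : nat).
Implicit Types (v : 'I_N -> K).

Definition pv (k : nat) v : K := \sum_(l < N) v l ^+ k.

(** In characteristic zero, a monomial with exponent at least 2 in the last variable leaves a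
    nonzero coefficient in the second derivative. *)
Lemma d33_msupp (f : PowerSums.poly_in K 3) (m : 'X_{1..3}) :
  PowerSums.d33_eq0 f -> m \in msupp (f : {mpoly K[3]}) -> (m ord_max <= 1)%N.
Proof.
move=> /eqP f33; rewrite mcoeff_msupp; apply: contraR; rewrite -ltnNge => m2.
pose m' : 'X_{1..3} := (m - U_(ord_max) - U_(ord_max))%MM.
have mE : (m' + U_(ord_max) + U_(ord_max) = m)%MM.
  apply/mnmP => l; rewrite !(mnmDE, mnmBE) mnm1E.
  by case: eqP => [<-|_] /=; lia.
have := congr1 (mcoeff m') f33.
rewrite !mcoeff_mderiv mcoeff0 mE => /eqP; rewrite !mulrn_eq0 /=.
by move=> ->.
Qed.

(** A list of coefficients and exponents carries the degree bound term by term, as the reduction of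
    the generators of the invariant space to monomials requires. *)
Lemma trunc2 (f : PowerSums.poly_in K 2) D :
  PowerSums.deg_lt (PowerSums.of_psums N f) D ->
  exists L : seq (K * (nat * nat)),
    {in L, forall t, (t.2.1 + 2 * t.2.2 < D)%N} /\
    forall v, PowerSums.eval (PowerSums.of_psums N f) v
      = \sum_(t <- L) t.1 * (pv 1 v ^+ t.2.1 * pv 2 v ^+ t.2.2).
Proof.
move=> hD; exists [seq (f@_m, (m ord0, m ord_max))
  | m <- [seq m <- msupp (f : {mpoly K[2]}) | (wt m < D)%N]]; split.
  move=> t /mapP[m]; rewrite mem_filter => /andP[mD _] -> /=.
  move: mD; rewrite /wt !big_ord_recl big_ord0 addn0 mul1n.
  by rewrite (_ : lift ord0 ord0 = ord_max) //; exact: val_inj.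
move=> v; rewrite (of_psums_trunc v hD) [RHS]big_map [RHS]big_filter; apply: eq_bigr => m _.
rewrite !big_ord_recl big_ord0 mulr1 /=.
by rewrite (_ : lift ord0 ord0 = ord_max) //; exact: val_inj.
Qed.

Lemma monomial2 (i j : nat) : exists f : PowerSums.poly_in K 2,
  (forall D, (i + 2 * j < D)%N -> PowerSums.deg_lt (PowerSums.of_psums N f) D) /\
  forall v, PowerSums.eval (PowerSums.of_psums N f) v = pv 1 v ^+ i * pv 2 v ^+ j.
Proof.
pose m : 'X_{1..2} := [multinom nth 0%N [:: i; j] l | l < 2].
have wm : wt m = (i + 2 * j)%N.
  by rewrite /wt !big_ord_recl big_ord0 !mnmE /= addn0 mul1n.
exists 'X_[K, m]; split => [D iD|v].
  apply: leq_trans iD; rewrite -wm; apply: dhomog_msize.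
  exact: dhomog_prodX.
rewrite /PowerSums.eval /PowerSums.of_psums comp_mpolyX rmorph_prod /=.
have E l : ((tnth [tuple PowerSums.psum K N i0.+1 | i0 < 2] l) ^+ m l).@[v]
    = pv l.+1 v ^+ m l.
  rewrite rmorphXn /= tnth_mktuple raddf_sum /=; congr (_ ^+ _).
  by apply: eq_bigr => l' _; rewrite rmorphXn /= mevalXU.
by rewrite !big_ord_recl big_ord0 mulr1 !E !mnmE.
Qed.

Lemma monomial3 (i j k : nat) : (k <= 1)%N ->
  exists f : PowerSums.poly_in K 3, [/\ PowerSums.d33_eq0 f,
  forall D, (i + 2 * j + 3 * k < D)%N ->
    PowerSums.deg_lt (PowerSums.of_psums N f) D &
  forall v, PowerSums.eval (PowerSums.of_psums N f) v
    = pv 1 v ^+ i * pv 2 v ^+ j * pv 3 v ^+ k].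
Proof.
move=> k1; pose m : 'X_{1..3} := [multinom nth 0%N [:: i; j; k] l | l < 3].
have wm : wt m = (i + 2 * j + 3 * k)%N.
  by rewrite /wt !big_ord_recl big_ord0 !mnmE /= addn0 mul1n addnA.
exists 'X_[K, m]; split => [|D iD|v].
- rewrite /PowerSums.d33_eq0 mderivX mderivZ mderivX mnmBE mnm1E eqxx mnmE /=.
  have -> : (k - 1 = 0)%N by apply/eqP; rewrite subn_eq0.
  by rewrite scale0r scaler0.
- apply: leq_trans iD; rewrite -wm; apply: dhomog_msize.
  exact: dhomog_prodX.
rewrite /PowerSums.eval /PowerSums.of_psums comp_mpolyX rmorph_prod /=.
have E l : ((tnth [tuple PowerSums.psum K N i0.+1 | i0 < 3] l) ^+ m l).@[v]
    = pv l.+1 v ^+ m l.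
  rewrite rmorphXn /= tnth_mktuple raddf_sum /=; congr (_ ^+ _).
  by apply: eq_bigr => l' _; rewrite rmorphXn /= mevalXU.
by rewrite !big_ord_recl big_ord0 mulr1 !E !mnmE /= mulrA.
Qed.

Lemma trunc3 (f : PowerSums.poly_in K 3) D : PowerSums.d33_eq0 f ->
  PowerSums.deg_lt (PowerSums.of_psums N f) D ->
  exists L : seq (K * (nat * nat * nat)),
    {in L, forall t, (t.2.1.1 + 2 * t.2.1.2 + 3 * t.2.2 < D)%N && (t.2.2 <= 1)%N} /\
    forall v, PowerSums.eval (PowerSums.of_psums N f) v
      = \sum_(t <- L) t.1 * (pv 1 v ^+ t.2.1.1 * pv 2 v ^+ t.2.1.2 * pv 3 v ^+ t.2.2).
Proof.
move=> f33 hD.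
have e1 : lift ord0 ord0 = inord 1 :> 'I_3 by apply: val_inj; rewrite /= inordK.
have e2 : lift ord0 (lift ord0 ord0) = ord_max :> 'I_3 by apply: val_inj.
exists [seq (f@_m, (m ord0, m (inord 1), m ord_max))
  | m <- [seq m <- msupp (f : {mpoly K[3]}) | (wt m < D)%N]]; split.
  move=> t /mapP[m]; rewrite mem_filter => /andP[mD mf] -> /=.
  move: mD; rewrite /wt !big_ord_recl big_ord0 addn0 mul1n /= e2 e1 addnA => ->.
  exact: d33_msupp f33 mf.
move=> v; rewrite (of_psums_trunc v hD) [RHS]big_map [RHS]big_filter; apply: eq_bigr => m _.
by rewrite !big_ord_recl big_ord0 mulr1 /= e2 e1 mulrA.
Qed.
End FewVariables.
End PowerSumMonomials.

From mathcomp Require Import all_classical all_reals all_analysis.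
From mathcomp Require Import (canonicals) mpoly.
Import Order.TTheory.

(** * Jacobi and Laguerre polynomials *)

Section Jacobi.
Variable R : realType.
Implicit Types (g d A : R) (n k : nat).

Lemma pochS (z : R) k : pochhammer z k.+1 = pochhammer z k * (z + k%:R).
Proof. by rewrite /pochhammer big_ord_recr. Qed.
Lemma poch0 (z : R) : pochhammer z 0 = 1.
Proof. by rewrite /pochhammer big_ord0. Qed.
Lemma pochSl (z : R) k : pochhammer z k.+1 = z * pochhammer (z + 1) k.
Proof.
rewrite /pochhammer big_ord_recl addr0; congr (_ * _); apply: eq_bigr => i _.
by rewrite -addrA -mulrS.
Qed.
Lemma fact_neq0 n : n`!%:R != 0 :> R.
Proof. by rewrite pnatr_eq0 -lt0n fact_gt0. Qed.

(* The coefficient of w^k in jacobi g d n at t = 1 + 2 w, with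
   A = g + d + n + 1. *)
Definition jcoef g A n k : R :=
  if (k <= n)%N then
    pochhammer A k * pochhammer (g + k%:R + 1) (n - k)
      / (k`!%:R * (n - k)`!%:R)
  else 0.

(** The variable is w = (t - 1) / 2, which in the eigenfunctions is the ratio [vv] / [xb]^2. *)
Definition jw g d n : {poly R} := jacobi g d n \Po (1 + 2 *: 'X).

Lemma pochN n k : (k <= n)%N ->
  pochhammer (- n%:R : R) k * (-1) ^+ k * (n - k)`!%:R = n`!%:R.
Proof.
elim: k => [|k IH] kn; first by rewrite poch0 subn0 !mul1r.
rewrite -(IH (ltnW kn)) -[(n - k)%N]subnSK // factS natrM subnSK //.
by rewrite pochS exprS natrB ?(ltnW kn) //; ring.
Qed.

Lemma coef_jw g d n k : (jw g d n)`_k = jcoef g (g + d + n%:R + 1) n k.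
Proof.
rewrite /jw /jacobi comp_polyZ raddf_sum coefZ coef_sum /=.
have E j : ((1 - 'X) ^+ j \Po (1 + 2 *: 'X) : {poly R}) = (-2) ^+ j *: 'X^j.
  rewrite rmorphXn /= comp_polyB comp_polyX comp_polyC opprD addNKr.
  by rewrite -scaleNr exprZn.
rewrite (eq_bigr (fun i : 'I_n.+1 => if i == k :> nat then
    n`!%:R * jcoef g (g + d + n%:R + 1) n k else 0)) => [|i _]; last first.
  rewrite comp_polyZ E !coefZ coefXn eq_sym.
  case: eqP => [<-|_]; last by rewrite !mulr0.
  have iin : (i <= n)%N by rewrite -ltnS.
  rewrite /jcoef iin -(pochN iin) mulr1 -[-2]mulN1r exprMn.
  have f1 := fact_neq0 i; have f2 := fact_neq0 (n - i).
  by field; rewrite f1 f2 expf_neq0.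
have [kn|nk] := leqP k n.
  rewrite (bigD1 (Ordinal (_ : k < n.+1)%N)) //= eqxx big1 ?addr0 => [|i].
    by rewrite mulrA mulVf ?fact_neq0 // mul1r.
  by rewrite -val_eqE /= => /negPf ->.
rewrite /jcoef leqNgt nk /= big1 ?mulr0 // => i _.
by rewrite ltn_eqF // (leq_trans (ltn_ord i)).
Qed.

Lemma jcoef_shiftA g A n k : A != 0 ->
  jcoef g (A + 1) n k = (A + k%:R) / A * jcoef g A n k.
Proof.
move=> A0; rewrite /jcoef; case: leqP => _; last by rewrite mulr0.
have -> : pochhammer (A + 1) k = (A + k%:R) / A * pochhammer A k.
  by apply: (mulfI A0); rewrite -pochSl pochS; field.
by rewrite !mulrA.
Qed.

Lemma jcoef_shiftg g A n k : g + k%:R + 1 != 0 ->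
  jcoef (g + 1) A n k = (g + n%:R + 1) / (g + k%:R + 1) * jcoef g A n k.
Proof.
move=> g0; rewrite /jcoef; case: leqP => kn; last by rewrite mulr0.
have -> : pochhammer (g + 1 + k%:R + 1) (n - k) =
   (g + n%:R + 1) / (g + k%:R + 1) * pochhammer (g + k%:R + 1) (n - k).
  have := pochS (g + k%:R + 1) (n - k); rewrite pochSl natrB //.
  rewrite [g + 1 + k%:R]addrAC => /(canRL (mulKf g0)) ->.
  by field; rewrite g0.
have f1 := fact_neq0 k; have f2 := fact_neq0 (n - k).
by field; rewrite f1 f2 g0.
Qed.

(** A stays fixed while n changes: as A = g + d + n + 1, this means that the second Jacobi parameter
    d moves the opposite way to n. *)
Lemma jcoef_shiftn g A n k : g + n%:R + 1 != 0 ->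
  jcoef g A n k = (n%:R + 1 - k%:R) / (g + n%:R + 1) * jcoef g A n.+1 k.
Proof.
move=> g0; rewrite /jcoef; have [kn|nk] := leqP k n.
  rewrite (leqW kn) subSn // pochS factS natrM natrB //.
  have f1 := fact_neq0 k; have f2 := fact_neq0 (n - k).
  have f3 : n%:R + 1 - k%:R != 0 :> R.
    by rewrite natr1 -natrB ?(leqW kn) // pnatr_eq0 subn_eq0 -ltnNge ltnS.
  rewrite -natr1 natrB //.
  by field; rewrite f1 f2 g0 addrAC f3.
case: leqP => kn; last by rewrite mulr0.
(* On the right [jcoef] is not zero at this index; the factor n + 1 - k is. *)
have -> : k = n.+1 by apply/eqP; rewrite eqn_leq kn nk.
by rewrite natr1 subrr !mul0r.
Qed.

Lemma jcoefS g A n k : g + k%:R + 1 != 0 ->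
  jcoef g A n k.+1
    = (A + k%:R) * (n%:R - k%:R) / ((k%:R + 1) * (g + k%:R + 1))
      * jcoef g A n k.
Proof.
move=> g0; rewrite /jcoef; have [kn|nk] := ltnP k n; last first.
  case: leqP => kn; last by rewrite mulr0.
  have -> : k = n by apply/eqP; rewrite eqn_leq kn nk.
  by rewrite subrr mulr0 !mul0r.
rewrite (ltnW kn) -[(n - k)%N]subnSK // pochS pochSl !factS !natrM.
have -> : (n - k.+1).+1%:R = n%:R - k%:R :> R.
  by rewrite subnSK // natrB // ltnW.
have f1 := fact_neq0 k; have f2 := fact_neq0 (n - k.+1).
have f3 : n%:R - k%:R != 0 :> R by rewrite -natrB ?(ltnW kn) // pnatr_eq0 subn_eq0 -ltnNge.
have f4 : k%:R + 1 != 0 :> R by rewrite natr1 pnatr_eq0.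
rewrite -natr1 [g + (k%:R + 1)]addrA.
by field; rewrite f1 f2 f3 f4 g0.
Qed.

End Jacobi.

(** * Contiguity relations between Jacobi polynomials, in the variable w *)

Section Contiguous.
Variable R : realType.
Variables (al be : R) (al_gt0 : 0 < al).
Local Notation J b c n := (jw (al + b) (be + c) n).

(** A fixpoint, so that [/=] unfolds the product for the numerals of the contiguity relations and
    leaves a plain fraction to [field]. *)
Fixpoint prodn (f : nat -> R) n : R := if n is n'.+1 then prodn f n' * f n' else 1.

(* All the Jacobi coefficients in an identity are rational multiples of those
   of the lowest first parameter, which reduces the identity to a field one. *)
Definition ratio h (A : R) b s j (k : R) : R :=
  prodn (fun i => (h%:R - i%:R - k) / (al + b%:R + h%:R - i%:R)) j
  * prodn (fun i => (al + i%:R + h%:R + 1) / (al + i%:R + k + 1)) b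
  * prodn (fun i => (A + i%:R + k) / (A + i%:R)) s.

Lemma jcoef_ratio h A b s j k : (j <= h)%N ->
  (forall i, (i < s)%N -> A + i%:R != 0) ->
  jcoef (al + b%:R) (A + s%:R) (h - j) k = ratio h A b s j k%:R * jcoef al A h k.
Proof.
have pos (u v : R) : 0 <= u -> 0 < v -> u + v != 0.
  by move=> u0 v0; rewrite gt_eqF // ltr_wpDl.
have al_i i : 0 < al + i%:R by rewrite ltr_pwDl.
move=> jh A0; rewrite /ratio; elim: j jh => [|j IH] jh.
  rewrite subn0 mul1r; elim: s A0 => [|s IHs] A0 /=.
    rewrite mulr1 addr0; elim: b => [|b IHb] /=; first by rewrite addr0 mul1r.
    rewrite -natr1 addrA jcoef_shiftg ?IHb.
      by rewrite [al + _ + h%:R]addrAC [al + _ + k%:R]addrAC; ring.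
    by rewrite gt_eqF // addr_gt0 ?ltr_pwDl.
  rewrite -natr1 addrA jcoef_shiftA; last exact: A0.
  by rewrite IHs => [|i si]; [ring|apply: A0; exact: ltnW].
have E : (h - j.+1)%:R = h%:R - j%:R - 1 :> R by rewrite natrB // -natr1; ring.
rewrite jcoef_shiftn.
  rewrite subnSK // IH ?(ltnW jh) // E /=.
  have -> : al + b%:R + (h%:R - j%:R - 1) + 1 = al + b%:R + h%:R - j%:R by ring.
  by ring.
by rewrite gt_eqF // addr_gt0 ?ltr_pwDl.
Qed.

(** The second hypothesis says that [A + s] is the sum g + d + n + 1 attached to this polynomial. *)
Lemma coef_J h A (b : nat) (c : R) (s j k : nat) : (j <= h)%N ->
  al + be + h%:R + 1 + b%:R + c - j%:R = A + s%:R ->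
  (forall i, (i < s)%N -> A + i%:R != 0) ->
  (J b%:R c (h - j))`_k = ratio h A b s j k%:R * jcoef al A h k.
Proof.
move=> jh hA A0; rewrite coef_jw -jcoef_ratio //; congr jcoef.
by rewrite -hA natrB //; ring.
Qed.

Lemma jcoef_top h A k :
  jcoef al A h k.+1
    = (A + k%:R) * (h%:R - k%:R) / ((k%:R + 1) * (al + k%:R + 1)) * jcoef al A h k.
Proof. by rewrite jcoefS // gt_eqF // addr_gt0 // ltr_pwDl. Qed.

(** Every denominator is a product of affine expressions of definite sign, given al > 0, the lower
    bound on h and k >= 0. *)
Ltac nonzero := repeat (apply/andP; split); first
  [apply/lt0r_neq0; lra | apply/ltr0_neq0; lra].

(* m = 2 h *)
Section Even.
Variables (h : nat) (hbe : al + be = - 2^-1 - 2 * h%:R).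
(** The value of al + be + h + 1. The parameters of the polynomials below exceed it by small natural
    numbers s. *)
Let A : R := 2^-1 - h%:R.
Let m : R := 2 * h%:R.

Lemma coef_even (b : nat) (c : R) (s j k : nat) :
  b%:R + c - j%:R = s%:R -> (j <= h)%N -> (s <= h)%N ->
  (J b%:R c (h - j))`_k = ratio h A b s j k%:R * jcoef al A h k.
Proof.
move=> hs jh sh; apply: coef_J => // [|i si]; first by rewrite hbe /A; lra.
rewrite /A lt_eqF // -[X in _ < X](subrr h%:R) ltrBrDr.
have : i%:R + 1 <= h%:R :> R by rewrite natr1 ler_nat (leq_trans si).
lra.
Qed.

(** With ['X] standing for vv / xb^2, the left side is the coefficient of Phi0 that remains when
    P^(alpha+2,beta) q2 is subtracted from the bracket of Psi2. The relation makes this remainder a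
    multiple of the family Psi0, hence harmonic. The other relations play the same part for the
    other families. *)
Lemma contig2_even : (1 <= h)%N ->
  'X * J 2 0 (h - 1) - (2 * (al + 1) / (m - 1)) *: J 1 0 (h - 1)
    = (- m / (m - 1)) *: J 0 0 (h - 0).
Proof.
move=> h1; have h0 : (0 < h)%N by apply: leq_trans h1.
have al0 := al_gt0.
have hR : 1%:R <= h%:R :> R by rewrite ler_nat.
rewrite ?[(_ *: 'X + _) * _]mulrDl -?scalerAl ?mul1r.
(* Multiplication by ['X] shifts the coefficients, so index k + 1 involves [jcoef] at both k and k +
   1; [jcoef_top] reduces the latter to the former. The constant coefficient has no such shift. *)
apply/polyP => -[|k]; rewrite !(coefB, coefD, coefN, coefZ, coef0, coefXM) /=.
  rewrite ?(@coef_even 2 (0) 1 1) ?(@coef_even 1 (0) 0 1) ?(@coef_even 0 (0) 0 0) //; try lra.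
  by rewrite /ratio /m /A /=; field; nonzero.
have k0 : 0 <= k%:R :> R by exact: ler0n.
rewrite ?(@coef_even 2 (0) 1 1) ?(@coef_even 1 (0) 0 1) ?(@coef_even 0 (0) 0 0) //; try lra.
by rewrite jcoef_top -?natr1 /ratio /m /A /=; field; nonzero.
Qed.

(** In units of xb^3, the factor 2 w + 2/3 is the excess of (2 / (3 N)) s3 over (2 / (3 N)) c3. *)
Lemma contig3_even : (2 <= h)%N ->
  (2 *: 'X + 2 / 3 *: 1) * J 3 0 (h - 2)
  + (((m + 2 * al + 2) / (m - 1)) *: J 2 (-2) (h - 0)
  - J 3 (-1) (h - 1)
  - ((4 * al + 7) / (m - 1)) *: J 2 (-1) (h - 1)
  + 3^-1 *: J 3 0 (h - 2))
    = ((m + 2 * al + 2) / (m - 1)) *: J 0 0 (h - 0).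
Proof.
move=> h1; have h0 : (0 < h)%N by apply: leq_trans h1.
have al0 := al_gt0.
have hR : 2%:R <= h%:R :> R by rewrite ler_nat.
rewrite ?[(_ *: 'X + _) * _]mulrDl -?scalerAl ?mul1r.
apply/polyP => -[|k]; rewrite !(coefB, coefD, coefN, coefZ, coef0, coefXM) /=.
  rewrite ?(@coef_even 3 (0) 1 2) ?(@coef_even 2 (-2) 0 0) ?(@coef_even 3 (-1) 1 1) ?(@coef_even 2 (-1) 0 1) ?(@coef_even 0 (0) 0 0) //; try lra.
  by rewrite /ratio /m /A /=; field; nonzero.
have k0 : 0 <= k%:R :> R by exact: ler0n.
rewrite ?(@coef_even 3 (0) 1 2) ?(@coef_even 2 (-2) 0 0) ?(@coef_even 3 (-1) 1 1) ?(@coef_even 2 (-1) 0 1) ?(@coef_even 0 (0) 0 0) //; try lra.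
by rewrite jcoef_top -?natr1 /ratio /m /A /=; field; nonzero.
Qed.

(** This is twice the coefficient of x_1 - x_2 that remains when P^(alpha+3,beta) q3h is subtracted
    from the antisymmetrized bracket of the third-degree antisymmetric family. *)
Lemma contig3h_even : (2 <= h)%N ->
  (4 * (al + 2) / (m - 1)) *: J 2 0 (h - 2) - 2 *: ('X * J 3 0 (h - 2))
    = (2 * (m - 2) / (m - 1)) *: J 1 0 (h - 1).
Proof.
move=> h1; have h0 : (0 < h)%N by apply: leq_trans h1.
have al0 := al_gt0.
have hR : 2%:R <= h%:R :> R by rewrite ler_nat.
rewrite ?[(_ *: 'X + _) * _]mulrDl -?scalerAl ?mul1r.
apply/polyP => -[|k]; rewrite !(coefB, coefD, coefN, coefZ, coef0, coefXM) /=.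
  rewrite ?(@coef_even 3 (0) 1 2) ?(@coef_even 2 (0) 0 2) ?(@coef_even 1 (0) 0 1) //; try lra.
  by rewrite /ratio /m /A /=; field; nonzero.
have k0 : 0 <= k%:R :> R by exact: ler0n.
rewrite ?(@coef_even 3 (0) 1 2) ?(@coef_even 2 (0) 0 2) ?(@coef_even 1 (0) 0 1) //; try lra.
by rewrite jcoef_top -?natr1 /ratio /m /A /=; field; nonzero.
Qed.

(** With y = x_1 - xb one has x_1 = y + xb and x_1^2 = q2 + 2 xb y + xb^2 + vv. After removal of the
    multiple of [q4], the bracket of Psi4 thus has components along q2, y and 1, treated by this
    relation and the next two. *)
Lemma contig4a_even : (2 <= h)%N ->
  (3 / (m - 3)) *: J 3 0 (h - 2) - (3 / (2 * (al + 3))) *: ('X * J 4 0 (h - 2))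
    = (3 / (2 * (al + 3)) * ((m - 2) / (m - 3))) *: J 2 0 (h - 1).
Proof.
move=> h1; have h0 : (0 < h)%N by apply: leq_trans h1.
have al0 := al_gt0.
have hR : 2%:R <= h%:R :> R by rewrite ler_nat.
rewrite ?[(_ *: 'X + _) * _]mulrDl -?scalerAl ?mul1r.
apply/polyP => -[|k]; rewrite !(coefB, coefD, coefN, coefZ, coef0, coefXM) /=.
  rewrite ?(@coef_even 3 (0) 1 2) ?(@coef_even 4 (0) 2 2) ?(@coef_even 2 (0) 1 1) //; try lra.
  by rewrite /ratio /m /A /=; field; nonzero.
have k0 : 0 <= k%:R :> R by exact: ler0n.
rewrite ?(@coef_even 3 (0) 1 2) ?(@coef_even 4 (0) 2 2) ?(@coef_even 2 (0) 1 1) //; try lra.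
by rewrite jcoef_top -?natr1 /ratio /m /A /=; field; nonzero.
Qed.

Lemma contig4b_even : (2 <= h)%N ->
  (6 / (m - 3)) *: J 3 0 (h - 2)
  + (3 / 2) *: (J 4 (-1) (h - 1) - 2 *: J 3 (-1) (h - 1)
    - ((m + 2 * al + 3) / ((m - 1) * (m - 3))) *: J 2 (-1) (h - 1)
    - 3^-1 *: J 4 0 (h - 2) + ((m + 2 * al - 1) / (m - 3)) *: J 3 0 (h - 2))
  - (3 *: 'X + 1) * J 4 0 (h - 2)
    = (- (3 / 2) * (m + 2 * al + 2) / ((m - 1) * (m - 3))) *: J 1 0 (h - 1).
Proof.
move=> h1; have h0 : (0 < h)%N by apply: leq_trans h1.
have al0 := al_gt0.
have hR : 2%:R <= h%:R :> R by rewrite ler_nat.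
rewrite ?[(_ *: 'X + _) * _]mulrDl -?scalerAl ?mul1r.
apply/polyP => -[|k]; rewrite !(coefB, coefD, coefN, coefZ, coef0, coefXM) /=.
  rewrite ?(@coef_even 3 (0) 1 2) ?(@coef_even 4 (-1) 2 1) ?(@coef_even 3 (-1) 1 1) ?(@coef_even 2 (-1) 0 1) ?(@coef_even 4 (0) 2 2) ?(@coef_even 1 (0) 0 1) //; try lra.
  by rewrite /ratio /m /A /=; field; nonzero.
have k0 : 0 <= k%:R :> R by exact: ler0n.
rewrite ?(@coef_even 3 (0) 1 2) ?(@coef_even 4 (-1) 2 1) ?(@coef_even 3 (-1) 1 1) ?(@coef_even 2 (-1) 0 1) ?(@coef_even 4 (0) 2 2) ?(@coef_even 1 (0) 0 1) //; try lra.
by rewrite jcoef_top -?natr1 /ratio /m /A /=; field; nonzero.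
Qed.

(** The component along 1, where the sums of cubes have already cancelled, vanishes altogether. *)
Lemma contig4c_even : (2 <= h)%N ->
  (3 / (m - 3)) *: J 3 0 (h - 2)
  + (3 / 2) *: ((J 4 (-1) (h - 1) - 2 *: J 3 (-1) (h - 1)
    - ((m + 2 * al + 3) / ((m - 1) * (m - 3))) *: J 2 (-1) (h - 1)
    - 3^-1 *: J 4 0 (h - 2) + ((m + 2 * al - 1) / (m - 3)) *: J 3 0 (h - 2))
   + (((3 * m + 2 * al) / ((m - 1) * (m - 3))) *: J 2 (-1) (h - 1)
  + ((2 * m - 7) / (m - 3)) *: J 3 (-1) (h - 1)
  - J 4 (-1) (h - 1)
  - ((m + 2 * al + 2) / ((m - 1) * (m - 3))) *: J 2 0 (h - 2)
  - ((m + 2 * al) / (m - 3)) *: J 3 0 (h - 2)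
  + 3^-1 *: J 4 0 (h - 2)))
  + 'X * ((3 / (m - 3)) *: J 3 0 (h - 2))
    = 0.
Proof.
move=> h1; have h0 : (0 < h)%N by apply: leq_trans h1.
have al0 := al_gt0.
have hR : 2%:R <= h%:R :> R by rewrite ler_nat.
rewrite ?[(_ *: 'X + _) * _]mulrDl -?scalerAl ?mul1r.
apply/polyP => -[|k]; rewrite !(coefB, coefD, coefN, coefZ, coef0, coefXM) /=.
  rewrite ?(@coef_even 3 (0) 1 2) ?(@coef_even 4 (-1) 2 1) ?(@coef_even 3 (-1) 1 1) ?(@coef_even 2 (-1) 0 1) ?(@coef_even 4 (0) 2 2) ?(@coef_even 2 (0) 0 2) //; try lra.
  by rewrite /ratio /m /A /=; field; nonzero.
have k0 : 0 <= k%:R :> R by exact: ler0n.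
rewrite ?(@coef_even 3 (0) 1 2) ?(@coef_even 4 (-1) 2 1) ?(@coef_even 3 (-1) 1 1) ?(@coef_even 2 (-1) 0 1) ?(@coef_even 4 (0) 2 2) ?(@coef_even 2 (0) 0 2) //; try lra.
by rewrite jcoef_top -?natr1 /ratio /m /A /=; field; nonzero.
Qed.

End Even.

(* m = 2 h + 1 *)
Section Odd.
Variables (h : nat) (hbe : al + be = - 2^-1 - (2 * h%:R + 1)).
Let A : R := - 2^-1 - h%:R.
Let m : R := 2 * h%:R + 1.

(** A + i stays negative up to i = h, one step further than in the even case; [contig3_odd] at h = 1
    uses this, with s = 2. *)
Lemma coef_odd (b : nat) (c : R) (s j k : nat) :
  b%:R + c - j%:R = s%:R -> (j <= h)%N -> (s <= h.+1)%N ->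
  (J b%:R c (h - j))`_k = ratio h A b s j k%:R * jcoef al A h k.
Proof.
move=> hs jh sh; apply: coef_J => // [|i si]; first by rewrite hbe /A; lra.
rewrite /A lt_eqF // -[X in _ < X](subrr h%:R) ltrBrDr.
have : i%:R <= h%:R :> R by rewrite ler_nat -ltnS (leq_trans si).
lra.
Qed.

Lemma contig2_odd : (1 <= h)%N ->
  'X * J 2 0 (h - 1) - (2 * (al + 1) / m) *: J 1 0 (h - 1)
    = (- (m - 1) / m) *: J 0 0 (h - 0).
Proof.
move=> h1; have h0 : (0 < h)%N by apply: leq_trans h1.
have al0 := al_gt0.
have hR : 1%:R <= h%:R :> R by rewrite ler_nat.
rewrite ?[(_ *: 'X + _) * _]mulrDl -?scalerAl ?mul1r.
apply/polyP => -[|k]; rewrite !(coefB, coefD, coefN, coefZ, coef0, coefXM) /=.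
  rewrite ?(@coef_odd 2 (0) 1 1) ?(@coef_odd 1 (0) 0 1) ?(@coef_odd 0 (0) 0 0) //; try lra.
  by rewrite /ratio /m /A /=; field; nonzero.
have k0 : 0 <= k%:R :> R by exact: ler0n.
rewrite ?(@coef_odd 2 (0) 1 1) ?(@coef_odd 1 (0) 0 1) ?(@coef_odd 0 (0) 0 0) //; try lra.
by rewrite jcoef_top -?natr1 /ratio /m /A /=; field; nonzero.
Qed.

Lemma contig3_odd : (1 <= h)%N ->
  (2 *: 'X + 2 / 3 *: 1) * J 3 0 (h - 1)
  + (2 *: J 2 (-1) (h - 0) - J 3 (-1) (h - 0) + 3^-1 *: J 3 0 (h - 1)
    + ((m + 2 * al + 2) / (m * (m - 2))) *: J 1 0 (h - 1)
    - ((m + 2 * al + 2) / (m - 2)) *: J 2 0 (h - 1))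
    = (- (m * (m - 2))^-1) *: J 0 0 (h - 0).
Proof.
move=> h1; have h0 : (0 < h)%N by apply: leq_trans h1.
have al0 := al_gt0.
have hR : 1%:R <= h%:R :> R by rewrite ler_nat.
rewrite ?[(_ *: 'X + _) * _]mulrDl -?scalerAl ?mul1r.
apply/polyP => -[|k]; rewrite !(coefB, coefD, coefN, coefZ, coef0, coefXM) /=.
  rewrite ?(@coef_odd 3 (0) 2 1) ?(@coef_odd 2 (-1) 1 0) ?(@coef_odd 3 (-1) 2 0) ?(@coef_odd 1 (0) 0 1) ?(@coef_odd 2 (0) 1 1) ?(@coef_odd 0 (0) 0 0) //; try lra.
  by rewrite /ratio /m /A /=; field; nonzero.
have k0 : 0 <= k%:R :> R by exact: ler0n.
rewrite ?(@coef_odd 3 (0) 2 1) ?(@coef_odd 2 (-1) 1 0) ?(@coef_odd 3 (-1) 2 0) ?(@coef_odd 1 (0) 0 1) ?(@coef_odd 2 (0) 1 1) ?(@coef_odd 0 (0) 0 0) //; try lra.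
by rewrite jcoef_top -?natr1 /ratio /m /A /=; field; nonzero.
Qed.

Lemma contig3h_odd : (1 <= h)%N ->
  (4 * (al + 2) / (m - 2)) *: J 2 0 (h - 1) - 2 *: ('X * J 3 0 (h - 1))
    = (2 * (m - 1) / (m - 2)) *: J 1 0 (h - 0).
Proof.
move=> h1; have h0 : (0 < h)%N by apply: leq_trans h1.
have al0 := al_gt0.
have hR : 1%:R <= h%:R :> R by rewrite ler_nat.
rewrite ?[(_ *: 'X + _) * _]mulrDl -?scalerAl ?mul1r.
apply/polyP => -[|k]; rewrite !(coefB, coefD, coefN, coefZ, coef0, coefXM) /=.
  rewrite ?(@coef_odd 3 (0) 2 1) ?(@coef_odd 2 (0) 1 1) ?(@coef_odd 1 (0) 1 0) //; try lra.
  by rewrite /ratio /m /A /=; field; nonzero.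
have k0 : 0 <= k%:R :> R by exact: ler0n.
rewrite ?(@coef_odd 3 (0) 2 1) ?(@coef_odd 2 (0) 1 1) ?(@coef_odd 1 (0) 1 0) //; try lra.
by rewrite jcoef_top -?natr1 /ratio /m /A /=; field; nonzero.
Qed.

Lemma contig4a_odd : (2 <= h)%N ->
  (3 / (m - 2)) *: J 3 0 (h - 2) - (3 / (2 * (al + 3))) *: ('X * J 4 0 (h - 2))
    = (3 / (2 * (al + 3)) * ((m - 3) / (m - 2))) *: J 2 0 (h - 1).
Proof.
move=> h1; have h0 : (0 < h)%N by apply: leq_trans h1.
have al0 := al_gt0.
have hR : 2%:R <= h%:R :> R by rewrite ler_nat.
rewrite ?[(_ *: 'X + _) * _]mulrDl -?scalerAl ?mul1r.
apply/polyP => -[|k]; rewrite !(coefB, coefD, coefN, coefZ, coef0, coefXM) /=.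
  rewrite ?(@coef_odd 3 (0) 1 2) ?(@coef_odd 4 (0) 2 2) ?(@coef_odd 2 (0) 1 1) //; try lra.
  by rewrite /ratio /m /A /=; field; nonzero.
have k0 : 0 <= k%:R :> R by exact: ler0n.
rewrite ?(@coef_odd 3 (0) 1 2) ?(@coef_odd 4 (0) 2 2) ?(@coef_odd 2 (0) 1 1) //; try lra.
by rewrite jcoef_top -?natr1 /ratio /m /A /=; field; nonzero.
Qed.

Lemma contig4b_odd : (2 <= h)%N ->
  (6 / (m - 2)) *: J 3 0 (h - 2)
  + (3 / 2) *: (J 4 (-1) (h - 1) - ((2 * m - 5) / (m - 2)) *: J 3 (-1) (h - 1)
    - 3^-1 *: J 4 0 (h - 2) + ((m + 2 * al - 1) / (m - 2)) *: J 3 0 (h - 2))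
  - (3 *: 'X + 1) * J 4 0 (h - 2)
    = 0.
Proof.
move=> h1; have h0 : (0 < h)%N by apply: leq_trans h1.
have al0 := al_gt0.
have hR : 2%:R <= h%:R :> R by rewrite ler_nat.
rewrite ?[(_ *: 'X + _) * _]mulrDl -?scalerAl ?mul1r.
apply/polyP => -[|k]; rewrite !(coefB, coefD, coefN, coefZ, coef0, coefXM) /=.
  rewrite ?(@coef_odd 3 (0) 1 2) ?(@coef_odd 4 (-1) 2 1) ?(@coef_odd 3 (-1) 1 1) ?(@coef_odd 4 (0) 2 2) //; try lra.
  by rewrite /ratio /m /A /=; field; nonzero.
have k0 : 0 <= k%:R :> R by exact: ler0n.
rewrite ?(@coef_odd 3 (0) 1 2) ?(@coef_odd 4 (-1) 2 1) ?(@coef_odd 3 (-1) 1 1) ?(@coef_odd 4 (0) 2 2) //; try lra.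
by rewrite jcoef_top -?natr1 /ratio /m /A /=; field; nonzero.
Qed.

Lemma contig4c_odd : (2 <= h)%N ->
  (3 / (m - 2)) *: J 3 0 (h - 2)
  + (3 / 2) *: ((J 4 (-1) (h - 1) - ((2 * m - 5) / (m - 2)) *: J 3 (-1) (h - 1)
    - 3^-1 *: J 4 0 (h - 2) + ((m + 2 * al - 1) / (m - 2)) *: J 3 0 (h - 2))
   + (((2 * m - 3) / (m * (m - 2))) *: J 2 (-1) (h - 1)
  + (2 * (m - 3) / (m - 2)) *: J 3 (-1) (h - 1)
  - J 4 (-1) (h - 1)
  - ((m + 2 * al + 1) / (m * (m - 2))) *: J 2 0 (h - 2)
  - ((m + 2 * al) / (m - 2)) *: J 3 0 (h - 2)
  + 3^-1 *: J 4 0 (h - 2)))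
  + 'X * ((3 / (m - 2)) *: J 3 0 (h - 2))
    = 0.
Proof.
move=> h1; have h0 : (0 < h)%N by apply: leq_trans h1.
have al0 := al_gt0.
have hR : 2%:R <= h%:R :> R by rewrite ler_nat.
rewrite ?[(_ *: 'X + _) * _]mulrDl -?scalerAl ?mul1r.
apply/polyP => -[|k]; rewrite !(coefB, coefD, coefN, coefZ, coef0, coefXM) /=.
  rewrite ?(@coef_odd 3 (0) 1 2) ?(@coef_odd 4 (-1) 2 1) ?(@coef_odd 3 (-1) 1 1) ?(@coef_odd 2 (-1) 0 1) ?(@coef_odd 4 (0) 2 2) ?(@coef_odd 2 (0) 0 2) //; try lra.
  by rewrite /ratio /m /A /=; field; nonzero.
have k0 : 0 <= k%:R :> R by exact: ler0n.
rewrite ?(@coef_odd 3 (0) 1 2) ?(@coef_odd 4 (-1) 2 1) ?(@coef_odd 3 (-1) 1 1) ?(@coef_odd 2 (-1) 0 1) ?(@coef_odd 4 (0) 2 2) ?(@coef_odd 2 (0) 0 2) //; try lra.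
by rewrite jcoef_top -?natr1 /ratio /m /A /=; field; nonzero.
Qed.

End Odd.
End Contiguous.

(** * Recurrences and special values of Jacobi and Laguerre polynomials *)

Section SpecialValues.
Variable R : realType.

Lemma size_jw (g d : R) n : (size (jw g d n) <= n.+1)%N.
Proof.
by apply/leq_sizeP => k nk; rewrite coef_jw /jcoef leqNgt nk.
Qed.

(** With n = [e/2] and A = 1/2 - e + n, the product 4 (A + k) (n - k) equals -(e - 2k) (e - 2k - 1)
    for either parity of e. The value of beta is what brings this about. *)
Lemma jw_rec (al be : R) (e d k : nat) : 0 < al ->
  al + be = - 2^-1 - (e + d)%:R -> (k < e./2)%N ->
  (jw (al + d%:R) be e./2)`_k * ((e - 2 * k) * (e - 2 * k).-1)%:R
    + 4 * k.+1%:R * (k.+1%:R + al + d%:R) * (jw (al + d%:R) be e./2)`_k.+1 = 0.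
Proof.
move=> al0 hbe ke; rewrite !coef_jw.
have gk : 0 < al + d%:R + k%:R + 1 by rewrite addr_gt0 // ltr_pwDl // ltr_pwDl.
rewrite jcoefS ?gt_eqF //.
have -> : al + d%:R + be + e./2%:R + 1 = 2^-1 - e%:R + e./2%:R.
  by rewrite [al + d%:R + be]addrAC hbe natrD; lra.
set n := e./2 in ke *; set J := jcoef _ _ _ _.
have eE : e = (odd e + n * 2)%N by rewrite -[LHS]odd_double_half muln2.
have e2 : ((e - 2 * k) * (e - 2 * k).-1)%:R
    = (e%:R - 2 * k%:R) * (e%:R - 2 * k%:R - 1) :> R.
  have ek : (2 * k < e)%N by rewrite eE; lia.
  rewrite natrM natrB ?(ltnW ek) // natrM -subn1 natrB ?subn_gt0 //.
  by rewrite natrB ?(ltnW ek) // natrM.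
have k1 : k%:R + 1 != 0 :> R by rewrite natr1 pnatr_eq0.
rewrite e2 -[k.+1%:R]natr1.
have -> : (k%:R + 1 + al + d%:R) = al + d%:R + k%:R + 1 by ring.
have gk0 := lt0r_neq0 gk.
have -> : e%:R = (odd e)%:R + n%:R * 2 :> R by rewrite {1}eE natrD natrM.
by case: (odd e) => /=; field; rewrite k1 gk0.
Qed.

(** The Chu-Vandermonde identity. Pascal's rule splits the sum for n + 1 into sums for n at (A, c)
    and at (A + 1, c + 1), which share the difference c - A. *)
Lemma vandermonde (A c : R) n :
  \sum_(k < n.+1) 'C(n, k)%:R * (-1) ^+ k * pochhammer A k
     * pochhammer (c + k%:R) (n - k) = pochhammer (c - A) n.
Proof.
elim: n A c => [|n IH] A c.
  by rewrite big_ord1 /= !poch0 !mulr1.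
pose F k := 'C(n, k)%:R * (-1) ^+ k * pochhammer A k
     * pochhammer (c + k%:R) (n.+1 - k).
pose G k := 'C(n, k)%:R * (-1) ^+ k.+1 * pochhammer A k.+1
     * pochhammer (c + k.+1%:R) (n - k).
transitivity (\sum_(k < n.+2) F k + \sum_(k < n.+1) G k).
  rewrite big_ord_recl [X in _ = X + _]big_ord_recl -addrA; congr (_ + _).
    by rewrite /F !bin0.
  rewrite -big_split /=; apply: eq_bigr => k _.
  by rewrite /F /G /bump /= add1n subSS binS natrD; ring.
rewrite big_ord_recr /= {2}/F bin_small // !mul0r addr0.
transitivity ((c + n%:R) * pochhammer (c - A) n - A * pochhammer (c - A) n).
  congr (_ + _).
    rewrite -(IH A c) mulr_sumr; apply: eq_bigr => k _; rewrite /F.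
    have kn : (k <= n)%N by rewrite -ltnS.
    by rewrite subSn // pochS natrB //; ring.
  rewrite -[c - A](_ : (c + 1) - (A + 1) = _); last by ring.
  rewrite -(IH (A + 1) (c + 1)) mulr_sumr -sumrN; apply: eq_bigr => k _.
  by rewrite /G pochSl exprS -[k.+1%:R]natr1 [k%:R + 1]addrC [c + (1 + _)]addrA; ring.
by rewrite pochS; ring.
Qed.

Lemma pochhammer_gt0 (z : R) n : 0 < z -> 0 < pochhammer z n.
Proof. by move=> z0; rewrite /pochhammer prodr_gt0 // => j _; rewrite ltr_pwDl. Qed.

(** At t = -1, that is w = -1, the Chu-Vandermonde identity evaluates the polynomial to (-d - n)_n /
    n!, a product of positive factors under the hypothesis. *)
Lemma jacobi_at_N1 (g d : R) n : n%:R + d < 0 -> (jacobi g d n).[-1] != 0.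
Proof.
move=> nd.
have -> : (jacobi g d n).[-1] = (jw g d n).[-1].
  by rewrite /jw horner_comp; congr (_.[_]); rewrite !hornerE; ring.
rewrite (horner_coef_wide _ (size_jw g d n)).
have -> : \sum_(i < n.+1) (jw g d n)`_i * (-1) ^+ i
    = (n`!%:R)^-1 * pochhammer (- d - n%:R) n.
  have -> : - d - n%:R = (g + 1) - (g + d + n%:R + 1) by ring.
  rewrite -vandermonde mulr_sumr; apply: eq_bigr => k _.
  have kn : (k <= n)%N by rewrite -ltnS.
  rewrite coef_jw /jcoef kn -(bin_fact kn) !natrM.
  have f1 := fact_neq0 R k; have f2 := fact_neq0 R (n - k).
  have f3 : 'C(n, k)%:R != 0 :> R by rewrite pnatr_eq0 -lt0n bin_gt0.
  rewrite [g + 1 + _]addrAC.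
  by field; rewrite f1 f2 f3.
rewrite mulf_neq0 ?invr_eq0 ?fact_neq0 //.
by apply/lt0r_neq0/pochhammer_gt0; lra.
Qed.

Lemma laguerreE (z : R) n : laguerre z n = \poly_(k < n.+1)
  ((-1) ^+ k * (pochhammer (z + k%:R + 1) (n - k) / (n - k)`!%:R) / k`!%:R).
Proof. by rewrite poly_def. Qed.

Lemma size_laguerre (z : R) n : (size (laguerre z n) <= n.+1)%N.
Proof. by rewrite laguerreE size_poly. Qed.

Lemma laguerre_lead (z : R) n : (laguerre z n)`_n != 0.
Proof.
rewrite laguerreE coef_poly ltnSn subnn poch0 divr1 mulr1.
by rewrite mulf_neq0 ?signr_eq0 ?invr_eq0 ?fact_neq0.
Qed.

Lemma laguerre_rec (z : R) n k : (k < n)%N ->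
  k.+1%:R * (z + 1 + k%:R) * (laguerre z n)`_k.+1
    = (k%:R - n%:R) * (laguerre z n)`_k.
Proof.
move=> kn; rewrite laguerreE !coef_poly !ltnS kn (ltnW kn).
rewrite -[(n - k)%N]subnSK // pochSl !factS !natrM exprS.
have -> : (n - k.+1).+1%:R = n%:R - k%:R :> R by rewrite subnSK // natrB // ltnW.
have f1 := fact_neq0 R k; have f2 := fact_neq0 R (n - k.+1).
have f3 : n%:R - k%:R != 0 :> R.
  by rewrite -natrB ?(ltnW kn) // pnatr_eq0 subn_eq0 -ltnNge.
have f4 : k%:R + 1 != 0 :> R by rewrite natr1 pnatr_eq0.
have -> : z + k.+1%:R + 1 = z + k%:R + 1 + 1 by rewrite -[k.+1%:R]natr1 addrA.
rewrite -[k.+1%:R]natr1; by field; rewrite f1 f2 f3 f4.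
Qed.
End SpecialValues.

(** * The contiguity relations indexed by m, both parities together *)

Section ContiguousIndexed.
Variables (R : realType) (N : nat) (hN : (2 < N)%N) (a : R) (ha : 2^-1 < a).
Local Notation al := (alpha N a).
Local Notation "1+2X" := (1 + 2 *: 'X).

Lemma alpha_gt0 : 0 < al.
Proof.
have a1 := ha; have N3 : 3 <= N%:R :> R by rewrite ler_nat.
have : 3 * 1 <= N%:R * (a + 2^-1) by apply: ler_pM => //; lra.
by rewrite /alpha; lra.
Qed.

Definition J (m : nat) (b c : R) n : {poly R} := P N a m b c n \Po 1+2X.

Lemma alpha_beta m : al + beta N a m = - 2^-1 - m%:R.
Proof. by rewrite /alpha /beta; lra. Qed.

Let comp_polyN (p q : {poly R}) : (- p) \Po q = - (p \Po q).
Proof. by rewrite -scaleN1r comp_polyZ scaleN1r. Qed.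
(** These are the linear shapes of varphi, phi and chi over arbitrary polynomials: one rewriting
    distributes the substitution t = 1 + 2 w over a whole combination. *)
Let lin_even (q p1 p2 p3 p4 : {poly R}) (c1 c3 c4 : R) :
  (c1 *: p1 - p2 - c3 *: p3 + c4 *: p4) \Po q = c1 *: (p1 \Po q) - (p2 \Po q)
    - c3 *: (p3 \Po q) + c4 *: (p4 \Po q).
Proof. by rewrite !(comp_polyD, comp_polyN, comp_polyZ). Qed.
Let lin_odd (q p1 p2 p3 p4 p5 : {poly R}) (c1 c3 c4 c5 : R) :
  (c1 *: p1 - p2 + c3 *: p3 + c4 *: p4 - c5 *: p5) \Po q = c1 *: (p1 \Po q)
    - (p2 \Po q) + c3 *: (p3 \Po q) + c4 *: (p4 \Po q) - c5 *: (p5 \Po q).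
Proof. by rewrite !(comp_polyD, comp_polyN, comp_polyZ). Qed.
Let lin_phi_even (q p1 p2 p3 p4 p5 : {poly R}) (c2 c3 c4 c5 : R) :
  (p1 - c2 *: p2 - c3 *: p3 - c4 *: p4 + c5 *: p5) \Po q = (p1 \Po q)
   - c2 *: (p2 \Po q) - c3 *: (p3 \Po q) - c4 *: (p4 \Po q) + c5 *: (p5 \Po q).
Proof. by rewrite !(comp_polyD, comp_polyN, comp_polyZ). Qed.
Let lin_phi_odd (q p1 p2 p3 p4 : {poly R}) (c2 c3 c4 : R) :
  (p1 - c2 *: p2 - c3 *: p3 + c4 *: p4) \Po q = (p1 \Po q)
   - c2 *: (p2 \Po q) - c3 *: (p3 \Po q) + c4 *: (p4 \Po q).
Proof. by rewrite !(comp_polyD, comp_polyN, comp_polyZ). Qed.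
Let lin_chi (q p1 p2 p3 p4 p5 p6 : {poly R}) (c1 c2 c4 c5 c6 : R) :
  (c1 *: p1 + c2 *: p2 - p3 - c4 *: p4 - c5 *: p5 + c6 *: p6) \Po q
  = c1 *: (p1 \Po q) + c2 *: (p2 \Po q) - (p3 \Po q) - c4 *: (p4 \Po q)
    - c5 *: (p5 \Po q) + c6 *: (p6 \Po q).
Proof. by rewrite !(comp_polyD, comp_polyN, comp_polyZ). Qed.

Lemma natr_double h : h.*2%:R = 2 * h%:R :> R.
Proof. by rewrite -[h.*2]mul2n natrM. Qed.

Lemma alpha_beta_even h : al + beta N a h.*2 = - 2^-1 - 2 * h%:R.
Proof. by rewrite alpha_beta natr_double. Qed.
Lemma alpha_beta_odd h : al + beta N a h.*2.+1 = - 2^-1 - (2 * h%:R + 1).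
Proof. by rewrite alpha_beta -[h.*2.+1%:R]natr1 natr_double. Qed.

Lemma parity m : exists h, m = h.*2 \/ m = h.*2.+1.
Proof. by exists m./2; case: (boolP (odd m)) => h; [right|left]; lia. Qed.

(** The constant depends on the parity of m, but any multiple of the lower family is harmonic, so
    its existence is all that is recorded. *)
Lemma contig2 m : (2 <= m)%N -> exists c,
  'X * J m 2 0 (m./2 - 1)
    - (2 * (al + 1) / (2 * ((m - 1)./2)%:R + 1)) *: J m 1 0 (m./2 - 1)
  = c *: J m 0 0 m./2.
Proof.
have [h [] -> m2] := parity m.
  have h1 : (1 <= h)%N by lia.
  have := contig2_even alpha_gt0 (alpha_beta_even h) h1; rewrite subn0 => E.
  eexists; rewrite doubleK; apply: (etrans _ E); congr (_ - (_ / _) *: _).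
  have -> : ((h.*2 - 1)./2 = h - 1)%N by lia.
  by rewrite natrB //; ring.
have h1 : (1 <= h)%N by lia.
have := contig2_odd alpha_gt0 (alpha_beta_odd h) h1; rewrite subn0 => E.
eexists.
have -> : (h.*2.+1./2 = h)%N by lia.
have -> : ((h.*2.+1 - 1)./2 = h)%N by lia.
exact: E.
Qed.

Lemma contig3 m : (3 <= m)%N -> exists c,
  (2 *: 'X + 2 / 3 *: 1) * J m 3 0 (m - 3)./2 + (varphi N a m \Po 1+2X)
  = c *: J m 0 0 m./2.
Proof.
have [h [] -> m3] := parity m.
  have h2 : (2 <= h)%N by lia.
  have := contig3_even alpha_gt0 (alpha_beta_even h) h2; rewrite subn0 => E.
  eexists; rewrite doubleK /varphi odd_double /varphi_even; apply: (etrans _ E).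
  have -> : ((h.*2 - 3)./2 = h - 2)%N by lia.
  by rewrite lin_even; rewrite doubleK natr_double.
have h1 : (1 <= h)%N by lia.
have := contig3_odd alpha_gt0 (alpha_beta_odd h) h1; rewrite subn0 => E.
eexists; rewrite /varphi /= odd_double /= /varphi_odd.
have -> : (uphalf h.*2 = h)%N by lia.
have -> : ((h.*2.+1 - 3)./2 = h - 1)%N by lia.
have -> : ((h.*2.+1).-1./2 = h)%N by lia.
by rewrite lin_odd; rewrite -[h.*2.+1%:R]natr1 natr_double; exact: E.
Qed.

Lemma contig3h m : (3 <= m)%N -> exists c,
  (4 * (al + 2) / (2 * (m./2)%:R - 1)) *: J m 2 0 (m - 3)./2
    - 2 *: ('X * J m 3 0 (m - 3)./2)
  = c *: J m 1 0 (m - 1)./2.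
Proof.
have [h [] -> m3] := parity m.
  have h2 : (2 <= h)%N by lia.
  have := contig3h_even alpha_gt0 (alpha_beta_even h) h2 => E.
  eexists; rewrite doubleK.
  have -> : ((h.*2 - 3)./2 = h - 2)%N by lia.
  have -> : ((h.*2 - 1)./2 = h - 1)%N by lia.
  exact: E.
have h1 : (1 <= h)%N by lia.
have := contig3h_odd alpha_gt0 (alpha_beta_odd h) h1; rewrite subn0 => E.
eexists.
have -> : (h.*2.+1./2 = h)%N by lia.
have -> : ((h.*2.+1 - 3)./2 = h - 1)%N by lia.
have -> : ((h.*2.+1 - 1)./2 = h)%N by lia.
by apply: (etrans _ E); congr ((_ / _) *: _ - _); ring.
Qed.

(** The coefficient of Phi2 in Psi4, in the variable w. *)
Definition J4 m : {poly R} :=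
  (3 / (2 * (((m - 3)./2)%:R + 2^-1))) *: J m 3 0 (m./2 - 2).

Lemma J4_even h : (2 <= h)%N ->
  J4 h.*2 = (3 / (2 * h%:R - 3)) *: J h.*2 3 0 (h - 2).
Proof.
move=> h2; rewrite /J4 doubleK; congr ((_ / _) *: _).
have -> : ((h.*2 - 3)./2 = h - 2)%N by lia.
by rewrite natrB //; field.
Qed.
Lemma J4_odd h : (2 <= h)%N ->
  J4 h.*2.+1 = (3 / (2 * h%:R + 1 - 2)) *: J h.*2.+1 3 0 (h - 2).
Proof.
move=> h2; rewrite /J4.
have -> : (h.*2.+1./2 = h)%N by lia.
have -> : ((h.*2.+1 - 3)./2 = h - 1)%N by lia.
by congr ((_ / _) *: _); rewrite natrB ?(ltnW h2) //; field.
Qed.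

Lemma contig4a m : (4 <= m)%N -> exists c,
  J4 m - (3 / (2 * (al + 3))) *: ('X * J m 4 0 (m./2 - 2))
  = c *: J m 2 0 (m./2 - 1).
Proof.
have [h [] -> m4] := parity m; have h2 : (2 <= h)%N by lia.
  have := contig4a_even alpha_gt0 (alpha_beta_even h) h2 => E.
  by eexists; rewrite doubleK J4_even //; exact: E.
have := contig4a_odd alpha_gt0 (alpha_beta_odd h) h2 => E.
eexists; rewrite J4_odd //; have -> : (h.*2.+1./2 = h)%N by lia.
exact: E.
Qed.

Lemma contig4b m : (4 <= m)%N -> exists c,
  2 *: J4 m + (3 / 2) *: (phi N a m \Po 1+2X)
    - (3 *: 'X + 1) * J m 4 0 (m./2 - 2)
  = c *: J m 1 0 (m - 1)./2.
Proof.
have [h [] -> m4] := parity m; have h2 : (2 <= h)%N by lia.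
  have := contig4b_even alpha_gt0 (alpha_beta_even h) h2 => E.
  eexists; rewrite J4_even // /phi odd_double /phi_even !doubleK.
  have -> : ((h.*2 - 1)./2 = h - 1)%N by lia.
  apply: (etrans _ E); rewrite lin_phi_even; rewrite natr_double scalerA.
  by congr ((_ *: _ + _) - _); ring.
have := contig4b_odd alpha_gt0 (alpha_beta_odd h) h2 => E.
exists 0; rewrite scale0r; apply: (etrans _ E); rewrite J4_odd // /phi /= odd_double /= /phi_odd.
have -> : (uphalf h.*2 = h)%N by lia.
have -> : ((h.*2.+1 - 3)./2 = h - 1)%N by lia.
have -> : ((h.*2.+1 - 5)./2 = h - 2)%N by lia.
rewrite lin_phi_odd; rewrite -[h.*2.+1%:R]natr1 natr_double scalerA.
by congr ((_ *: _ + _) - _); ring.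
Qed.

Lemma contig4c m : (4 <= m)%N ->
  J4 m + (3 / 2) *: ((phi N a m \Po 1+2X) + (chi N a m \Po 1+2X)) + 'X * J4 m
  = 0.
Proof.
have [h [] -> m4] := parity m; have h2 : (2 <= h)%N by lia.
  have := contig4c_even alpha_gt0 (alpha_beta_even h) h2 => E.
  apply: (etrans _ E); rewrite J4_even // /phi /chi odd_double /phi_even /chi_even !doubleK.
  by rewrite lin_phi_even lin_chi; rewrite natr_double.
have := contig4c_odd alpha_gt0 (alpha_beta_odd h) h2 => E.
apply: (etrans _ E); rewrite J4_odd // /phi /chi /= odd_double /= /phi_odd /chi_odd.
have -> : ((h.*2.+1 - 3)./2 = h - 1)%N by lia.
have -> : ((h.*2.+1 - 5)./2 = h - 2)%N by lia.
by rewrite lin_phi_odd lin_chi; rewrite -[h.*2.+1%:R]natr1 natr_double.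
Qed.
End ContiguousIndexed.

Import numFieldNormedType.Exports.
Import ScalarOperator.
Local Open Scope complex_scope.

(** * Conjugation of the Hamiltonian by the gauge factor *)

(** Formulas such as mu = exp (logmu) hold on the open configuration space only, so
    differentiability has to be transported along an equality near a point. *)
Lemma near_eq_differentiable (K : numFieldType) (U W : normedModType K)
    (f g : U -> W) (x : U) :
  (\near x, f x = g x) -> differentiable f x -> differentiable g x.
Proof.
move=> fg df.
have E : g \o shift x = cst (g x) + 'd f x +o_ 0 id.
  apply/eqaddoP => _/posnumP[e].
  have /eqaddoP/(_ e%:num)/(_ [gt0 of e%:num]) := diff_locally df.
  have fg0 : \forall y \near 0, f (y + x) = g (y + x).
    by have := fg; rewrite (near_shift 0) subr0; apply.
  apply: filter_app; near=> y => /=.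
  rewrite -![(_ + _ : _ -> _) _]/(_ + _) -![(- _ : _ -> _) _]/(- _) /=.
  rewrite -![(_ + _ : _ -> _) _]/(_ + _) /cst (nbhs_singleton fg).
  by have -> // : f (y + x) = g (y + x) by near: y.
have D : 'd g x = 'd f x :> (U -> W).
  by apply: diff_unique => //; exact: diff_continuous.
by apply/diff_locallyP; rewrite D; split => //; exact: diff_continuous.
Unshelve. all: by end_near. Qed.

Section Calculus.
Variables (R : realType) (N : nat).
Local Notation V := 'rV[R]_N.
Implicit Types (f g : V -> R) (i j : 'I_N) (x : V).

(** Differentiability travels with the value of the partial derivative, because each rule for the
    latter presupposes the former. *)
Definition hasD f i x (d : R) : Prop :=
  differentiable f x /\ 'D_(delta_mx 0 i) f x = d.

Lemma hasD_near f g i x d :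
  (\near x, f x = g x) -> hasD f i x d -> hasD g i x d.
Proof.
move=> fg [df <-]; split; first exact: near_eq_differentiable df.
by apply/esym/near_eq_derive.
Qed.
Lemma hasD_eq f g i x d d' : f = g -> d = d' -> hasD f i x d -> hasD g i x d'.
Proof. by move=> -> ->. Qed.
Lemma hasD_cst (c : R) i x : hasD (fun=> c) i x 0.
Proof. by split; [exact: differentiable_cst|rewrite derive_cst]. Qed.
Lemma hasD_coord j i x : hasD (fun y => y 0 j) i x (i == j)%:R.
Proof.
(* Packaged as a linear map, the coordinate function is its own differential. *)
have @c : {linear V -> R}.
  by exists (fun y : V => y 0 j); do 2![eexists]; do ?[constructor];
     rewrite ?mxE// => ? *; rewrite ?mxE//; move=> ?; rewrite !mxE.
have cc : continuous (c : V -> R) by exact: coord_continuous.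
have dc : differentiable (c : V -> R) x by exact: linear_differentiable.
have -> : (fun y : V => y 0 j) = c by [].
split => //; rewrite (deriveE _ dc) (diff_lin x cc).
by rewrite /= mxE eqxx eq_sym.
Qed.
Lemma hasD_add f g i x d e :
  hasD f i x d -> hasD g i x e -> hasD (fun y => f y + g y) i x (d + e).
Proof.
move=> [df <-] [dg <-]; split; first exact: differentiableD.
by apply: deriveD; apply: diff_derivable.
Qed.
Lemma hasD_opp f i x d : hasD f i x d -> hasD (fun y => - f y) i x (- d).
Proof.
move=> [df <-]; split; first exact: differentiableN.
by apply: deriveN; apply: diff_derivable.
Qed.
Lemma hasD_mul f g i x d e : hasD f i x d -> hasD g i x e ->
  hasD (fun y => f y * g y) i x (d * g x + f x * e).
Proof.
move=> [df <-] [dg <-]; split; first exact: differentiableM.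
have -> : (fun y => f y * g y) = f * g by [].
rewrite deriveM; [|exact: diff_derivable|exact: diff_derivable].
by rewrite addrC /GRing.scale /=; congr (_ + _); rewrite mulrC.
Qed.
Lemma hasD_comp (h : R -> R) f i x d e :
  hasD f i x d -> is_derive (f x) 1 h e -> hasD (fun y => h (f y)) i x (e * d).
Proof.
move=> [df <-] [dh <-].
have dh' : differentiable h (f x) by apply/derivable1_diffP.
split; first exact: (differentiable_comp df dh').
rewrite (deriveE _ (differentiable_comp df dh')) diff_comp // [LHS]/=.
by rewrite deriv1E // (deriveE _ df) -derive1E [RHS]mulrC.
Qed.
Lemma hasD_sum (I : Type) (r : seq I) (P : pred I) (F : I -> V -> R) (d : I -> R) i x :
  (forall l, P l -> hasD (F l) i x (d l)) ->
  hasD (fun y => \sum_(l <- r | P l) F l y) i x (\sum_(l <- r | P l) d l).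
Proof.
move=> h; elim: r => [|l r IH].
  rewrite big_nil; apply: hasD_eq (hasD_cst 0 i x) => //.
  by apply/funext => y; rewrite big_nil.
rewrite big_cons; case: ifP => Pl.
  apply: hasD_eq (hasD_add (h l Pl) IH) => //.
  by apply/funext => y; rewrite big_cons Pl.
apply: hasD_eq IH => //.
by apply/funext => y; rewrite big_cons Pl.
Qed.

Lemma config_near x : config x -> \near x, config x.
Proof.
move=> cx; suff : \forall y \near x, forall p : 'I_N * 'I_N,
    (p.1 < p.2)%N -> (y : V) 0 p.1 < (y : V) 0 p.2.
  by apply: filterS => y h i j; exact: (h (i, j)).
apply: (@filter_forall V _ (fun (p : 'I_N * 'I_N) (y : V) =>
  (p.1 < p.2)%N -> y 0 p.1 < y 0 p.2) (nbhs x) (nbhs_filter x)) => -[i j] /=.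
have [ij|ij] := boolP (i < j)%N; last by apply: filterE.
have x0 : 0 < x 0 j - x 0 i by rewrite subr_gt0 cx.
have dx : differentiable (fun y : V => y 0 j - y 0 i) x.
  by apply: differentiableB; exact: differentiable_coord.
have /cvgr_gt/(_ _ x0) := differentiable_continuous dx.
by apply: filterS => y; rewrite subr_gt0.
Qed.

End Calculus.

Section Model.
Variables (R : realType) (N : nat) (hN : (2 < N)%N) (twoM : nat) (a omega : R).
Local Notation V := 'rV[R]_N.
Implicit Types (f g : V -> R) (i j l : 'I_N) (x y : V).

Definition gap l x : R := x 0 l - x 0 (ordS l).

Lemma config_inj x i j : config x -> i != j -> x 0 i != x 0 j.
Proof.
move=> cx; rewrite -val_eqE neq_ltn => /orP[] /cx h; first by rewrite lt_eqF.
by rewrite gt_eqF.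
Qed.
Lemma config_next x : config x -> forall l, x 0 l != x 0 (ordS l).
Proof. by move=> cx l; apply: config_inj => //; rewrite eq_sym ordS_neq. Qed.
Lemma gap_neq0 x l : config x -> gap l x != 0.
Proof. by move=> cx; rewrite subr_eq0 config_next. Qed.

Lemma hasD_inv f i x d : hasD f i x d -> f x != 0 ->
  hasD (fun y => (f y)^-1) i x (- (f x ^+ 2)^-1 * d).
Proof.
move=> [df <-] fx; split; first exact: differentiableV.
by rewrite deriveV //; exact: diff_derivable.
Qed.

Lemma hasD_gap l i x : hasD (gap l) i x (del R l i).
Proof.
apply: hasD_eq (hasD_add (hasD_coord l i x) (hasD_opp (hasD_coord (ordS l) i x))) => //.
by rewrite /del ![i == _]eq_sym.
Qed.

(* The constant sign of x_l - x_(l+1) on the configuration space. *)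
Definition gap_sign l : R := if (l < ordS l)%N then -1 else 1.
Lemma gap_signP l x : config x -> 0 < gap_sign l * gap l x.
Proof.
move=> cx; rewrite /gap_sign /gap; case: ltnP => h.
  by rewrite mulN1r opprB subr_gt0 cx.
rewrite mul1r subr_gt0 cx // ltn_neqAle h andbT.
by rewrite (inj_eq val_inj) ordS_neq.
Qed.
Lemma gap_sign_sqr l : gap_sign l * gap_sign l = 1.
Proof. by rewrite /gap_sign; case: ifP => _; ring. Qed.

(** The logarithm of mu on the configuration space, where each absolute value is the gap times its
    constant sign. *)
Definition logmu x : R :=
  - (omega / 2) * rsq x + \sum_l a * ln (gap_sign l * gap l x).

Lemma mu_logmu x : config x -> mu a omega x = expR (logmu x).
Proof.
move=> cx; rewrite /mu /logmu expRD expR_sum; congr (_ * _).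
(* [powR] has a separate value at base 0, excluded here because the gaps do not vanish. *)
apply: eq_bigr => l _; rewrite /powR normr_eq0 -/(gap l x) (negPf (gap_neq0 l cx)).
congr (expR (_ * ln _)); rewrite -[RHS]ger0_norm ?ltW ?gap_signP //.
by rewrite normrM /gap_sign; case: ifP => _; rewrite ?normrN normr1 mul1r.
Qed.

Definition dlogmu i x : R :=
  - omega * x 0 i + a * ((gap i x)^-1 - (gap (ord_pred i) x)^-1).

Lemma sum_del i (F : 'I_N -> R) : \sum_l F l * del R l i = F i - F (ord_pred i).
Proof.
under eq_bigr do rewrite mulrBr; rewrite sumrB; congr (_ - _).
  rewrite (bigD1 i) //= eqxx mulr1 big1 ?addr0 // => l /negPf ->.
  by rewrite mulr0.
rewrite (bigD1 (ord_pred i)) //= ord_predK eqxx mulr1 big1 ?addr0 // => l li.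
by rewrite -(inj_eq (can_inj (@ord_predK N))) -[l]ordSK in li *; rewrite ordSK in li *;
  case: eqP => [e|_]; rewrite ?mulr0 //; rewrite -e !ordSK eqxx in li.
Qed.

Lemma hasD_rsq i x : hasD (@rsq R N) i x (2 * x 0 i).
Proof.
apply: hasD_eq (hasD_sum (index_enum _) (P := xpredT)
  (fun j _ => hasD_mul (hasD_coord j i x) (hasD_coord j i x))) => //.
rewrite (bigD1 i) //= eqxx big1 ?addr0 => [|j /negPf ji]; first by rewrite /=; ring.
by rewrite eq_sym ji /=; ring.
Qed.

Lemma hasD_logmu i x : config x -> hasD logmu i x (dlogmu i x).
Proof.
move=> cx; have hl l : hasD (fun y => a * ln (gap_sign l * gap l y)) i x
    (a * ((gap l x)^-1 * del R l i)).
  have g := hasD_mul (hasD_cst (gap_sign l) i x) (hasD_gap l i x).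
  have := hasD_mul (hasD_cst a i x) (hasD_comp g (is_derive1_ln (gap_signP l cx))).
  apply: hasD_eq => //; rewrite !mul0r !add0r invfM.
  have [g0 s0] := (gap_neq0 l cx, gap_sign_sqr l).
  have s1 : gap_sign l != 0.
    by apply: contraTneq isT => e; move: s0; rewrite e mul0r => /eqP; rewrite eq_sym oner_eq0.
  by field; rewrite g0 s1.
apply: hasD_eq (hasD_add (hasD_mul (hasD_cst (- (omega / 2)) i x) (hasD_rsq i x))
  (hasD_sum (index_enum _) (P := xpredT) (fun l _ => hl l))) => //.
by rewrite -mulr_sumr sum_del /dlogmu mul0r add0r; congr (_ + _); field.
Qed.

Lemma hasD_mu i x : config x ->
  hasD (mu a omega) i x (mu a omega x * dlogmu i x).
Proof.
move=> cx; apply: (@hasD_near _ _ (fun y => expR (logmu y))).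
  by apply: filterS (config_near cx) => y cy; rewrite mu_logmu.
by rewrite (mu_logmu cx); apply: hasD_comp (hasD_logmu i cx) (is_derive_expR _).
Qed.

(** A class of functions closed under partial derivatives and containing those of log mu. Every
    iterated derivative of mu times a nice function is therefore again of that form, which yields
    smoothness. *)
Inductive nice : (V -> R) -> Prop :=
| nice_cst c : nice (fun=> c)
| nice_coord j : nice (fun y => y 0 j)
| nice_inv j : nice (fun y => (gap j y)^-1)
| nice_add f g of nice f & nice g : nice (fun y => f y + g y)
| nice_mul f g of nice f & nice g : nice (fun y => f y * g y).

Lemma nice_D f : nice f -> forall i, exists2 f', nice f' &
  forall x, config x -> hasD f i x (f' x).
Proof.
elim=> {f} [c|j|j|f g _ IHf _ IHg|f g nf IHf ng IHg] i.
- exists (fun=> 0); first exact: nice_cst.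
  by move=> x _; exact: hasD_cst.
- exists (fun=> (i == j)%:R); first exact: nice_cst.
  by move=> x _; exact: hasD_coord.
- exists (fun y => - del R j i * ((gap j y)^-1 * (gap j y)^-1)).
    by apply: nice_mul; [exact: nice_cst|apply: nice_mul; exact: nice_inv].
  move=> x cx; apply: hasD_eq (hasD_inv (hasD_gap j i x) (gap_neq0 j cx)) => //.
  by field; exact: gap_neq0.
- have [[f' nf' hf] [g' ng' hg]] := (IHf i, IHg i).
  exists (fun y => f' y + g' y); first exact: nice_add.
  by move=> x cx; apply: hasD_add; [exact: hf|exact: hg].
- have [[f' nf' hf] [g' ng' hg]] := (IHf i, IHg i).
  exists (fun y => f' y * g y + f y * g' y).
    by apply: nice_add; apply: nice_mul.
  by move=> x cx; apply: hasD_mul; [exact: hf|exact: hg].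
Qed.

Lemma nice_dlogmu i : nice (dlogmu i).
Proof.
apply: nice_add; first by apply: nice_mul; [exact: nice_cst|exact: nice_coord].
apply: nice_mul; first exact: nice_cst.
apply: nice_add; first exact: nice_inv.
have -> : (fun y => - (gap (ord_pred i) y)^-1)
  = (fun y => -1 * (gap (ord_pred i) y)^-1).
  by apply/funext => y; rewrite mulN1r.
by apply: nice_mul; [exact: nice_cst|exact: nice_inv].
Qed.

Lemma mu_nice_D f i : nice f -> exists2 f', nice f' &
  forall x, config x ->
    hasD (fun y => mu a omega y * f y) i x (mu a omega x * f' x).
Proof.
move=> nf; have [f' nf' hf] := nice_D nf i.
exists (fun y => dlogmu i y * f y + f' y).
  by apply: nice_add => //; apply: nice_mul => //; exact: nice_dlogmu.
move=> x cx; apply: hasD_eq (hasD_mul (hasD_mu i cx) (hf x cx)) => //.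
by ring.
Qed.

Local Notation Sg := (Sigma R N twoM).
Local Notation wf := (wavefun R N twoM).
Variables (I : finType) (U : I -> Sg).

(** Fixed spin vectors with real coefficient functions: the real and imaginary parts of each
    component are then constant real combinations of the h p, and the calculus reduces to real
    functions. *)
Definition comb (h : I -> V -> R) : wf := fun y => \sum_p (h p y)%:C *: U p.

Lemma comb_c h y c : comb h y c = \sum_p (h p y)%:C * U p c.
Proof. by rewrite /comb sum_ffunE; apply: eq_bigr => p _; rewrite ffunE. Qed.
Lemma Re_comb h y c :
  complex.Re (comb h y c) = \sum_p h p y * complex.Re (U p c).
Proof.
rewrite comb_c raddf_sum; apply: eq_bigr => p _ /=.
by case: (U p c) => u v /=; rewrite mul0r subr0.
Qed.
Lemma Im_comb h y c :
  complex.Im (comb h y c) = \sum_p h p y * complex.Im (U p c).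
Proof.
rewrite comb_c raddf_sum; apply: eq_bigr => p _ /=.
by case: (U p c) => u v /=; rewrite mul0r addr0.
Qed.

Lemma dpart_near (F G : wf) i x : (\near x, F x = G x) ->
  dpart i F x = dpart i G x.
Proof.
move=> FG; apply/ffunP => c; rewrite !ffunE; congr (_ +i* _);
  by apply: near_eq_derive; apply: filterS FG => y ->.
Qed.

Lemma hasD_comb h h' i x (r : R[i] -> R) c :
    (forall F y, r (comb F y c) = \sum_p F p y * r (U p c)) ->
    (forall p, hasD (h p) i x (h' p)) ->
  hasD (fun y => r (comb h y c)) i x (\sum_p h' p * r (U p c)).
Proof.
move=> rE hh.
apply: hasD_eq (hasD_sum (index_enum _) (P := xpredT)
   (fun p _ => hasD_mul (hh p) (hasD_cst (r (U p c)) i x))) => //.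
  by apply/funext => y; rewrite rE.
by apply: eq_bigr => p _; rewrite mulr0 addr0.
Qed.

Lemma dpart_comb h (h' : I -> V -> R) i x :
  (forall p, hasD (h p) i x (h' p x)) -> dpart i (comb h) x = comb h' x.
Proof.
move=> hh; apply/ffunP => c; rewrite ffunE.
have [_ ->] := hasD_comb (fun F y => Re_comb F y c) hh.
have [_ ->] := hasD_comb (fun F y => Im_comb F y c) hh.
by rewrite -Re_comb -Im_comb; case: (comb h' x c).
Qed.

Lemma smooth_comb (F : wf) (q : I -> V -> R) : (forall p, nice (q p)) ->
  (forall x, config x -> F x = comb (fun p y => mu a omega y * q p y) x) ->
  smooth F.
Proof.
move=> nq Fq l.
have [q' nq' Fq'] : exists2 q' : I -> V -> R, (forall p, nice (q' p)) &
    forall x, config x ->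
      foldr (@dpart R N twoM) F l x = comb (fun p y => mu a omega y * q' p y) x.
  elim: l => [|i l [q' nq' IH]]; first by exists q.
  have /choice[q2 hq2] : forall p, exists f', nice f' /\ forall x, config x ->
      hasD (fun y => mu a omega y * q' p y) i x (mu a omega x * f' x).
    by move=> p; have [f' ? ?] := mu_nice_D i (nq' p); exists f'.
  exists q2 => [p|x cx /=]; first by have [] := hq2 p.
  rewrite (@dpart_near _ (comb (fun p y => mu a omega y * q' p y))); last first.
    by apply: filterS (config_near cx) => y; exact: IH.
  by apply: dpart_comb => p; have [_] := hq2 p; exact.
move=> c x cx.
(* Only differentiability is extracted here, so the index is arbitrary. *)
have hD p := (mu_nice_D (first hN) (nq' p)).
have /choice[d hd] : forall p, exists d,
    hasD (fun y => mu a omega y * q' p y) (first hN) x d.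
  by move=> p; have [f' _ h] := hD p; exists (mu a omega x * f' x); exact: h.
have near r : \near x, r (comb (fun p y => mu a omega y * q' p y) x c)
     = r (foldr (@dpart R N twoM) F l x c) :> R.
  by apply: filterS (config_near cx) => y cy; rewrite Fq'.
split.
  apply: near_eq_differentiable (near (@complex.Re R)) _.
  by have [] := hasD_comb (fun F y => Re_comb F y c) hd.
apply: near_eq_differentiable (near (@complex.Im R)) _.
by have [] := hasD_comb (fun F y => Im_comb F y c) hd.
Qed.
End Model.

(** * The Hamiltonian on mu times symmetrized polynomial states *)

Section Conjugation.
Variables (R : realType) (N : nat) (hN : (2 < N)%N) (twoM : nat) (a omega : R).
Local Notation V := 'rV[R]_N.
Local Notation Sg := (Sigma R N twoM).
Local Notation wf := (wavefun R N twoM).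
Local Notation poly := (PowerSums.poly_in R N).
Implicit Types (i j l : 'I_N) (x y : V) (p : 'S_N) (s : Sg).

Lemma hasD_ev (q : poly) i x :
  hasD (fun y : V => ev q (y 0)) i x (ev (dv i q) (x 0)).
Proof.
elim/poly_ind: q => [c|j|u w hu hw|u w hu hw].
- apply: hasD_eq (hasD_cst c i x); first by apply/funext => y; rewrite evC.
  by rewrite dvC ev0.
- apply: hasD_eq (hasD_coord j i x); first by apply/funext => y; rewrite evV.
  by rewrite dvV ev_nat.
- apply: hasD_eq (hasD_add hu hw); first by apply/funext => y; rewrite evD.
  by rewrite dvD evD.
- apply: hasD_eq (hasD_mul hu hw); first by apply/funext => y; rewrite evM.
  by rewrite dvM !evE.
Qed.

Lemma nice_ev (q : poly) : nice (fun y : V => ev q (y 0)).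
Proof.
elim/poly_ind: q => [c|j|u w hu hw|u w hu hw].
- have -> : (fun y : V => ev (scal N c) (y 0)) = (fun=> c).
    by apply/funext => y; rewrite evC.
  exact: nice_cst.
- have -> : (fun y : V => ev (var R j) (y 0)) = (fun y => y 0 j).
    by apply/funext => y; rewrite evV.
  exact: nice_coord.
- have -> : (fun y : V => ev (u + w) (y 0)) = (fun y => ev u (y 0) + ev w (y 0)).
    by apply/funext => y; rewrite evD.
  exact: nice_add.
- have -> : (fun y : V => ev (u * w) (y 0)) = (fun y => ev u (y 0) * ev w (y 0)).
    by apply/funext => y; rewrite evM.
  exact: nice_mul.
Qed.

Definition ddlogmu i x : R :=
  - omega - a * ((gap i x ^+ 2)^-1 + (gap (ord_pred i) x ^+ 2)^-1).

Lemma hasD_dlogmu i x : config x ->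
  hasD (dlogmu a omega i) i x (ddlogmu i x).
Proof.
move=> cx; have [g1 g2] := (gap_neq0 hN i cx, gap_neq0 hN (ord_pred i) cx).
have h1 := hasD_inv (hasD_gap i i x) g1.
have h2 := hasD_inv (hasD_gap (ord_pred i) i x) g2.
apply: hasD_eq (hasD_add (hasD_mul (hasD_cst (- omega) i x) (hasD_coord i i x))
  (hasD_mul (hasD_cst a i x) (hasD_add h1 (hasD_opp h2)))) => //.
have -> : del R i i = 1 by rewrite /del eqxx (negPf (ordS_neq hN i)) subr0.
have -> : del R (ord_pred i) i = -1.
  have := ordS_neq hN (ord_pred i); rewrite ord_predK eq_sym => /negPf pi.
  by rewrite /del ord_predK eqxx pi sub0r.
rewrite /ddlogmu eqxx /=; field.
by rewrite g1 g2.
Qed.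

Lemma sum_pred (F : 'I_N -> R) : \sum_i F (ord_pred i) = \sum_i F i.
Proof. by rewrite [RHS](reindex_inj (can_inj (@ord_predK N))). Qed.

(** This is the Laplacian of mu divided by mu. Its products of neighbouring inverse gaps cancel the
    three-body potential of H0, and its inverse squares combine with the exchange potential into the
    difference quotient of [bond]. *)
Lemma sum_logmu x : config x ->
  \sum_i (dlogmu a omega i x ^+ 2 + ddlogmu i x)
  = omega ^+ 2 * rsq x - 2 * omega * a * N%:R - N%:R * omega
    + 2 * (a ^+ 2 - a) * \sum_i (gap i x ^+ 2)^-1
    - 2 * a ^+ 2 * \sum_i (gap i x * gap (ord_pred i) x)^-1.
Proof.
move=> cx.
(* Summation by parts around the cycle: each bond contributes (x_i - x_(i+1)) / gap = 1. This gives
   the term of E0 proportional to a. *)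
have E1 : \sum_i x 0 i * ((gap i x)^-1 - (gap (ord_pred i) x)^-1) = N%:R.
  under eq_bigr do rewrite mulrBr; rewrite sumrB.
  have <- : \sum_i x 0 (ordS i) / gap i x = \sum_i x 0 i / gap (ord_pred i) x.
    by rewrite -[RHS](sum_ordS (fun i => x 0 i / gap (ord_pred i) x));
      apply: eq_bigr => i _; rewrite ordSK.
  rewrite -sumrB (eq_bigr (fun=> 1)) => [|i _].
    by rewrite sumr_const card_ord.
  by rewrite -mulrBl divff // gap_neq0.
have E2 : \sum_i (gap (ord_pred i) x ^+ 2)^-1 = \sum_i (gap i x ^+ 2)^-1.
  exact: (sum_pred (fun i => (gap i x ^+ 2)^-1)).
rewrite (eq_bigr (fun i => omega ^+ 2 * x 0 i ^+ 2
   - 2 * omega * a * (x 0 i * ((gap i x)^-1 - (gap (ord_pred i) x)^-1))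
   - omega + (a ^+ 2 - a) * (gap i x ^+ 2)^-1
   + (a ^+ 2 - a) * (gap (ord_pred i) x ^+ 2)^-1
   - 2 * a ^+ 2 * (gap i x * gap (ord_pred i) x)^-1)) => [|i _]; last first.
  have [g1 g2] := (gap_neq0 hN i cx, gap_neq0 hN (ord_pred i) cx).
  by rewrite /dlogmu /ddlogmu; field; rewrite g1 g2.
rewrite !(sumrB, big_split) /= -!mulr_sumr E1 E2 sumr_const card_ord.
by rewrite /rsq -[_ *+ N]mulr_natl; ring.
Qed.

(** The left side is the coefficient of a single vector p|s> in H0 applied to a symmetrized state;
    [c i] is the coefficient that the exchange of the spins i and i + 1 moves onto that vector. *)
Lemma H0_scalar x (q : poly) (c : 'I_N -> R) : config x ->
  let g := ev q (x 0) in let g1 i := ev (dv i q) (x 0) in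
  let lam i := dlogmu a omega i x in
  (forall i, c i = ev (sw (tperm i (ordS i)) q) (x 0)) ->
  - (\sum_i mu a omega x * (lam i * (lam i * g + g1 i)
        + (ddlogmu i x * g + lam i * g1 i + ev (dv i (dv i q)) (x 0))))
  + omega ^+ 2 * rsq x * (mu a omega x * g)
  + (\sum_i 2 * a ^+ 2 / ((x 0 i - x 0 (ord_pred i)) * (x 0 i - x 0 (ordS i))))
      * (mu a omega x * g)
  + \sum_i 2 * a / (x 0 i - x 0 (ordS i)) ^+ 2
      * (a * (mu a omega x * g) - mu a omega x * c i)
  = mu a omega x * (E0 N a omega * g + 2 * omega * eul (x 0) q - T0 a (x 0) q).
Proof.
move=> cx g g1 lam hc.
have -> : \sum_i mu a omega x * (lam i * (lam i * g + g1 i)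
        + (ddlogmu i x * g + lam i * g1 i + ev (dv i (dv i q)) (x 0)))
    = mu a omega x * ((\sum_i (lam i ^+ 2 + ddlogmu i x)) * g
      + 2 * (\sum_i lam i * g1 i) + \sum_i ev (dv i (dv i q)) (x 0)).
  rewrite mulr_suml [2 * _]mulr_sumr -!big_split /= mulr_sumr.
  by apply: eq_bigr => i _; ring.
rewrite sum_logmu //.
have -> : \sum_i lam i * g1 i = - omega * eul (x 0) q
    + a * \sum_i (g1 i - g1 (ordS i)) / gap i x.
  rewrite /lam /dlogmu; under eq_bigr do rewrite mulrDl.
  rewrite big_split /=; congr (_ + _).
    by rewrite mulr_sumr; apply: eq_bigr => i _; rewrite mulrA.
  have -> : \sum_i (g1 i - g1 (ordS i)) / gap i x
     = \sum_i g1 i / gap i x - \sum_i g1 i / gap (ord_pred i) x.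
    rewrite -[X in _ - X](sum_ordS (fun i => g1 i / gap (ord_pred i) x)) -sumrB.
    by apply: eq_bigr => i _; rewrite ordSK mulrBl.
  by rewrite mulrBr !mulr_sumr -sumrB; apply: eq_bigr => i _; ring.
have -> : \sum_i 2 * a ^+ 2 / ((x 0 i - x 0 (ord_pred i)) * (x 0 i - x 0 (ordS i)))
    = - (2 * a ^+ 2) * \sum_i (gap i x * gap (ord_pred i) x)^-1.
  rewrite mulr_sumr; apply: eq_bigr => i _.
  have [g1' g2'] := (gap_neq0 hN i cx, gap_neq0 hN (ord_pred i) cx).
  have e : x 0 i - x 0 (ord_pred i) = - gap (ord_pred i) x by rewrite /gap ord_predK opprB.
  by rewrite e -/(gap i x); field; rewrite g1' g2'.
have -> : \sum_i 2 * a / (x 0 i - x 0 (ordS i)) ^+ 2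
      * (a * (mu a omega x * g) - mu a omega x * c i)
    = 2 * a ^+ 2 * mu a omega x * g * (\sum_i (gap i x ^+ 2)^-1)
      - 2 * a * mu a omega x * \sum_i c i / gap i x ^+ 2.
  rewrite [X in _ = X - _]mulr_sumr [X in _ = _ - X]mulr_sumr -sumrB.
  apply: eq_bigr => i _; rewrite -/(gap i x).
  by field; exact: gap_neq0.
rewrite /T0.
have -> : \sum_i bond (x 0) i q = \sum_i (g1 i - g1 (ordS i)) / gap i x
   - g * (\sum_i (gap i x ^+ 2)^-1) + \sum_i c i / gap i x ^+ 2.
  rewrite [X in _ - X]mulr_sumr -sumrB -big_split /=; apply: eq_bigr => i _.
  by rewrite /bond -hc -/(gap i x) -/(g1 _) -/(g1 _) -/g; ring.
by rewrite /E0; ring.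
Qed.

Definition spin_term s p : Sg := (N`!%:R)^-1 *: spin_perm p s.

Lemma spin_permZ p (c : R[i]) s : spin_perm p (c *: s) = c *: spin_perm p s.
Proof. by apply/ffunP => d; rewrite !ffunE. Qed.
Lemma spin_permD p s s' : spin_perm p (s + s') = spin_perm p s + spin_perm p s'.
Proof. by apply/ffunP => d; rewrite !ffunE. Qed.
Lemma spin_permN p s : spin_perm p (- s) = - spin_perm p s.
Proof. by apply/ffunP => d; rewrite !ffunE. Qed.
Lemma spin_perm0 p : spin_perm p 0 = 0 :> Sg.
Proof. by apply/ffunP => d; rewrite !ffunE. Qed.
Lemma spin_perm_sum p (I : Type) (r : seq I) (P : pred I) (F : I -> Sg) :
  spin_perm p (\sum_(i <- r | P i) F i) = \sum_(i <- r | P i) spin_perm p (F i).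
Proof. by elim/big_rec2: _ => [|i u w _ <-]; rewrite ?spin_perm0 ?spin_permD. Qed.
Lemma spin_permM p p' s : spin_perm p' (spin_perm p s) = spin_perm (p * p')%g s.
Proof.
apply/ffunP => d; rewrite !ffunE; congr (s _).
by apply/ffunP => k; rewrite !ffunE permM.
Qed.

Variable s : Sg.
Local Notation U := (spin_term s).

Lemma comb_scale (c : R) (h : 'S_N -> V -> R) x :
  c%:C *: comb U h x = comb U (fun p y => c * h p y) x.
Proof.
rewrite /comb scaler_sumr; apply: eq_bigr => p _.
by rewrite scalerA rmorphM.
Qed.
Lemma comb_add (h k : 'S_N -> V -> R) x :
  comb U h x + comb U k x = comb U (fun p y => h p y + k p y) x.
Proof.
rewrite /comb -big_split /=; apply: eq_bigr => p _.
by rewrite -scalerDl rmorphD.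
Qed.
Lemma comb_opp (h : 'S_N -> V -> R) x :
  - comb U h x = comb U (fun p y => - h p y) x.
Proof.
by rewrite /comb -sumrN; apply: eq_bigr => p _; rewrite -scaleNr rmorphN.
Qed.
Lemma comb_sum (I : Type) (r : seq I) (h : I -> 'S_N -> V -> R) x :
  \sum_(i <- r) comb U (h i) x = comb U (fun p y => \sum_(i <- r) h i p y) x.
Proof.
rewrite /comb exchange_big /=; apply: eq_bigr => p _.
by rewrite -scaler_suml rmorph_sum.
Qed.
Lemma comb_eq (h k : 'S_N -> V -> R) x :
  (forall p, h p x = k p x) -> comb U h x = comb U k x.
Proof. by move=> hk; apply: eq_bigr => p _; rewrite hk. Qed.

Lemma comb_perm (q : 'S_N) (h : 'S_N -> V -> R) x :
  spin_perm q (comb U h x) = comb U (fun p y => h (p * q^-1)%g y) x.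
Proof.
rewrite /comb spin_perm_sum [RHS](reindex_inj (mulIg q)) /=.
apply: eq_bigr => p _; rewrite mulgK spin_permZ /spin_term.
by rewrite spin_permZ spin_permM.
Qed.

(* A family of polynomials indexed by the images of the first two sites,
   equivariant under permutations of the coordinates. *)
Definition equivariant (G : 'I_N -> 'I_N -> poly) : Prop :=
  forall (q : 'S_N) j k, sw q (G j k) = G (q j) (q k).

Definition Lam (G : 'I_N -> 'I_N -> poly) : wf :=
  comb U (fun p y => ev (G (p (first hN)) (p (second hN))) (y 0)).

Lemma smooth_Lam G : smooth (fun x => (mu a omega x)%:C *: Lam G x).
Proof.
apply: (smooth_comb hN (a := a) (omega := omega) (U := U)
  (q := fun p y => ev (G (p (first hN)) (p (second hN))) (y 0))).
  by move=> p; exact: nice_ev.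
by move=> x _; rewrite comb_scale.
Qed.

(** A spin exchange merely reindexes the sum over p, and equivariance turns this reindexing into an
    exchange of coordinates inside the polynomial attached to p. *)
Lemma H0_Lam G x : equivariant G -> config x ->
  H0 a omega (fun y => (mu a omega y)%:C *: Lam G y) x
  = (mu a omega x)%:C *: comb U (fun p y =>
      let q := G (p (first hN)) (p (second hN)) in
      E0 N a omega * ev q (y 0) + 2 * omega * eul (y 0) q - T0 a (y 0) q) x.
Proof.
move=> eG cx; pose q p := G (p (first hN)) (p (second hN)).
pose F : wf := comb U (fun p y => mu a omega y * ev (q p) (y 0)).
have FE : (fun y => (mu a omega y)%:C *: Lam G y) = F.
  by apply/funext => y; rewrite comb_scale.
rewrite FE.
pose D1 i p y : R := mu a omega y * (dlogmu a omega i y * ev (q p) (y 0)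
    + ev (dv i (q p)) (y 0)).
have d1 i y : config y -> dpart i F y = comb U (D1 i) y.
  move=> cy; apply: dpart_comb => p.
  apply: hasD_eq (hasD_mul (hasD_mu hN a omega i cy) (hasD_ev (q p) i y)) => //.
  by rewrite /D1; ring.
pose D2 i p y : R := mu a omega y * (dlogmu a omega i y
  * (dlogmu a omega i y * ev (q p) (y 0) + ev (dv i (q p)) (y 0))
  + (ddlogmu i y * ev (q p) (y 0) + dlogmu a omega i y * ev (dv i (q p)) (y 0)
     + ev (dv i (dv i (q p))) (y 0))).
have d2 i : dpart i (dpart i F) x = comb U (D2 i) x.
  rewrite (@dpart_near _ _ _ _ (comb U (D1 i))); last first.
    by apply: filterS (config_near cx) => y; exact: d1.
  apply: dpart_comb => p.
  apply: hasD_eq (hasD_mul (hasD_mu hN a omega i cx) (hasD_add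
    (hasD_mul (hasD_dlogmu i cx) (hasD_ev (q p) i x)) (hasD_ev (dv i (q p)) i x))) => //.
  by rewrite /D2; ring.
rewrite /H0 (eq_bigr _ (fun i _ => d2 i)) comb_sum comb_opp.
rewrite [in X in _ + X](eq_bigr (fun i => comb U (fun p y =>
   2 * a / (y 0 i - y 0 (ordS i)) ^+ 2 * (a * (mu a omega y * ev (q p) (y 0))
     - mu a omega y * ev (sw (tperm i (ordS i)) (q p)) (y 0))) x)) => [|i _].
  rewrite comb_sum !comb_scale !comb_add.
  by apply: comb_eq => p; apply: H0_scalar.
rewrite /spin_swap comb_perm /F comb_scale comb_opp comb_add comb_scale.
by apply: comb_eq => p; rewrite tpermV /q !permM !eG.
Qed.

End Conjugation.

(** * Eigenfunctions *)

Section Homogenization.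
Variable R : realType.
Implicit Types (c p : {poly R}) (u w : R) (d k n : nat).

(** The homogenization u^d c(w / u^2) as a number, shared by [hom] and [xbar_times]. *)
Definition hval d c u w : R := \sum_(k < size c) c`_k * w ^+ k * u ^+ (d - 2 * k).

Lemma hvalE d c n u w : (size c <= n)%N ->
  hval d c u w = \sum_(k < n) c`_k * w ^+ k * u ^+ (d - 2 * k).
Proof.
move=> cn; rewrite /hval -(big_mkord xpredT (fun k => c`_k * w ^+ k * u ^+ (d - 2 * k))).
rewrite -(big_mkord xpredT (fun k => c`_k * w ^+ k * u ^+ (d - 2 * k))).
rewrite [RHS](big_cat_nat _ cn) //= [X in _ = _ + X]big1_seq ?addr0 // => k.
by rewrite mem_index_iota => /andP[_ /andP[h _]]; rewrite nth_default // !mul0r.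
Qed.
Lemma hvalD d c p u w : hval d (c + p) u w = hval d c u w + hval d p u w.
Proof.
pose n := maxn (size c) (size p).
rewrite (@hvalE d (c + p) n) ?size_polyD // (@hvalE d c n) ?leq_maxl //.
rewrite (@hvalE d p n) ?leq_maxr // -big_split /=.
by apply: eq_bigr => k _; rewrite coefD; ring.
Qed.
Lemma hvalZ d b c u w : hval d (b *: c) u w = b * hval d c u w.
Proof.
rewrite (@hvalE d (b *: c) (size c)) ?size_scale_leq // mulr_sumr.
by apply: eq_bigr => k _; rewrite coefZ; ring.
Qed.
Lemma hval0 d u w : hval d 0 u w = 0.
Proof. by rewrite /hval size_poly0 big_ord0. Qed.
Lemma hvalN d c u w : hval d (- c) u w = - hval d c u w.
Proof. by rewrite -scaleN1r hvalZ mulN1r. Qed.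
Lemma hvalB d c p u w : hval d (c - p) u w = hval d c u w - hval d p u w.
Proof. by rewrite hvalD hvalN. Qed.
Lemma hval_sum (I : Type) (r : seq I) (Q : pred I) (F : I -> {poly R}) d u w :
  hval d (\sum_(i <- r | Q i) F i) u w = \sum_(i <- r | Q i) hval d (F i) u w.
Proof. by elim/big_rec2: _ => [|i y z _ <-]; rewrite ?hval0 ?hvalD. Qed.
Lemma hvalXn d k u w : hval d 'X^k u w = w ^+ k * u ^+ (d - 2 * k).
Proof.
rewrite (@hvalE d _ k.+1) ?size_polyXn // big_ord_recr /= coefXn eqxx mul1r.
by rewrite big1 ?add0r // => i _; rewrite coefXn ltn_eqF // !mul0r.
Qed.
Lemma hvalX d c u w : hval d.+2 ('X * c) u w = w * hval d c u w.
Proof.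
rewrite (@hvalE _ _ (size c).+1); last first.
  by rewrite (leq_trans (size_polyMleq _ _)) // size_polyX.
rewrite big_ord_recl coefXM /= !mul0r add0r mulr_sumr; apply: eq_bigr => k _.
rewrite coefXM /= /bump /= add1n exprS mulnS.
by have -> : (d.+2 - (2 + 2 * k) = d - 2 * k)%N by []; ring.
Qed.

(** An affine substitution in the ratio w / u^2 homogenizes to w := b u^2 + e w. It relates the
    three expansions in use, in t, in t - 1 and in t + 1. *)
Lemma hval_comp d p (b e u w : R) : (size p <= d./2.+1)%N ->
  hval d (p \Po (b%:P + e *: 'X)) u w = hval d p u (b * u ^+ 2 + e * w).
Proof.
move=> pd; rewrite comp_polyE hval_sum [RHS]/hval; apply: eq_bigr => k _.
have kd : (2 * k <= d)%N by have := leq_trans (ltn_ord k) pd; lia.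
rewrite hvalZ -mulrA; congr (_ * _).
rewrite !exprDn hval_sum mulr_suml; apply: eq_bigr => j _.
have jk : (j <= k)%N by rewrite -ltnS.
rewrite -scaler_nat -polyC_exp exprZn -scalerAr mul_polyC !hvalZ hvalXn.
have -> : (d - 2 * j = 2 * (k - j) + (d - 2 * k))%N by lia.
by rewrite -mulr_natl !exprMn [(2 * (k - j))%N]mul2n -addnn !exprD; ring.
Qed.

Lemma lin_sub (c : R) (f g r : {poly R}) :
  (f - c *: g) \Po r = (f \Po r) - c *: (g \Po r).
Proof. by rewrite comp_polyB comp_polyZ. Qed.
Lemma lin_add (c : R) (f g r : {poly R}) :
  (f + c *: g) \Po r = (f \Po r) + c *: (g \Po r).
Proof. by rewrite comp_polyD comp_polyZ. Qed.
Lemma hvalXB d c u w : (2 <= d)%N ->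
  hval d ('X * c) u w = w * hval (d - 2) c u w.
Proof. by move=> d2; rewrite -{1}(subnK d2) addn2 hvalX. Qed.
Lemma hval_lower d e c u w : (e <= d)%N ->
  (size c <= (d - e)./2.+1)%N -> hval d c u w = u ^+ e * hval (d - e) c u w.
Proof.
move=> ed sc; rewrite /hval mulr_sumr; apply: eq_bigr => k _.
have kd : (2 * k <= d - e)%N by have := leq_trans (ltn_ord k) sc; lia.
have -> : (d - 2 * k = e + (d - e - 2 * k))%N by lia.
by rewrite exprD; ring.
Qed.

Section Sizes.
Variables (n : nat).
Lemma size_polyD_leq (f g : {poly R}) : (size f <= n)%N -> (size g <= n)%N ->
  (size (f + g)%R <= n)%N.
Proof.
by move=> hp hq; rewrite (leq_trans (size_polyD _ _)) // geq_max hp hq.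
Qed.
Lemma size_polyN_leq (f : {poly R}) : (size f <= n)%N -> (size (- f)%R <= n)%N.
Proof. by rewrite size_polyN. Qed.
Lemma size_polyZ_leq (c : R) (f : {poly R}) : (size f <= n)%N -> (size (c *: f)%R <= n)%N.
Proof. exact: leq_trans (size_scale_leq _ _). Qed.
End Sizes.

Lemma size_jacobi (g d : R) n : (size (jacobi g d n) <= n.+1)%N.
Proof.
apply: size_polyZ_leq; apply: (leq_trans (size_sum _ _ _)).
apply/bigmax_leqP => k _; apply: size_polyZ_leq.
rewrite (leq_trans (size_poly_exp_leq _ _)) //.
by rewrite -opprB size_polyN size_XsubC mul1n.
Qed.

End Homogenization.

Section Eigenfunctions.
Variables (R : realType) (N : nat) (hN : (2 < N)%N) (twoM : nat).
Variables (a omega : R) (ha : 2^-1 < a).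
Local Notation V := 'rV[R]_N.
Local Notation Sg := (Sigma R N twoM).
Local Notation wf := (wavefun R N twoM).
Local Notation poly := (PowerSums.poly_in R N).
Local Notation "1+2X" := (1 + 2 *: 'X).
Implicit Types (i j k : 'I_N) (x y : V) (p : 'S_N) (s : Sg).
Implicit Types (G : 'I_N -> 'I_N -> poly).

Lemma xbarE x : xbar x = ev (xb R N) (x 0).
Proof. by rewrite /xb evZ ev_sum; under [in RHS]eq_bigr do rewrite evV. Qed.
Lemma rsqE x : rsq x = ev (s2 R N) (x 0).
Proof. by rewrite /s2 ev_sum; under [in RHS]eq_bigr do rewrite evX evV. Qed.
Lemma cubesE x : cubes x = ev (s3 R N) (x 0).
Proof. by rewrite /s3 ev_sum; under [in RHS]eq_bigr do rewrite evX evV. Qed.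

Definition vbar x : R := ev (vv R N) (x 0).
Lemma vbarE x : vbar x = rsq x / N%:R - xbar x ^+ 2.
Proof. by rewrite /vbar /vv evB evZ evX -rsqE -xbarE mulrC. Qed.

Lemma ev_hom d c x : ev (hom N d c) (x 0) = hval d c (xbar x) (vbar x).
Proof.
rewrite ev_sum; apply: eq_bigr => k _.
by rewrite evZ evM !evX -xbarE -/(vbar x); ring.
Qed.

Lemma xbar_times_hval d (c : {poly R}) x : (size c <= d./2.+1)%N ->
  xbar_times d c x = hval d (c \Po 1+2X) (xbar x) (vbar x).
Proof.
move=> cd; rewrite -[1]polyC1 hval_comp // vbarE.
by apply: eq_bigr => k _; congr (_ * _ ^+ _ * _); ring.
Qed.

(* Lam G is the Lambda-projection of Q|s> for Q = G first second; being
   annihilated by T0 on the symmetric states makes it an eigenvector once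
   multiplied by the Laguerre factor. *)
Definition zero_mode s m G : Prop :=
  [/\ equivariant G,
      forall j k x, j != k -> eul (x 0) (G j k) = m%:R * ev (G j k) (x 0)
    & forall x, config x -> comb (spin_term s) (fun p y =>
        T0 a (y 0) (G (p (first hN)) (p (second hN)))) x = 0].

Lemma zero_modeD s m G G' : zero_mode s m G -> zero_mode s m G' ->
  zero_mode s m (fun j k => G j k + G' j k).
Proof.
move=> [e1 d1 t1] [e2 d2 t2]; split.
- by move=> q j k; rewrite swD e1 e2.
- by move=> j k x jk; rewrite eulD d1 // d2 // evD mulrDr.
- move=> x cx; rewrite -[RHS]addr0 -{1}(t1 x cx) -(t2 x cx) comb_add.
  by apply: comb_eq => p; rewrite T0D //; exact: config_next.
Qed.
Lemma zero_modeZ s m c G : zero_mode s m G -> zero_mode s m (fun j k => c *: G j k).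
Proof.
move=> [e1 d1 t1]; split.
- by move=> q j k; rewrite swZ e1.
- by move=> j k x jk; rewrite eulZ d1 // evZ; ring.
- move=> x cx; rewrite -[RHS](scaler0 _ c%:C) -(t1 x cx) comb_scale.
  by apply: comb_eq => p; rewrite T0Z //; exact: config_next.
Qed.

(* gam xb q is, up to the factor N, the derivative of q along the diagonal. *)
Definition rel_zero_mode s d (q : 'I_N -> 'I_N -> poly) : Prop :=
  zero_mode s d q /\ forall j k x, gam (x 0) (xb R N) (q j k) = 0.

Lemma perm_first_second p : p (first hN) != p (second hN).
Proof. by rewrite (inj_eq perm_inj). Qed.

(** [T0_hom] leaves the product of [hom] with T0 q. The first factor is common to all permutations
    and comes out of the spin sum, so T0 q need only vanish after summation. *)
Lemma zero_mode_hom s e d q : rel_zero_mode s d q ->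
  zero_mode s (e + d)
    (fun j k => hom N e (J N a (e + d) d%:R 0 e./2) * q j k).
Proof.
move=> [[eq dq tq] gq]; split.
- by move=> r j k; rewrite swM symm_hom eq.
- move=> j k x jk; rewrite eulM eul_hom ?size_jw // dq // evM natrD.
  by ring.
- move=> x cx.
  rewrite -[RHS](scaler0 _ (ev (hom N e (J N a (e + d) d%:R 0 e./2)) (x 0))%:C).
  rewrite -(tq x cx) comb_scale; apply: comb_eq => p.
  apply: (T0_hom hN (config_next hN cx)); rewrite ?size_jw //.
  + move=> k ke; apply: jw_rec => //; first exact: (alpha_gt0 hN ha).
    by rewrite addr0 alpha_beta.
  + by apply: dq; exact: perm_first_second.
Qed.

Lemma eigen_Lam s m l G : zero_mode s m G ->
  eigenfunction a omega (fun x => (radial a omega l m x)%:C *: Lam hN s G x)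
    (E N a omega l m).
Proof.
move=> [eG dG tG].
pose Q := rad N omega (laguerre (- beta N a m) l).
have QE x : (laguerre (- beta N a m) l).[omega * rsq x] = ev Q (x 0).
  rewrite horner_coef ev_sum; apply: eq_bigr => k _.
  by rewrite evZ evX -rsqE exprMn mulrA.
pose F j k := Q * G j k.
have FE : (fun x => (radial a omega l m x)%:C *: Lam hN s G x)
    = (fun x => (mu a omega x)%:C *: Lam hN s F x).
  apply/funext => x; rewrite /radial rmorphM -scalerA; congr (_ *: _).
  by rewrite /Lam comb_scale; apply: comb_eq => p; rewrite evM QE.
have eF : equivariant F by move=> q j k; rewrite swM symm_rad eG.
rewrite FE; split; first exact: smooth_Lam.
move=> x cx; rewrite H0_Lam // scalerA [(E N a omega l m)%:C * _]mulrC -scalerA.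
congr (_ *: _); rewrite -[RHS]subr0 -[X in _ = _ - X](scaler0 _ (ev Q (x 0))%:C).
rewrite -(tG x cx) /Lam !comb_scale comb_opp comb_add; apply: comb_eq => p.
set j := p _; set k := p _; have jk : j != k by exact: perm_first_second.
have H := @T0_rad R N a (x 0) (config_next hN cx) omega _ m l (G j k)
  (size_laguerre (- beta N a m) l); rewrite -addrA -/(F j k) H -/Q.
- by rewrite /E /F !evM; ring.
(* The two recurrences agree because 1 - beta(m) = m + N (a + 1/2). *)
- move=> n nl; rewrite -laguerre_rec //; congr (_ * _ * _).
  by rewrite /beta; ring.
- exact: dG.
Qed.
End Eigenfunctions.

(** * The translation-invariant harmonic states and the condition Sigma' *)

Section Families.
Variables (R : realType) (N : nat) (hN : (2 < N)%N) (twoM : nat).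
Variables (a omega : R) (ha : 2^-1 < a).
Local Notation V := 'rV[R]_N.
Local Notation Sg := (Sigma R N twoM).
Local Notation wf := (wavefun R N twoM).
Local Notation poly := (PowerSums.poly_in R N).
Local Notation zero_mode := (@zero_mode R N hN twoM a).
Local Notation rel_zero_mode := (@rel_zero_mode R N hN twoM a).
Local Notation "p .[1]" := (p (first hN)) (at level 2, format "p .[1]").
Local Notation "p .[2]" := (p (second hN)) (at level 2, format "p .[2]").
Local Notation "1+2X" := (1 + 2 *: 'X).
Implicit Types (i j k : 'I_N) (x y : V) (p : 'S_N) (s : Sg).
Implicit Types (G : 'I_N -> 'I_N -> poly).

Lemma rel_zero_mode_pointwise s d G :
    equivariant G ->
    (forall j k x, eul (x 0) (G j k) = d%:R * ev (G j k) (x 0)) ->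
    (forall j k x, gam (x 0) (xb R N) (G j k) = 0) ->
    (forall j k x, j != k -> config x -> T0 a (x 0) (G j k) = 0) ->
  rel_zero_mode s d G.
Proof.
move=> eG dG gG tG; split => //; split => // x cx.
rewrite /comb big1 // => p _; rewrite tG ?scale0r //.
exact: perm_first_second.
Qed.

Lemma rel_zero_mode1 s : rel_zero_mode s 0 (fun _ _ => 1).
Proof.
apply: rel_zero_mode_pointwise => [q j k|j k x|j k x|j k x _ cx].
- exact: sw1.
- by rewrite eul1 mul0r.
- by rewrite gam_xb big1 ?mulr0 // => i _; rewrite dv1 ev0.
- by have := T0_exp a (config_next hN cx) 0 (@symm1 R N); rewrite expr0 !mul0r addr0.
Qed.
Lemma rel_zero_mode_yy s : rel_zero_mode s 1 (fun j _ => yy R j).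
Proof.
apply: rel_zero_mode_pointwise => [q j k|j k x|j k x|j k x _ cx].
- exact: sw_yy.
- by rewrite eul_yy mul1r.
- exact: (gam_xb_yy hN).
- exact: (T0_yy hN a (config_next hN cx)).
Qed.
Lemma rel_zero_mode_yyB s : rel_zero_mode s 1 (fun j k => yy R j - yy R k).
Proof.
apply: rel_zero_mode_pointwise => [q j k|j k x|j k x|j k x _ cx].
- by rewrite swB !sw_yy.
- by rewrite eulB !eul_yy mul1r evB.
- by rewrite gamB !(gam_xb_yy hN) subrr.
- have hx := config_next hN cx.
  by rewrite T0B // !(T0_yy hN a hx) subrr.
Qed.
Lemma rel_zero_mode_q2 s : rel_zero_mode s 2 (fun j _ => q2 R j).
Proof.
apply: rel_zero_mode_pointwise => [q j k|j k x|j k x|j k x _ cx].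
- exact: sw_q2.
- exact: eul_q2.
- exact: (gam_xb_q2 hN).
- exact: (T0_q2 hN a (config_next hN cx)).
Qed.
Lemma rel_zero_mode_c3 s : rel_zero_mode s 3 (fun _ _ => c3 R N).
Proof.
apply: rel_zero_mode_pointwise => [q j k|j k x|j k x|j k x _ cx].
- exact: symm_c3.
- exact: eul_c3.
- exact: (gam_xb_c3 hN).
- exact: (T0_c3 hN a (config_next hN cx)).
Qed.
Lemma rel_zero_mode_q3h s : rel_zero_mode s 3 (@q3h R N).
Proof.
apply: rel_zero_mode_pointwise => [q j k|j k x|j k x|j k x jk cx].
- exact: sw_q3h.
- exact: eul_q3h.
- exact: (gam_xb_q3h hN).
- exact: (T0_q3h hN a (config_next hN cx)).
Qed.
Lemma rel_zero_mode_q4 s : rel_zero_mode s 4 (fun j _ => q4 a j).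
Proof.
apply: rel_zero_mode_pointwise => [q j k|j k x|j k x|j k x jk cx].
- exact: sw_q4.
- exact: eul_q4.
- exact: (gam_xb_q4 hN).
- apply: (T0_q4 hN (config_next hN cx)).
  by rewrite gt_eqF // addr_gt0 //; exact: (alpha_gt0 hN ha).
Qed.

Let tau : 'S_N := tperm (first hN) (second hN).

Lemma spin_term_swap s p : spin_term s (tau * p)%g = spin_term (spin_swap (first hN) (second hN) s) p.
Proof. by rewrite /spin_term /spin_swap spin_permM. Qed.

Lemma comb_swap s (h : 'S_N -> V -> R) x :
  comb (spin_term (spin_swap (first hN) (second hN) s)) h x
    = comb (spin_term s) (fun p => h (tau * p)%g) x.
Proof.
rewrite /comb [RHS](reindex_inj (mulgI tau)) /=; apply: eq_bigr => p _.
by rewrite -spin_term_swap mulgA tperm2 mul1g.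
Qed.
Lemma comb_spinN s (h : 'S_N -> V -> R) x :
  comb (spin_term (- s)) h x = - comb (spin_term s) h x.
Proof.
rewrite /comb -sumrN; apply: eq_bigr => p _.
by rewrite /spin_term spin_permN scalerN scalerN.
Qed.

Lemma tau1 p : (tau * p)%g (first hN) = p (second hN).
Proof. by rewrite permM tpermL. Qed.
Lemma tau2 p : (tau * p)%g (second hN) = p (first hN).
Proof. by rewrite permM tpermR. Qed.

(* A fixed transposition of the first index counts the permutations with
   p second = p first + 1: averaging over the possible second indices. *)
Lemma count_adjacent :
  (N%:R - 1) * (\sum_(p : 'S_N) (p (second hN) == ordS (p (first hN)))%:R) = N`!%:R :> R.
Proof.
pose c l := \sum_(p : 'S_N) (p l == ordS (p (first hN)))%:R : R.
have ccst l : l != first hN -> c l = c (second hN).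
  move=> l1; rewrite /c (reindex_inj (mulgI (tperm (second hN) l))) /=.
  apply: eq_bigr => p _; rewrite !permM tpermR tpermD //.
have -> : (N%:R - 1) * c (second hN) = \sum_(l | l != first hN) c l.
  rewrite (eq_bigr _ ccst) sumr_const -[RHS]mulr_natl; congr (_ * _).
  rewrite cardC1 card_ord -subn1 natrB // (leq_trans _ hN) //.
rewrite /c exchange_big /=.
rewrite (eq_bigr (fun=> 1)) => [|p _].
  by rewrite sumr_const card_Sn.
rewrite (bigD1 ((p^-1)%g (ordS (p (first hN))))) /=.
  rewrite permKV eqxx big1 ?addr0 // => l /andP[_ l1].
  by rewrite -(inj_eq (@perm_inj _ (p^-1)%g)) permK (negPf l1).
by rewrite -(inj_eq (@perm_inj _ p)) permKV ordS_neq.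
Qed.

Lemma Lambda_comb (f : V -> R) s x : Lambda (fun y => (f y)%:C *: s) x
  = comb (spin_term s) (fun p y => f (col_perm p y)) x.
Proof.
rewrite /Lambda /comb scaler_sumr; apply: eq_bigr => p _.
by rewrite /spin_term spin_permZ !scalerA mulrC.
Qed.

Let adj (p : 'S_N) (y : V) : R := (p.[2] == ordS p.[1])%:R.

Lemma sum_del_del j k : j != k ->
  \sum_i del R i j * del R i k = - ((k == ordS j)%:R + (j == ordS k)%:R).
Proof.
move=> jk.
rewrite (eq_bigr (fun i => - ((i == j)%:R * (k == ordS j)%:R
    + (i == k)%:R * (j == ordS k)%:R))) => [|i _]; last first.
  rewrite /del; case: (i =P j) => [->|_].
    rewrite (negPf jk) [ordS j == k]eq_sym [ordS j == j](negPf (ordS_neq hN j)) /=.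
    by ring.
  case: (i =P k) => [->|_].
    rewrite [ordS k == j]eq_sym [ordS k == k](negPf (ordS_neq hN k)) /=.
    by ring.
  case: (ordS i =P j) => [->|_]; last by rewrite /=; ring.
  by rewrite (negPf jk) /=; ring.
by rewrite sumrN big_split /= -!mulr_suml !sum_delta !mul1r.
Qed.

(** The sum over i collects the permutations that send the first two sites to consecutive ones, and
    (1 + S_12) s = 2 s. This ties Sigma' to the adjacencies in [T0_q2t]. The point 0 is arbitrary,
    as [adj] ignores it. *)
Lemma sum_splus s : spin_swap (first hN) (second hN) s = s ->
  \sum_i splus hN s i (ordS i) = 2 *: comb (spin_term s) adj 0.
Proof.
move=> ss; rewrite /splus ss -scaler_sumr (exchange_big_dep predT) //=.
rewrite /comb !scaler_sumr; apply: eq_bigr => p _.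
rewrite (eq_bigl (fun i => (i == p.[1]) && (p.[2] == ordS p.[1]))); last first.
  by move=> i; rewrite [i == _]eq_sym; case: (p.[1] =P i) => [<-|].
rewrite /adj; case: (p.[2] == ordS p.[1]); last first.
  rewrite big1 => [|i]; last by rewrite andbF.
  by rewrite scaler0 rmorph0 scale0r scaler0.
rewrite (eq_bigl (fun i => i == p.[1])) => [|i]; last by rewrite andbT.
rewrite big_pred1_eq spin_permD rmorph1 scale1r scalerDr /spin_term.
by rewrite scaler_nat mulr2n.
Qed.

Lemma comb_invariant u (q : 'S_N) x :
  spin_perm q (comb (spin_term u) (fun _ _ => 1) x)
    = comb (spin_term u) (fun _ _ => 1) x :> Sg.
Proof. by rewrite comb_perm. Qed.

(** By Sigma' the left side is half of a totally symmetric spin vector, hence equal to its average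
    over all spin permutations; averaging replaces the adjacency indicator by its mean, which
    [count_adjacent] evaluates to 1 / (N - 1). *)
Lemma comb_adj s x : spin_swap (first hN) (second hN) s = s -> Sigma' hN s ->
  comb (spin_term s) adj x
    = ((N%:R - 1)^-1)%:C *: comb (spin_term s) (fun _ _ => 1) x.
Proof.
move=> ss [u hu].
have inv q : spin_perm q (comb (spin_term s) adj x) = comb (spin_term s) adj x.
  have E : comb (spin_term s) adj x = 2^-1 *: comb (spin_term u) (fun _ _ => 1) x.
    have -> : comb (spin_term u) (fun _ _ => 1) x = Lambda (fun=> u) x.
      rewrite /Lambda /comb scaler_sumr; apply: eq_bigr => p _.
      by rewrite rmorph1 scale1r.
    rewrite -hu (sum_splus ss) scalerA mulVf ?scale1r // pnatr_eq0 //.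
  by rewrite E spin_permZ comb_invariant.
have N1 : N%:R - 1 != 0 :> R.
  by rewrite subr_eq0 pnatr_eq1 gtn_eqF // (ltn_trans _ hN).
have f0 : N`!%:R != 0 :> R by exact: fact_neq0.
have fC : N`!%:R != 0 :> R[i] by rewrite pnatr_eq0 -lt0n fact_gt0.
have -> : comb (spin_term s) adj x
    = (N`!%:R)^-1 *: \sum_(q : 'S_N) spin_perm q (comb (spin_term s) adj x).
  rewrite (eq_bigr _ (fun q _ => inv q)) sumr_const card_Sn -[comb _ _ _ *+ _]scaler_nat scalerA.
  by rewrite mulVf // scale1r.
under eq_bigr do rewrite /comb spin_perm_sum.
rewrite exchange_big /=.
rewrite (eq_bigr (fun p => (adj p x)%:C *: comb (spin_term s) (fun _ _ => 1) x)) => [|p _].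
  rewrite -scaler_suml scalerA; congr (_ *: _).
  have C0 := count_adjacent.
  rewrite -rmorph_sum -[_^-1](_ : ((N`!%:R)^-1)%:C = _); last by rewrite fmorphV rmorph_nat.
  rewrite -rmorphM; congr (_%:C); rewrite -C0.
  have : \sum_(p : 'S_N) (p.[2] == ordS p.[1])%:R != 0 :> R.
    by apply: contraTneq f0 => e; rewrite -C0 e mulr0 eqxx.
  by move=> h; rewrite /adj; field; rewrite N1 h.
rewrite /comb scaler_sumr (reindex_inj (mulgI p^-1%g)) /=; apply: eq_bigr => q _.
by rewrite spin_permZ /spin_term spin_permZ spin_permM mulKVg rmorph1 scale1r.
Qed.

Lemma rel_zero_mode_q2t s : spin_swap (first hN) (second hN) s = s ->
  Sigma' hN s -> rel_zero_mode s 2 (@q2t R N).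
Proof.
move=> ss hs; split; last by move=> j k x; exact: (gam_xb_q2t hN).
split; [exact: sw_q2t|by move=> j k x _; exact: eul_q2t|move=> x cx].
have N1 : N%:R - 1 != 0 :> R.
  by rewrite subr_eq0 pnatr_eq1 gtn_eqF // (ltn_trans _ hN).
(* The two orders of adjacency are exchanged by S_12, which fixes s, so both contribute the same
   average; together they cancel the last term. *)
transitivity ((- (2 * a))%:C *: comb (spin_term s) adj x
  + ((- (2 * a))%:C *: comb (spin_term s) (fun p => adj (tau * p)%g) x
  + (4 * a / (N%:R - 1))%:C *: comb (spin_term s) (fun _ _ => 1) x)).
  rewrite !comb_scale !comb_add; apply: comb_eq => p.
  rewrite (T0_q2t hN a (config_next hN cx)) ?perm_first_second // /adj tau1 tau2.
  rewrite sum_del_del ?perm_first_second //.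
  by field.
rewrite -comb_swap ss comb_adj // !comb_scale !comb_add.
transitivity (comb (spin_term s) (fun _ _ => 0) x).
  by apply: comb_eq => p; field.
by rewrite /comb big1 // => p _; rewrite rmorph0 scale0r.
Qed.

End Families.

(** * The seven families as combinations of harmonic states *)

Section PsiFamilies.
Variables (R : realType) (N : nat) (hN : (2 < N)%N) (twoM : nat).
Variables (a omega : R) (ha : 2^-1 < a).
Local Notation V := 'rV[R]_N.
Local Notation Sg := (Sigma R N twoM).
Local Notation wf := (wavefun R N twoM).
Local Notation poly := (PowerSums.poly_in R N).
Local Notation zero_mode := (@zero_mode R N hN twoM a).
Local Notation rel_zero_mode := (@rel_zero_mode R N hN twoM a).
Local Notation "p .[1]" := (p (first hN)) (at level 2, format "p .[1]").
Local Notation "p .[2]" := (p (second hN)) (at level 2, format "p .[2]").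
Local Notation al := (alpha N a).
Local Notation J := (J N a).
Implicit Types (i j k : 'I_N) (x y : V) (p : 'S_N) (s : Sg) (m l : nat).
Implicit Types (G : 'I_N -> 'I_N -> poly).

Lemma zero_mode_homB s m d q : (d <= m)%N -> rel_zero_mode s d q ->
  zero_mode s m (fun j k => hom N (m - d) (J m d%:R 0 (m - d)./2) * q j k).
Proof. by move=> dm /(zero_mode_hom ha (m - d)); rewrite subnK. Qed.

Lemma size_P m (b c : R) n d : (n <= d)%N -> (size (P N a m b c n) <= d.+1)%N.
Proof. by move=> nd; rewrite (leq_trans (size_jacobi _ _ _)). Qed.

Ltac size_le := repeat lazymatch goal with
  | |- is_true (leq (size (polyseq (GRing.add _ _))) _) => apply: size_polyD_leq
  | |- is_true (leq (size (polyseq (GRing.opp _))) _) => apply: size_polyN_leq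
  | |- is_true (leq (size (polyseq (GRing.scale _ _))) _) => apply: size_polyZ_leq
  | |- is_true (leq (size (polyseq (P _ _ _ _ _ _))) _) => apply: size_P; lia
  end.

Lemma size_varphi m : (3 <= m)%N -> (size (varphi N a m) <= m./2.+1)%N.
Proof.
move=> m3; rewrite /varphi; case: ifP => om; rewrite /varphi_odd /varphi_even; size_le.
Qed.
Lemma size_phi m : (4 <= m)%N -> (size (phi N a m) <= (m - 1)./2.+1)%N.
Proof.
move=> m3; rewrite /phi; case: ifP => om; rewrite /phi_odd /phi_even; size_le.
Qed.
Lemma size_chi m : (4 <= m)%N -> (size (chi N a m) <= m./2.+1)%N.
Proof.
move=> m3; rewrite /chi; case: ifP => om; rewrite /chi_odd /chi_even; size_le.
Qed.

Lemma size_J m (b c : R) n d : (n <= d)%N -> (size (J m b c n) <= d.+1)%N.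
Proof. by move=> nd; rewrite (leq_trans (size_jw _ _ _)). Qed.

Lemma PhiE n s x : Phi hN n s x
  = comb (spin_term s) (fun p y => y 0 p.[1] ^+ n) x.
Proof. by rewrite /Phi Lambda_comb; apply: comb_eq => p; rewrite mxE. Qed.
Lemma Phi2tE s x : Phi2t hN s x
  = comb (spin_term s) (fun p y => y 0 p.[1] * y 0 p.[2]) x.
Proof. by rewrite /Phi2t Lambda_comb; apply: comb_eq => p; rewrite !mxE. Qed.
Lemma Phi3hE s x : Phi3h hN s x = comb (spin_term s)
  (fun p y => y 0 p.[1] * y 0 p.[2] * (y 0 p.[1] - y 0 p.[2])) x.
Proof. by rewrite /Phi3h Lambda_comb; apply: comb_eq => p; rewrite !mxE. Qed.

Lemma ev_yy j x : ev (yy R j) (x 0) = x 0 j - xbar x.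
Proof. by rewrite /yy evB evV xbarE. Qed.
Lemma ev_q2 j x : ev (q2 R j) (x 0) = (x 0 j - xbar x) ^+ 2 - vbar x.
Proof. by rewrite /q2 evB evX ev_yy. Qed.
Lemma ev_q2t j k x : ev (q2t R j k) (x 0)
  = (x 0 j - xbar x) * (x 0 k - xbar x) + (N%:R - 1)^-1 * vbar x.
Proof. by rewrite /q2t evD evM evZ !ev_yy. Qed.
Lemma ev_c3 x : ev (c3 R N) (x 0)
  = cubes x - 3 * N%:R * (xbar x * vbar x) - N%:R * xbar x ^+ 3.
Proof. by rewrite /c3 !evB !evZ evM evX -xbarE cubesE. Qed.
Lemma ev_q3h j k x : ev (q3h R j k) (x 0)
  = (x 0 j - x 0 k) * ((x 0 j - xbar x) * (x 0 k - xbar x) + vbar x).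
Proof. by rewrite /q3h evM evB !ev_yy evD evM !ev_yy -/(vbar x); congr (_ * _); ring. Qed.
Lemma ev_q4 j x : ev (q4 a j) (x 0) = ev (c3 R N) (x 0) * (x 0 j - xbar x)
  - 3 * N%:R / (2 * (al + 3)) * (vbar x * ((x 0 j - xbar x) ^+ 2 - vbar x)).
Proof. by rewrite /q4 evB evZ !evM ev_yy ev_q2. Qed.

Lemma eigen_comb s m l G (F : wf) : zero_mode s m G ->
  (forall x, F x = (radial a omega l m x)%:C *: comb (spin_term s)
      (fun p y => ev (G p.[1] p.[2]) (y 0)) x) ->
  eigenfunction a omega F (E N a omega l m).
Proof.
move=> /(eigen_Lam omega l) h FE.
suff -> : F = fun x => (radial a omega l m x)%:C *: Lam hN s G x by [].
by apply/funext => x; rewrite FE.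
Qed.

Ltac to_comb :=
  rewrite !(PhiE, Phi2tE, Phi3hE) !(comb_scale, comb_opp, comb_add).

Lemma eigen_Psi0 l m s :
  eigenfunction a omega (Psi0 hN a omega l m s) (E N a omega l m).
Proof.
apply: (eigen_comb (zero_mode_homB (leq0n m) (rel_zero_mode1 hN a s))) => x.
rewrite /Psi0; congr (_ *: _); to_comb; apply: comb_eq => p.
rewrite evM ev1 ev_hom xbar_times_hval ?subn0; last by apply: size_P; lia.
by rewrite expr0.
Qed.

Lemma eigen_Psi1 l m s : (1 <= m)%N ->
  eigenfunction a omega (Psi1 hN a omega l m s) (E N a omega l m).
Proof.
move=> m1.
apply: (eigen_comb (zero_mode_homB m1 (rel_zero_mode_yy hN a s))) => x.
rewrite /Psi1; congr (_ *: _); to_comb; apply: comb_eq => p.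
rewrite evM ev_hom ev_yy xbar_times_hval; last by apply: size_P; lia.
by rewrite expr0 expr1 mulr1.
Qed.

Lemma eigen_Psi2 l m s : (2 <= m)%N ->
  eigenfunction a omega (Psi2 hN a omega l m s) (E N a omega l m).
Proof.
move=> m2; have [c Hc] := contig2 hN ha m2.
have h2 := zero_mode_homB m2 (rel_zero_mode_q2 hN a s).
have h0 := zero_mode_homB (leq0n m) (rel_zero_mode1 hN a s).
apply: (eigen_comb (zero_modeD h2 (zero_modeZ c h0))) => x.
rewrite /Psi2; congr (_ *: _); to_comb; apply: comb_eq => p.
rewrite evD evZ !evM ev1 !ev_hom ev_q2 subn0.
have -> : ((m - 2)./2 = m./2 - 1)%N by lia.
rewrite !xbar_times_hval; [|size_le|size_le].
rewrite lin_sub -!/(J _ _ _ _) hvalB hvalZ (@hval_lower R m 2) //; last first.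
  by apply: size_J; lia.
have := congr1 (fun f => hval m f (xbar x) (vbar x)) Hc.
rewrite /= hvalB !hvalZ hvalXB // mulr1 => <-.
by ring.
Qed.

(** On a spin state fixed by S_12 only the part of the coefficient symmetric in the first two sites
    counts. This lets x_1 be read as (x_1 + x_2) / 2, to be compared with the symmetric [q2t]. *)
Lemma comb_sym s (h : 'S_N -> V -> R) x :
    spin_swap (first hN) (second hN) s = s ->
  comb (spin_term s) h x = comb (spin_term s)
    (fun p y => (h p y + h (tperm (first hN) (second hN) * p)%g y) / 2) x.
Proof.
move=> ss.
have E := comb_swap hN s h x; rewrite ss in E.
transitivity ((2^-1)%:C *: (comb (spin_term s) h x + comb (spin_term s) h x)).
  rewrite scalerDr -scalerDl -rmorphD (_ : 2^-1 + 2^-1 = 1) ?rmorph1 ?scale1r //.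
  by field.
rewrite {2}E comb_add comb_scale; apply: comb_eq => p.
by rewrite mulrC.
Qed.
Lemma comb_antisym s (h : 'S_N -> V -> R) x :
    spin_swap (first hN) (second hN) s = - s ->
  comb (spin_term s) h x = comb (spin_term s)
    (fun p y => (h p y - h (tperm (first hN) (second hN) * p)%g y) / 2) x.
Proof.
move=> ss.
have E := comb_swap hN s h x; rewrite ss comb_spinN in E.
transitivity ((2^-1)%:C *: (comb (spin_term s) h x + comb (spin_term s) h x)).
  rewrite scalerDr -scalerDl -rmorphD (_ : 2^-1 + 2^-1 = 1) ?rmorph1 ?scale1r //.
  by field.
rewrite {2}(canRL (@opprK _) E) comb_opp comb_add comb_scale; apply: comb_eq => p.
by rewrite mulrC.
Qed.

Lemma eigen_Psi2t l m s : (2 <= m)%N ->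
    spin_swap (first hN) (second hN) s = s -> Sigma' hN s ->
  eigenfunction a omega (Psi2t hN a omega l m s) (E N a omega l m).
Proof.
move=> m2 ss hs; have [c Hc] := contig2 hN ha m2.
have h2 := zero_mode_homB m2 (rel_zero_mode_q2t a ss hs).
have h0 := zero_mode_homB (leq0n m) (rel_zero_mode1 hN a s).
(* [q2t] contains vv / (N - 1) where [q2] contains -vv, so the remainder is -1 / (N - 1) times the
   one for Psi2. *)
apply: (eigen_comb (zero_modeD h2 (zero_modeZ (- c / (N%:R - 1)) h0))) => x.
rewrite /Psi2t; congr (_ *: _); to_comb; rewrite comb_sym //.
apply: comb_eq => p; rewrite tau1 tau2.
rewrite evD evZ !evM ev1 !ev_hom ev_q2t subn0.
have -> : ((m - 2)./2 = m./2 - 1)%N by lia.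
rewrite !xbar_times_hval; [|size_le|size_le].
rewrite lin_add -!/(J _ _ _ _) hvalD hvalZ (@hval_lower R m 2) //; last first.
  by apply: size_J; lia.
have := congr1 (fun f => hval m f (xbar x) (vbar x)) Hc.
rewrite /= hvalB !hvalZ hvalXB // => E0.
have N1 : N%:R - 1 != 0 :> R.
  by rewrite subr_eq0 pnatr_eq1 gtn_eqF // (ltn_trans _ hN).
set h1 := hval m (J m 1 0 _) _ _ in E0 *.
set k0 := 2 * (al + 1) / _ in E0.
have -> : 2 * (al + 1) / ((2 * (m - 1)./2%:R + 1) * (N%:R - 1)) = k0 / (N%:R - 1).
  by rewrite invfM mulrA.
rewrite mulr1 [- c / _ * _]mulrAC mulNr -E0.
by field.
Qed.

Lemma eigen_Psi3 l m s : (3 <= m)%N ->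
  eigenfunction a omega (Psi3 hN a omega l m s) (E N a omega l m).
Proof.
move=> m3; have [c Hc] := contig3 hN ha m3.
rewrite mulrDl -!scalerAl mul1r in Hc.
have h3 := zero_mode_homB m3 (rel_zero_mode_c3 hN a s).
have h0 := zero_mode_homB (leq0n m) (rel_zero_mode1 hN a s).
apply: (eigen_comb (zero_modeD (zero_modeZ (2 / (3 * N%:R)) h3) (zero_modeZ c h0))) => x.
rewrite /Psi3; congr (_ *: _); to_comb; apply: comb_eq => p.
rewrite evD !evZ !evM ev1 !ev_hom ev_c3 subn0.
rewrite !xbar_times_hval; [|exact: size_varphi|size_le].
rewrite -!/(J _ _ _ _).
have := congr1 (fun f => hval m f (xbar x) (vbar x)) Hc.
have sJ : (size (J m 3 0 (m - 3)./2) <= (m - 3)./2.+1)%N by exact: size_J.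
rewrite /= !hvalD !hvalZ hvalXB ?(ltnW m3) //.
rewrite (@hval_lower R m 3) // (@hval_lower R (m - 2) 1) ?subn_gt0 //; last first.
  by rewrite -subnDA.
rewrite -subnDA => E0; rewrite mulr1 -E0 expr0.
have N0 := @N_neq0 R N hN.
by field.
Qed.

Lemma eigen_Psi3h l m s : (3 <= m)%N ->
    spin_swap (first hN) (second hN) s = - s ->
  eigenfunction a omega (Psi3h hN a omega l m s) (E N a omega l m).
Proof.
move=> m3 ss; have [c Hc] := contig3h hN ha m3.
have m1 : (1 <= m)%N by apply: leq_trans m3.
have h3 := zero_mode_homB m3 (rel_zero_mode_q3h hN a s).
have h1 := zero_mode_homB m1 (rel_zero_mode_yyB hN a s).
apply: (eigen_comb (zero_modeD h3 (zero_modeZ (c / 2) h1))) => x.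
rewrite /Psi3h; congr (_ *: _); to_comb; rewrite comb_antisym //.
apply: comb_eq => p; rewrite tau1 tau2.
rewrite evD evZ evM ev_q3h evM evB !ev_yy !ev_hom.
rewrite !xbar_times_hval; [|size_le|size_le|size_le].
(* The coefficient of Phi0 does not depend on p, so antisymmetrization cancels it, whatever its
   value. *)
set F0 := hval m _ _ _; rewrite lin_add -!/(J _ _ _ _).
have := congr1 (fun f => hval (m - 1) f (xbar x) (vbar x)) Hc.
have sJ : (size (J m 3 0 (m - 3)./2) <= (m - 3)./2.+1)%N by exact: size_J.
have m12 : (2 <= m - 1)%N by lia.
have m13 : (m - 1 - 2 = m - 3)%N by lia.
rewrite /= hvalB !hvalZ hvalXB // hvalD hvalZ.
rewrite [hval (m - 1) (J m 3 0 _) _ _](@hval_lower R _ 2) ?m13 // => E0.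
set k1 := hval (m - 1) (J m 1%:R 0 _) _ _.
rewrite -/k1 in E0; set i0 := (2 * m./2%:R - 1)^-1 in E0 *.
rewrite [c / 2 * _](_ : _ = c * k1 * (x 0 p.[1] - x 0 p.[2]) / 2); last by field.
by rewrite -E0; field.
Qed.

Lemma eigen_Psi4 l m s : (4 <= m)%N ->
  eigenfunction a omega (Psi4 hN a omega l m s) (E N a omega l m).
Proof.
move=> m4; have [c2 H2] := contig4a hN ha m4.
have [c1 H1] := contig4b hN ha m4; have Hz := contig4c hN ha m4.
rewrite [(3 *: 'X + 1) * _]mulrDl -scalerAl mul1r in H1.
have m1 : (1 <= m)%N by apply: leq_trans m4.
have m2 : (2 <= m)%N by apply: leq_trans m4.
have h4 := zero_mode_homB m4 (rel_zero_mode_q4 hN ha s).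
have h2 := zero_mode_homB m2 (rel_zero_mode_q2 hN a s).
have h1 := zero_mode_homB m1 (rel_zero_mode_yy hN a s).
(* The factor -1 / N matches the coefficient of the sum of cubes times Phi1; [c2] and [c1] then come
   from the components along q2 and y. *)
apply: (eigen_comb (zero_modeD (zero_modeZ (- N%:R^-1) h4)
   (zero_modeD (zero_modeZ c2 h2) (zero_modeZ c1 h1)))) => x.
rewrite /Psi4; congr (_ *: _); to_comb; apply: comb_eq => p.
rewrite !evD !evZ !evM !ev_hom ev_q4 ev_q2 ev_yy ev_c3.
have -> : ((m - 4)./2 = m./2 - 2)%N by lia.
have -> : ((m - 2)./2 = m./2 - 1)%N by lia.
rewrite !xbar_times_hval; try size_le; [|exact: size_chi|exact: size_phi].
rewrite -!/(J _ _ _ _) -hvalZ -/(J4 N a m).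
have sD : (size (J4 N a m) <= (m - 2)./2.+1)%N.
  by apply: size_polyZ_leq; apply: size_J; lia.
have sB : (size (J m 4 0 (m./2 - 2)) <= (m - 4)./2.+1)%N by apply: size_J; lia.
have sp : (size (phi N a m \Po (1 + 2 *: 'X)) <= (m - 1)./2.+1)%N.
  have := size_phi m4; apply: leq_trans; rewrite size_comp_poly2 //.
  rewrite addrC size_polyDl ?size_poly1 size_scale ?pnatr_eq0 ?size_polyX //.
set B := J m 4 0 _ in H2 H1 sB *; set D := J4 N a m in H2 H1 Hz sD *.
set ph := phi N a m \Po _ in H1 Hz sp *; set ch := chi N a m \Po _ in Hz *.
clearbody B D ph ch.
have := congr1 (fun f => hval (m - 2) f (xbar x) (vbar x)) H2.
have := congr1 (fun f => hval (m - 1) f (xbar x) (vbar x)) H1.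
have := congr1 (fun f => hval m f (xbar x) (vbar x)) Hz.
have n2 : (2 <= m - 2)%N by lia.
have n1 : (2 <= m - 1)%N by lia.
rewrite /= !(hvalD, hvalN, hvalZ, hval0) !hvalXB //.
have -> : (m - 2 - 2 = m - 4)%N by lia.
have -> : (m - 1 - 2 = m - 3)%N by lia.
have low d e d' (f : {poly R}) : d = (e + d')%N -> (size f <= d'./2.+1)%N ->
    hval d f (xbar x) (vbar x) = xbar x ^+ e * hval d' f (xbar x) (vbar x).
  by move=> de sf; rewrite (@hval_lower R d e) de ?leq_addr ?addKn.
rewrite (low m 2%N (m - 2)%N D) //; last by lia.
rewrite (low (m - 1)%N 1%N (m - 2)%N D) //; last by lia.
rewrite (low m 1%N (m - 1)%N ph) //; last by lia.
rewrite (low (m - 1)%N 3%N (m - 4)%N B) //; last by lia.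
rewrite (low (m - 3)%N 1%N (m - 4)%N B) //; last by lia.
rewrite !expr1 expr0.
move: (hval _ ch _ _) (hval _ ph _ _) (hval _ D _ _) (hval _ B _ _) => c p' d b.
move=> Ez E1 E2.
rewrite [c2 * _]mulrA -E2 [c1 * _]mulrA -E1.
have N0 := @N_neq0 R N hN; have al3 : al + 3 != 0.
  by rewrite gt_eqF // addr_gt0 //; exact: (alpha_gt0 hN ha).
have -> : 3 / 2 * c = - (xbar x ^+ 2 * d) - vbar x * d - 3 / 2 * (xbar x * p').
  by apply/eqP; rewrite -subr_eq0 -[X in _ == X]Ez; apply/eqP; field.
by field; rewrite N0 al3.
Qed.

End PsiFamilies.

(** * Completeness *)

Section Span.
Variables (R : realType) (N : nat) (hN : (2 < N)%N) (twoM : nat).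
Variable a : R.
Local Notation V := 'rV[R]_N.
Local Notation Sg := (Sigma R N twoM).
Local Notation wf := (wavefun R N twoM).
Implicit Types (x y : V) (s : Sg) (m l n d b : nat) (F G B Q : wf).
Implicit Types (S : wf -> Prop) (p q : {poly R}).

(** Only values on the configuration space count: [sub_ext] identifies functions that agree there,
    in accordance with [lin_span]. *)
Record is_subspace S : Prop := Subspace {
  sub0 : S (fun=> 0);
  sub_add F G : S F -> S G -> S (fun x => F x + G x);
  sub_scale (c : R[i]) F : S F -> S (fun x => c *: F x);
  sub_ext F G : (forall x, config x -> F x = G x) -> S F -> S G }.

Lemma sub_opp S F : is_subspace S -> S F -> S (fun x => - F x).
Proof.
move=> hS SF; apply: (sub_ext hS) (sub_scale hS (-1) SF) => x _.
by rewrite scaleN1r.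
Qed.
Lemma sub_sum S (I : eqType) (r : seq I) (F : I -> wf) : is_subspace S ->
  {in r, forall i, S (F i)} -> S (fun x => \sum_(i <- r) F i x).
Proof.
move=> hS; elim: r => [|i r IH] SF.
  by apply: (sub_ext hS) (sub0 hS) => x _; rewrite big_nil.
apply: (sub_ext hS) (sub_add hS (SF i (mem_head i r)) (IH _)) => [x _|j jr].
  by rewrite big_cons.
by apply: SF; rewrite inE jr orbT.
Qed.

Lemma lin_span_gen (H : wf -> Prop) F : H F -> lin_span H F.
Proof.
move=> HF; exists 1%N, (fun=> 1), (fun=> F); split=> // x _.
by rewrite big_ord1 scale1r.
Qed.
Lemma lin_span_subspace (H : wf -> Prop) : is_subspace (lin_span H).
Proof.
split.
- exists 0%N, (fun=> 0), (fun=> fun=> 0); split=> [[]//|x _].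
  by rewrite big_ord0.
- move=> F G [k [c [g [Hg Fg]]]] [k' [c' [g' [Hg' Gg]]]].
  exists (k + k')%N, (fun i : 'I_(k + k') => match fintype.split i with inl j => c j | inr j => c' j end),
    (fun i : 'I_(k + k') => match fintype.split i with inl j => g j | inr j => g' j end).
  split=> [i|x cx]; first by case: (fintype.split i).
  rewrite big_split_ord /= Fg // Gg //; congr (_ + _); apply: eq_bigr => i _.
    by rewrite (unsplitK (inl i)).
  by rewrite (unsplitK (inr i)).
- move=> d F [k [c [g [Hg Fg]]]]; exists k, (fun i => d * c i), g; split=> // x cx.
  by rewrite Fg // scaler_sumr; apply: eq_bigr => i _; rewrite scalerA.
- move=> F G FG [k [c [g [Hg Fg]]]]; exists k, c, g; split=> // x cx.
  by rewrite -FG // Fg.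
Qed.
Lemma lin_span_min (H S : wf -> Prop) : is_subspace S -> (forall F, H F -> S F) ->
  forall F, lin_span H F -> S F.
Proof.
move=> hS HS F [k [c [g [Hg Fg]]]].
apply: (sub_ext hS) (sub_sum (r := index_enum 'I_k) (F := fun i x => c i *: g i x) hS _).
  by move=> x cx; rewrite Fg.
by move=> i _; apply: (sub_scale hS); apply: HS.
Qed.

Lemma pull_subspace S (f : V -> R[i]) : is_subspace S ->
  is_subspace (fun F => S (fun x => f x *: F x)).
Proof.
move=> hS; split.
- by apply: (sub_ext hS) (sub0 hS) => x _; rewrite scaler0.
- move=> F G SF SG; apply: (sub_ext hS) (sub_add hS SF SG) => x _.
  by rewrite scalerDr.
- move=> c F SF; apply: (sub_ext hS) (sub_scale hS c SF) => x _.
  by rewrite !scalerA mulrC.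
- by move=> F G FG; apply: (sub_ext hS) => x cx; rewrite FG.
Qed.

(* The generators of H_0^n over the polynomials in xbar and r^2, with their
   degrees. *)
Inductive base : nat -> wf -> Prop :=
| Base0 s : base 0 (Phi hN 0 s)
| Base1 s : base 1 (Phi hN 1 s)
| Base2 s : base 2 (Phi hN 2 s)
| Base2t s of Sigma' hN s : base 2 (Phi2t hN s)
| Base3 s : base 3 (fun x => (cubes x)%:C *: Phi hN 0 s x)
| Base3h s : base 3 (Phi3h hN s)
| Base4 s : base 4 (fun x => (cubes x)%:C *: Phi hN 1 s x).

Inductive monomial d : wf -> Prop :=
| Monomial i j b B of base b B & (i + 2 * j + b = d)%N :
    monomial d (fun x => (xbar x ^+ i * rsq x ^+ j)%:C *: B x).

Definition bterm d p B : wf := fun x => (xbar_times d p x)%:C *: B x.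

(** Composition with X - 1 is the expansion in powers of t + 1 = 2 r^2 / (N xbar^2), so the
    coefficient of the power of xbar free of r^2 is the value of p at -1. *)
Lemma xbar_times_expand d p x : (size p <= d./2.+1)%N ->
  xbar_times d p x = \sum_(k < d./2.+1) (p \Po ('X - 1))`_k * (2 / N%:R) ^+ k
    * (xbar x ^+ (d - 2 * k) * rsq x ^+ k).
Proof.
move=> pd; pose q := p \Po ('X - 1).
have sX : size ('X - 1 : {poly R}) = 2%N by rewrite -polyC1 size_XsubC.
have qd : (size q <= d./2.+1)%N by rewrite size_comp_poly2.
have pq : p = q \Po (1%:P + 1 *: 'X).
  rewrite -comp_polyA comp_polyB comp_polyX rmorph1 scale1r ?rmorph1 addrAC subrr.
  by rewrite add0r comp_polyXr.
transitivity (hval d p (xbar x) (2 * rsq x / N%:R - xbar x ^+ 2)); first by [].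
rewrite {1}pq hval_comp // (hvalE _ _ _ qd); apply: eq_bigr => k _.
by rewrite -/q !mul1r addrC subrK [2 * _ / _]mulrAC exprMn; ring.
Qed.

Lemma xbar_times_lower d e p x : (size p <= d./2.+1)%N ->
  xbar_times (e + d) p x = xbar x ^+ e * xbar_times d p x.
Proof.
move=> pd; have := @hval_lower R (e + d) e p (xbar x) (2 * rsq x / N%:R - xbar x ^+ 2).
by rewrite leq_addr addKn => /(_ isT pd).
Qed.

Lemma sub_bterm S d p B : is_subspace S -> (size p <= d./2.+1)%N ->
  (forall k, (2 * k <= d)%N ->
     S (fun x => (xbar x ^+ (d - 2 * k) * rsq x ^+ k)%:C *: B x)) ->
  S (bterm d p B).
Proof.
move=> hS pd SB.
apply: (sub_ext hS) (sub_sum (r := index_enum 'I_(d./2.+1)) (F := fun k x =>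
  ((p \Po ('X - 1))`_k * (2 / N%:R) ^+ k)%:C *:
   ((xbar x ^+ (d - 2 * k) * rsq x ^+ k)%:C *: B x)) hS _) => [x _|k _].
  rewrite /bterm xbar_times_expand // rmorph_sum scaler_suml.
  by apply: eq_bigr => k _; rewrite scalerA -rmorphM.
apply: (sub_scale hS); apply: SB.
by have := ltn_ord k; lia.
Qed.

Lemma bterm_homogeneous m b p B : base b B -> (b <= m)%N ->
  (size p <= (m - b)./2.+1)%N -> lin_span (monomial m) (bterm (m - b) p B).
Proof.
move=> hB bm sp; apply: sub_bterm => //; first exact: lin_span_subspace.
by move=> k km; apply: lin_span_gen; apply: Monomial hB _; lia.
Qed.

Section Decomposition.
Variables (m : nat) (s : Sg).
Local Notation P := (P N a).
Local Notation Phi := (Phi hN).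

(** The bodies are the eigenfunctions without their radial factor, kept convertible to them so that
    [family_body] holds by reflexivity. *)
Definition body0 : wf := bterm m (P m 0 0 m./2) (Phi 0 s).
Definition body1 : wf := fun x => (xbar_times (m - 1) (P m 1 0 (m - 1)./2) x)%:C *:
  (Phi 1 s x - (xbar x)%:C *: Phi 0 s x).
Definition coef2 : R := 2 * (alpha N a + 1) / (2 * ((m - 1)./2)%:R + 1).
Definition coef2t : R :=
  2 * (alpha N a + 1) / ((2 * ((m - 1)./2)%:R + 1) * (N%:R - 1)).
Definition body2 (B : wf) (p : {poly R}) : wf := fun x =>
  (xbar_times (m - 2) (P m 2 0 (m./2 - 1)) x)%:C *:
       (B x - (2 * xbar x)%:C *: Phi 1 s x)
     + (xbar_times m p x)%:C *: Phi 0 s x.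
Definition body3 : wf := fun x =>
  (2 / (3 * N%:R) * xbar_times (m - 3) (P m 3 0 (m - 3)./2) x * cubes x
      + xbar_times m (varphi N a m) x)%:C *: Phi 0 s x.
Definition poly3h1 : {poly R} := P m 3 0 (m - 3)./2
           + (2 * (alpha N a + 2) / (2 * (m./2)%:R - 1)) *: P m 2 0 (m - 3)./2.
Definition poly3h0 : {poly R} := 3^-1 *: P m 3 0 (m - 3)./2
           + (2 * (m./2)%:R - 1)^-1 *: P m 2 0 (m - 3)./2
           + ((2 * alpha N a + 3) / (m%:R * (m%:R - 2)) * (odd m)%:R)
               *: P m 1 0 (m - 3)./2.
Definition body3h : wf := fun x =>
  (xbar_times (m - 3) (P m 3 0 (m - 3)./2) x)%:C *:
       (Phi3h hN s x - (2 * xbar x)%:C *: Phi 2 s x)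
     + (2 * xbar_times (m - 1) poly3h1 x)%:C *: Phi 1 s x
     - (2 * xbar_times m poly3h0 x)%:C *: Phi 0 s x.
Definition coef4 : R := 3 / (2 * (((m - 3)./2)%:R + 2^-1)).
Definition body4 : wf := fun x =>
  (coef4 * xbar_times (m - 2) (P m 3 0 (m./2 - 2)) x)%:C *: Phi 2 s x
     + (3 / 2 * xbar_times (m - 1) (phi N a m) x
        - N%:R^-1 * xbar_times (m - 4) (P m 4 0 (m./2 - 2)) x * cubes x)%:C
         *: Phi 1 s x
     + (N%:R^-1 * xbar_times (m - 3) (P m 4 0 (m./2 - 2)) x * cubes x
        + 3 / 2 * xbar_times m (chi N a m) x)%:C *: Phi 0 s x.

Lemma xbar_timesS d e p x : (d = e.+1)%N -> (size p <= e./2.+1)%N ->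
  xbar_times d p x = xbar x * xbar_times e p x.
Proof. by move=> -> pe; rewrite (@xbar_times_lower e 1) ?expr1. Qed.

Lemma body1E x : (1 <= m)%N -> body1 x
  = bterm (m - 1) (P m 1 0 (m - 1)./2) (Phi 1 s) x
    - bterm m (P m 1 0 (m - 1)./2) (Phi 0 s) x.
Proof.
move=> m1; rewrite /body1 /bterm; move: (Phi 1 s x) (Phi 0 s x) => F1 F0.
have E : xbar_times m (P m 1 0 (m - 1)./2) x
    = xbar x * xbar_times (m - 1) (P m 1 0 (m - 1)./2) x.
  by apply: xbar_timesS; [lia | apply: size_P].
by rewrite scalerBr scalerA -rmorphM E [in RHS]mulrC.
Qed.

Lemma body2E B p x : (2 <= m)%N -> body2 B p x
  = bterm (m - 2) (P m 2 0 (m./2 - 1)) B x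
    - 2%:C *: bterm (m - 1) (P m 2 0 (m./2 - 1)) (Phi 1 s) x
    + bterm m p (Phi 0 s) x.
Proof.
move=> m2; rewrite /body2 /bterm; move: (B x) (Phi 1 s x) (Phi 0 s x) => F2 F1 F0.
have -> : xbar_times (m - 1) (P m 2 0 (m./2 - 1)) x
    = xbar x * xbar_times (m - 2) (P m 2 0 (m./2 - 1)) x.
  by apply: xbar_timesS; [lia | apply: size_P; lia].
by rewrite scalerBr !scalerA -!rmorphM mulrCA [_ * xbar x]mulrC.
Qed.

Lemma body3E x : (3 <= m)%N -> body3 x
  = (2 / (3 * N%:R))%:C *: bterm (m - 3) (P m 3 0 (m - 3)./2)
         (fun x => (cubes x)%:C *: Phi 0 s x) x
    + bterm m (varphi N a m) (Phi 0 s) x.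
Proof.
move=> m2; rewrite /body3 /bterm; move: (Phi 0 s x) => F0.
by rewrite !scalerA -!rmorphM rmorphD scalerDl.
Qed.

Lemma body3hE x : (3 <= m)%N -> body3h x
  = bterm (m - 3) (P m 3 0 (m - 3)./2) (Phi3h hN s) x
    - 2%:C *: bterm (m - 2) (P m 3 0 (m - 3)./2) (Phi 2 s) x
    + 2%:C *: bterm (m - 1) poly3h1 (Phi 1 s) x
    - 2%:C *: bterm m poly3h0 (Phi 0 s) x.
Proof.
move=> m3; rewrite /body3h /bterm.
move: (Phi3h hN s x) (Phi 2 s x) (Phi 1 s x) (Phi 0 s x) => F3 F2 F1 F0.
have -> : xbar_times (m - 2) (P m 3 0 (m - 3)./2) x
    = xbar x * xbar_times (m - 3) (P m 3 0 (m - 3)./2) x.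
  by apply: xbar_timesS; [lia | apply: size_P; lia].
by rewrite scalerBr !scalerA -!rmorphM mulrCA [_ * xbar x]mulrC.
Qed.

Lemma body4E x : (4 <= m)%N -> body4 x
  = coef4%:C *: bterm (m - 2) (P m 3 0 (m./2 - 2)) (Phi 2 s) x
    + (3 / 2)%:C *: bterm (m - 1) (phi N a m) (Phi 1 s) x
    - (N%:R^-1)%:C *: bterm (m - 4) (P m 4 0 (m./2 - 2))
         (fun x => (cubes x)%:C *: Phi 1 s x) x
    + (N%:R^-1)%:C *: bterm (m - 3) (P m 4 0 (m./2 - 2))
         (fun x => (cubes x)%:C *: Phi 0 s x) x
    + (3 / 2)%:C *: bterm m (chi N a m) (Phi 0 s) x.
Proof.
move=> m4; rewrite /body4 /bterm.
move: (Phi 2 s x) (Phi 1 s x) (Phi 0 s x) => F2 F1 F0; rewrite !scalerA -!rmorphM.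
by rewrite rmorphB rmorphD scalerBl scalerDl !addrA.
Qed.
End Decomposition.

End Span.

(** * Monomials as generators of the invariant space *)

Section Monomials.
Variables (R : realType) (N : nat) (hN : (2 < N)%N) (twoM : nat).
Local Notation V := 'rV[R]_N.
Local Notation Sg := (Sigma R N twoM).
Local Notation wf := (wavefun R N twoM).
Implicit Types (x y : V) (s : Sg) (m l n d b : nat) (F G B Q : wf).
Implicit Types (S : wf -> Prop) (p q : {poly R}).

Local Notation base := (@base R N hN twoM).
Local Notation monomial := (@monomial R N hN twoM).

Lemma pv1E x : PowerSumMonomials.pv 1 (fun k : 'I_N => (x 0 k)%:C) = (N%:R * xbar x)%:C.
Proof.
rewrite /xbar mulrA mulfV ?mul1r; last exact: (@N_neq0 R N hN).
by rewrite rmorph_sum; apply: eq_bigr => i _; rewrite expr1.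
Qed.
Lemma pv2E x : PowerSumMonomials.pv 2 (fun k : 'I_N => (x 0 k)%:C) = (rsq x)%:C.
Proof. by rewrite rmorph_sum; apply: eq_bigr => i _; rewrite rmorphXn. Qed.
Lemma pv3E x : PowerSumMonomials.pv 3 (fun k : 'I_N => (x 0 k)%:C) = (cubes x)%:C.
Proof. by rewrite rmorph_sum; apply: eq_bigr => i _; rewrite rmorphXn. Qed.

Lemma xbar_pow i j x : (xbar x ^+ i * rsq x ^+ j)%:C
  = (N%:R^-1 ^+ i)%:C * ((N%:R * xbar x)%:C ^+ i * (rsq x)%:C ^+ j).
Proof.
rewrite -!rmorphXn -!rmorphM; congr (_%:C).
have N0 : N%:R ^+ i != 0 :> R by rewrite expf_neq0 //; exact: (@N_neq0 R N hN).
by move: (xbar x) (rsq x) => u r; rewrite exprMn exprVn !mulrA mulVf // mul1r.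
Qed.

Lemma monomial_Hspace n d F : (d <= n)%N -> monomial d F -> Hspace hN n F.
Proof.
move=> dn [i j b B hB hd].
have gen (f : R[i]) G : Hspace_gen hN n G ->
    (forall x, (xbar x ^+ i * rsq x ^+ j)%:C *: B x = f *: G x) ->
    Hspace hN n (fun x => (xbar x ^+ i * rsq x ^+ j)%:C *: B x).
  move=> hG fG; have hS := lin_span_subspace (@Hspace_gen R N hN twoM n).
  by apply: (sub_ext hS _ (sub_scale hS f (lin_span_gen hG))) => x _; rewrite fG.
have [f2 [deg2 ev2]] := @PowerSumMonomials.monomial2 R[i] N i j.
have [f0 [d33_0 deg0 ev0]] := @PowerSumMonomials.monomial3 R[i] N i j 0 isT.
have [f1 [d33_1 deg1 ev1]] := @PowerSumMonomials.monomial3 R[i] N i j 1 isT.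
case: hB hd gen => [s|s|s|s hs|s|s|s] hd gen.
- apply: (gen (N%:R^-1 ^+ i)%:C (fun x => psum_fun f0 x *: Phi hN 0 s x)).
    by apply: (Gen_f hN s d33_0); apply: deg0; lia.
  by move=> x; rewrite /psum_fun ev0 pv1E pv2E expr0 mulr1 scalerA -xbar_pow.
- apply: (gen (N%:R^-1 ^+ i)%:C (fun x => psum_fun f0 x *: Phi hN 1 s x)).
    by apply: (Gen_g hN s d33_0); apply: deg0; lia.
  by move=> x; rewrite /psum_fun ev0 pv1E pv2E expr0 mulr1 scalerA -xbar_pow.
- apply: (gen (N%:R^-1 ^+ i)%:C (fun x => psum_fun f2 x *: Phi hN 2 s x)).
    by apply: (Gen_h hN s); apply: deg2; lia.
  by move=> x; rewrite /psum_fun ev2 pv1E pv2E scalerA -xbar_pow.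
- apply: (gen (N%:R^-1 ^+ i)%:C (fun x => psum_fun f2 x *: Phi2t hN s x)).
    by apply: (Gen_ht _ hs); apply: deg2; lia.
  by move=> x; rewrite /psum_fun ev2 pv1E pv2E scalerA -xbar_pow.
- apply: (gen (N%:R^-1 ^+ i)%:C (fun x => psum_fun f1 x *: Phi hN 0 s x)).
    by apply: (Gen_f hN s d33_1); apply: deg1; lia.
  move=> x; rewrite /psum_fun ev1 pv1E pv2E pv3E expr1 [in RHS]scalerA [in RHS]mulrA.
  by rewrite -xbar_pow -[in RHS]scalerA.
- apply: (gen (N%:R^-1 ^+ i)%:C (fun x => psum_fun f2 x *: Phi3h hN s x)).
    by apply: (Gen_w hN s); apply: deg2; lia.
  by move=> x; rewrite /psum_fun ev2 pv1E pv2E scalerA -xbar_pow.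
- apply: (gen (N%:R^-1 ^+ i)%:C (fun x => psum_fun f1 x *: Phi hN 1 s x)).
    by apply: (Gen_g hN s d33_1); apply: deg1; lia.
  move=> x; rewrite /psum_fun ev1 pv1E pv2E pv3E expr1 [in RHS]scalerA [in RHS]mulrA.
  by rewrite -xbar_pow -[in RHS]scalerA.
Qed.

Lemma pow_xbar i j x : (N%:R * xbar x)%:C ^+ i * (rsq x)%:C ^+ j
  = (N%:R ^+ i)%:C * (xbar x ^+ i * rsq x ^+ j)%:C.
Proof.
move: (xbar x) (rsq x) => u r.
have -> : (N%:R * u)%:C ^+ i = (N%:R ^+ i)%:C * (u ^+ i)%:C :> R[i].
  by rewrite -rmorphXn exprMn rmorphM.
have -> : r%:C ^+ j = (r ^+ j)%:C :> R[i] by rewrite rmorphXn.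
by rewrite [(_ * r ^+ j)%:C]rmorphM mulrA.
Qed.

(** The condition on second derivatives leaves sigma_3 with exponent 0 or 1; the terms linear in
    sigma_3 are the ones represented by [Base3] and [Base4]. *)
Lemma Hspace_gen_min n S : is_subspace S ->
  (forall d F, (d <= n)%N -> monomial d F -> S F) ->
  forall F, Hspace_gen hN n F -> S F.
Proof.
move=> hS hm.
have sum3 b b' (f : PowerSums.poly_in R[i] 3) B : (b' = b + 3)%N ->
    PowerSums.d33_eq0 f -> deg_le N f n b -> base b B ->
    base b' (fun x => (cubes x)%:C *: B x) ->
    S (fun x => psum_fun f x *: B x).
  move=> bb' f33 fn hB hB'.
  have [L [hL ev]] := PowerSumMonomials.trunc3 f33 fn.
  apply: (sub_ext hS) (sub_sum (r := L) (F := fun t x => t.1 *: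
    ((PowerSumMonomials.pv 1 (fun k : 'I_N => (x 0 k)%:C) ^+ t.2.1.1
    * PowerSumMonomials.pv 2 (fun k : 'I_N => (x 0 k)%:C) ^+ t.2.1.2
    * PowerSumMonomials.pv 3 (fun k : 'I_N => (x 0 k)%:C) ^+ t.2.2) *: B x)) hS _).
    move=> x _; rewrite /psum_fun ev scaler_suml; apply: eq_bigr => t _.
    by rewrite scalerA.
  move=> [c [[i j] k]] /hL /= /andP[ijk k1]; apply: (sub_scale hS).
  case: k k1 ijk => [|[|//]] _ ijk.
    apply: (sub_ext hS) (sub_scale hS (N%:R ^+ i)%:C (hm (i + 2 * j + b)%N _ _ (Monomial hB erefl))).
      by move=> x _; rewrite pv1E pv2E expr0 mulr1 pow_xbar scalerA.
    by lia.
  apply: (sub_ext hS) (sub_scale hS (N%:R ^+ i)%:C (hm (i + 2 * j + b')%N _ _ (Monomial hB' erefl))).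
    by move=> x _; rewrite pv1E pv2E pv3E expr1 pow_xbar !scalerA.
  by lia.
have sum2 b (f : PowerSums.poly_in R[i] 2) B : deg_le N f n b -> base b B ->
    S (fun x => psum_fun f x *: B x).
  move=> fn hB; have [L [hL ev]] := PowerSumMonomials.trunc2 fn.
  apply: (sub_ext hS) (sub_sum (r := L) (F := fun t x => t.1 *:
    ((PowerSumMonomials.pv 1 (fun k : 'I_N => (x 0 k)%:C) ^+ t.2.1
    * PowerSumMonomials.pv 2 (fun k : 'I_N => (x 0 k)%:C) ^+ t.2.2) *: B x)) hS _).
    move=> x _; rewrite /psum_fun ev scaler_suml; apply: eq_bigr => t _.
    by rewrite scalerA.
  move=> [c [i j]] /hL /= ij; apply: (sub_scale hS).
  apply: (sub_ext hS) (sub_scale hS (N%:R ^+ i)%:C (hm (i + 2 * j + b)%N _ _ (Monomial hB erefl))).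
    by move=> x _; rewrite pv1E pv2E pow_xbar scalerA.
  by lia.
move=> F [f s f33 fn|g s g33 gn|h s hn|h s hn hs|w s wn].
- exact: (sum3 0 3)%N (Base0 hN s) (Base3 hN s).
- exact: (sum3 1 4)%N (Base1 hN s) (Base4 hN s).
- exact: sum2 (Base2 hN s).
- exact: sum2 (Base2t hs).
- exact: sum2 (Base3h hN s).
Qed.

End Monomials.

(** * Triangularity modulo r^2 and induction on the degree *)

Section Completeness.
Variables (R : realType) (N : nat) (hN : (2 < N)%N) (twoM : nat).
Variables (a omega : R) (ha : 2^-1 < a).
Local Notation V := 'rV[R]_N.
Local Notation Sg := (Sigma R N twoM).
Local Notation wf := (wavefun R N twoM).
Local Notation base := (@base R N hN twoM).
Local Notation monomial := (@monomial R N hN twoM).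
Local Notation family := (@spin_eigenfamily R N hN twoM a omega).
Local Notation swap := (spin_swap (first hN) (second hN)).
Local Notation P := (P N a).
Implicit Types (x y : V) (s : Sg) (m l n d b j : nat) (F G B Q : wf).
Implicit Types (S : wf -> Prop) (p : {poly R}).

Ltac sizes := repeat lazymatch goal with
  | |- is_true (leq (size (polyseq (GRing.add _ _))) _) => apply: size_polyD_leq
  | |- is_true (leq (size (polyseq (GRing.opp _))) _) => apply: size_polyN_leq
  | |- is_true (leq (size (polyseq (GRing.scale _ _))) _) => apply: size_polyZ_leq
  | |- is_true (leq (size (polyseq (Defs.P _ _ _ _ _ _))) _) => apply: size_P; lia
  end.

Lemma size_poly3h1 m : (3 <= m)%N -> (size (poly3h1 N a m) <= (m - 1)./2.+1)%N.
Proof. by move=> m3; rewrite /poly3h1; sizes. Qed.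
Lemma size_poly3h0 m : (3 <= m)%N -> (size (poly3h0 N a m) <= m./2.+1)%N.
Proof. by move=> m3; rewrite /poly3h0; sizes. Qed.

Section Bodies.
Variables (m : nat) (s : Sg).
Let hS := lin_span_subspace (monomial m).
Local Notation spanm := (lin_span (monomial m)).

Lemma span_bterm b d p B : base b B -> (b <= m)%N -> d = (m - b)%N ->
  (size p <= d./2.+1)%N -> spanm (bterm d p B).
Proof. by move=> hB bm -> sp; apply: bterm_homogeneous. Qed.

Lemma body0_span : spanm (body0 hN a m s).
Proof. by apply: span_bterm (Base0 hN s) _ _ _ => //; [lia | sizes]. Qed.

Lemma body1_span : (1 <= m)%N -> spanm (body1 hN a m s).
Proof.
move=> m1; have h1 := span_bterm (Base1 hN s) m1 erefl.
have h0 := span_bterm (Base0 hN s) (leq0n m) (esym (subn0 m)).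
apply: (sub_ext hS _ (sub_add hS (h1 _ _) (sub_opp hS (h0 _ _)))).
- by move=> x _; rewrite body1E.
- by sizes.
- by sizes.
Qed.

Lemma body2_span B p : base 2 B -> (2 <= m)%N -> (size p <= m./2.+1)%N ->
  spanm (body2 hN a m s B p).
Proof.
move=> hB m2 sp; have h2 := span_bterm hB m2 erefl.
have h1 := span_bterm (Base1 hN s) (ltnW m2) erefl.
have h0 := span_bterm (Base0 hN s) (leq0n m) (esym (subn0 m)).
apply: (sub_ext hS _ (sub_add hS (sub_add hS (h2 _ _)
  (sub_opp hS (sub_scale hS 2%:C (h1 _ _)))) (h0 _ _))).
- by move=> x _; rewrite body2E.
- by sizes.
- by sizes.
- by [].
Qed.

Lemma body3_span : (3 <= m)%N -> spanm (body3 hN a m s).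
Proof.
move=> m3; have h3 := span_bterm (Base3 hN s) m3 erefl.
have h0 := span_bterm (Base0 hN s) (leq0n m) (esym (subn0 m)).
apply: (sub_ext hS _ (sub_add hS (sub_scale hS (2 / (3 * N%:R))%:C (h3 _ _)) (h0 _ _))).
- by move=> x _; rewrite body3E.
- by sizes.
- exact: size_varphi.
Qed.

Lemma body3h_span : (3 <= m)%N -> spanm (body3h hN a m s).
Proof.
move=> m3; have h3 := span_bterm (Base3h hN s) m3 erefl.
have h2 := span_bterm (Base2 hN s) (ltnW m3) erefl.
have h1 := span_bterm (Base1 hN s) (ltnW (ltnW m3)) erefl.
have h0 := span_bterm (Base0 hN s) (leq0n m) (esym (subn0 m)).
apply: (sub_ext hS _ (sub_add hS (sub_add hS (sub_add hS (h3 _ _)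
  (sub_opp hS (sub_scale hS 2%:C (h2 _ _)))) (sub_scale hS 2%:C (h1 _ _)))
  (sub_opp hS (sub_scale hS 2%:C (h0 _ _))))).
- by move=> x _; rewrite body3hE.
- by sizes.
- by sizes.
- exact: size_poly3h1.
- exact: size_poly3h0.
Qed.

Lemma body4_span : (4 <= m)%N -> spanm (body4 hN a m s).
Proof.
move=> m4; have h4 := span_bterm (Base4 hN s) m4 erefl.
have h3 := span_bterm (Base3 hN s) (ltnW m4) erefl.
have h2 := span_bterm (Base2 hN s) (ltnW (ltnW m4)) erefl.
have h1 := span_bterm (Base1 hN s) (ltnW (ltnW (ltnW m4))) erefl.
have h0 := span_bterm (Base0 hN s) (leq0n m) (esym (subn0 m)).
apply: (sub_ext hS _ (sub_add hS (sub_add hS (sub_add hS (sub_add hS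
  (sub_scale hS (coef4 R m)%:C (h2 _ _)) (sub_scale hS (3 / 2)%:C (h1 _ _)))
  (sub_opp hS (sub_scale hS (N%:R^-1)%:C (h4 _ _))))
  (sub_scale hS (N%:R^-1)%:C (h3 _ _))) (sub_scale hS (3 / 2)%:C (h0 _ _)))).
- by move=> x _; rewrite body4E.
- by sizes.
- exact: size_phi.
- by sizes.
- by sizes.
- exact: size_chi.
Qed.
End Bodies.

Lemma family_body l m F : family l m F -> exists Q,
  [/\ forall l', family l' m (fun x => (radial a omega l' m x)%:C *: Q x),
      lin_span (monomial m) Q & F = fun x => (radial a omega l m x)%:C *: Q x].
Proof.
case=> [s|s m1|s m2|s m2 ss hs|s m3|s m3 ss|s m4].
- by exists (body0 hN a m s); split=> // [l'|]; [exact: Fam0 | exact: body0_span].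
- by exists (body1 hN a m s); split=> // [l'|]; [exact: Fam1 | exact: body1_span].
- exists (body2 hN a m s (Phi hN 2 s) (P m 2 0 (m./2 - 1)
    - coef2 N a m *: P m 1 0 (m./2 - 1))); split=> // [l'|]; first exact: Fam2.
  by apply: body2_span (Base2 hN s) _ _ => //; sizes.
- exists (body2 hN a m s (Phi2t hN s) (P m 2 0 (m./2 - 1)
    + coef2t N a m *: P m 1 0 (m./2 - 1))); split=> // [l'|]; first exact: Fam2t.
  by apply: body2_span (Base2t hs) _ _ => //; sizes.
- by exists (body3 hN a m s); split=> // [l'|]; [exact: Fam3 | exact: body3_span].
- by exists (body3h hN a m s); split=> // [l'|]; [exact: Fam3h | exact: body3h_span].
- by exists (body4 hN a m s); split=> // [l'|]; [exact: Fam4 | exact: body4_span].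
Qed.

Lemma radialE l m x : radial a omega l m x = mu a omega x *
  \sum_(k < l.+1) (laguerre (- beta N a m) l)`_k * omega ^+ k * rsq x ^+ k.
Proof.
rewrite /radial (horner_coef_wide _ (size_laguerre _ _)); congr (_ * _).
by apply: eq_bigr => k _; rewrite exprMn mulrA.
Qed.

Lemma monomial_rsq S m k F : is_subspace S ->
  (forall G, monomial (m + 2 * k) G -> S G) -> monomial m F ->
  S (fun x => (rsq x ^+ k)%:C *: F x).
Proof.
move=> hS hm [i j b B hB hd].
apply: (sub_ext hS _ (hm _ (Monomial (i := i) (j := k + j) hB _))); last by lia.
by move=> x _; rewrite scalerA -rmorphM exprD [in RHS]mulrCA.
Qed.

Lemma family_mu_Hspace n l m F : (2 * l + m <= n)%N -> family l m F ->
  mu_Hspace hN a omega n F.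
Proof.
move=> lmn /family_body[Q [_ Qm ->]].
have hS := lin_span_subspace (@Hspace_gen R N hN twoM n).
pose c k := (laguerre (- beta N a m) l)`_k * omega ^+ k.
exists (fun x => \sum_(k < l.+1) (c k)%:C *: ((rsq x ^+ k)%:C *: Q x)).
  apply: (sub_sum (F := fun (k : 'I_l.+1) x => (c k)%:C *: ((rsq x ^+ k)%:C *: Q x)) hS).
  move=> k _; apply: (sub_scale hS).
  apply: (lin_span_min (pull_subspace (fun x => (rsq x ^+ k)%:C) hS) _ Qm).
  move=> G; apply: (monomial_rsq hS) => G'; apply: monomial_Hspace.
  by have := ltn_ord k; lia.
move=> x _; rewrite radialE rmorphM -scalerA rmorph_sum scaler_suml.
by congr (_ *: _); apply: eq_bigr => k _; rewrite scalerA -rmorphM.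
Qed.

Lemma P_at_N1 m (b : R) k : (k <= m)%N -> (P m b 0 k).[-1] != 0.
Proof.
move=> km; apply: jacobi_at_N1; rewrite /beta addr0.
have h1 : 3%:R <= N%:R :> R by rewrite ler_nat.
have h2 : k%:R <= m%:R :> R by rewrite ler_nat.
have h3 : N%:R * (a + 2^-1) > N%:R * 1 :> R.
  have h4 := ha; rewrite ltr_pM2l; last by apply: lt_le_trans h1; rewrite ltr0n.
  by lra.
by lra.
Qed.

Lemma swapK s : swap (swap s) = s.
Proof.
rewrite /spin_swap spin_permM tperm2; apply/ffunP => c; rewrite ffunE.
by congr (s _); apply/ffunP => k; rewrite ffunE perm1.
Qed.

Local Notation cfg := (spincfg N twoM).

(* Phi2t and Phi3h only see the part of the spin vector that is symmetric,
   respectively antisymmetric, under S_12. *)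
Definition half_sym (c : R[i]) s : Sg :=
  [ffun u : cfg => (s u + c * swap s u) / 2].

Lemma half_symE c s (u : cfg) : half_sym c s u = (s u + c * swap s u) / 2.
Proof. by rewrite ffunE. Qed.

Lemma swap_half_sym c s (u : cfg) : c * c = 1 ->
  swap (half_sym c s) u = c * half_sym c s u.
Proof.
move=> cc; pose v : cfg := [ffun k => u (tperm (first hN) (second hN) k)].
have E (t : Sg) : swap t u = t v by rewrite ffunE.
have sv : swap s v = s u by rewrite -E swapK.
by rewrite E !half_symE sv E mulrA mulrDr mulrA cc mul1r addrC.
Qed.

Lemma comb_half_sym c s (h : 'S_N -> V -> R) x : c * c = 1 ->
  (forall q, (h (tperm (first hN) (second hN) * q)%g x)%:C = c * (h q x)%:C) ->
  comb (spin_term (half_sym c s)) h x = comb (spin_term s) h x.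
Proof.
move=> cc hh; apply/ffunP => u.
have K (A B C : R[i]) : A = c * B -> C = (B + c * A) / 2 -> C = B.
  by move=> -> ->; rewrite mulrA cc mul1r mulrDl -splitr.
apply: (K (comb (spin_term (swap s)) h x u)).
  apply: etrans (congr1 (fun f : Sg => f u) (comb_swap _ _ _ _)) _.
  apply: etrans (comb_c _ _ _ _) _; apply/esym.
  apply: etrans (congr1 ( *%R c) (comb_c _ _ _ _)) _.
  by rewrite mulr_sumr; apply: eq_bigr => q _; rewrite hh mulrA.
have E1 q (t : Sg) : spin_term t q u = (N`!%:R)^-1 * t [ffun k => u (q k)].
  by rewrite ffunE [spin_perm _ _ _]ffunE.
have E2 (t : Sg) : comb (spin_term t) h x u
    = \sum_q (h q x)%:C * ((N`!%:R)^-1 * t [ffun k => u (q k)]).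
  by apply: etrans (comb_c _ _ _ _) _; apply: eq_bigr => q _; rewrite E1.
apply: etrans (E2 _) _; apply/esym.
apply: etrans (congr1 (fun z => z / 2) (congr2 (fun z w => z + c * w) (E2 _) (E2 _))) _.
rewrite mulr_sumr -big_split mulr_suml; apply: eq_bigr => q _ /=.
by rewrite half_symE; ring.
Qed.

Lemma Phi2t_sym s x : Phi2t hN (half_sym 1 s) x = Phi2t hN s x.
Proof.
rewrite [LHS]Phi2tE [RHS]Phi2tE; apply: comb_half_sym => [|q].
  by rewrite mulr1.
by rewrite tau1 tau2 mulrC mul1r.
Qed.
Lemma Phi3h_antisym s x : Phi3h hN (half_sym (-1) s) x = Phi3h hN s x.
Proof.
rewrite [LHS]Phi3hE [RHS]Phi3hE; apply: comb_half_sym => [|q].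
  by rewrite mulrNN mulr1.
by rewrite tau1 tau2 mulN1r -rmorphN; congr (_%:C); ring.
Qed.

(** [splus] applies 1 + S_12, which takes the same value on s and on its symmetric part, so the same
    witness u serves. *)
Lemma Sigma'_sym s : Sigma' hN s -> Sigma' hN (half_sym 1 s).
Proof.
move=> [u hu]; exists u => x; rewrite -hu; apply: eq_bigr => i _.
rewrite /splus; congr (_ *: _); apply: eq_bigr => q _; congr (spin_perm _ _).
apply/ffunP => u'; rewrite ffunE [RHS]ffunE swap_half_sym ?mulr1 //.
by rewrite half_symE !mul1r -splitr.
Qed.

(* S is to be thought of as { F | r^(2j) F is spanned }: in degree d, the
   multiples of r^2 are already known to belong to S. *)
Section Triangular.
Variables (d : nat) (S : wf -> Prop).
Hypothesis hS : is_subspace S.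
Hypothesis low : forall i k b B, base b B -> (i + 2 * k + b = d)%N -> (0 < k)%N ->
  S (fun x => (xbar x ^+ i * rsq x ^+ k)%:C *: B x).
Hypothesis bodies : forall Q,
  (forall l, family l d (fun x => (radial a omega l d x)%:C *: Q x)) -> S Q.

(** The generator B in degree d, taken modulo multiples of r^2. *)
Definition top b B := S (fun x => (xbar x ^+ (d - b))%:C *: B x).

Lemma top_bterm b e p B : base b B -> (b <= d)%N -> e = (d - b)%N ->
  top b B -> (size p <= e./2.+1)%N -> S (bterm e p B).
Proof.
move=> hB bd -> tB sp; apply: sub_bterm => // -[_|k kd].
  by apply: (sub_ext hS _ tB) => x _; rewrite muln0 subn0 expr0 mulr1.
by apply: low hB _ _ => //; lia.
Qed.

(** Modulo multiples of r^2, the term is p(-1) times the power of xbar times B, and p(-1) can be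
    divided out. *)
Lemma bterm_top b e p B : base b B -> (b <= d)%N -> e = (d - b)%N ->
  p.[-1] != 0 -> (size p <= e./2.+1)%N -> S (bterm e p B) -> top b B.
Proof.
move=> hB bd eE p1 sp SB; rewrite /top -eE.
pose c k : R := (p \Po ('X - 1))`_k * (2 / N%:R) ^+ k.
have c0 : c 0%N = p.[-1].
  by rewrite /c expr0 mulr1 -horner_coef0 horner_comp -polyC1 hornerXsubC sub0r.
have lo : S (fun x => \sum_(k < e./2)
    (c k.+1)%:C *: ((xbar x ^+ (e - 2 * k.+1) * rsq x ^+ k.+1)%:C *: B x)).
  apply: (sub_sum (F := fun (k : 'I_e./2) x =>
    (c k.+1)%:C *: ((xbar x ^+ (e - 2 * k.+1) * rsq x ^+ k.+1)%:C *: B x)) hS).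
  move=> k _; apply: (sub_scale hS); apply: low hB _ _ => //.
  by have := ltn_ord k; lia.
apply: (sub_ext hS _ (sub_scale hS (p.[-1]^-1)%:C (sub_add hS SB (sub_opp hS lo)))).
move=> x _; rewrite /bterm (xbar_times_expand _ sp) big_ord_recl rmorphD scalerDl.
rewrite rmorph_sum scaler_suml.
rewrite [X in _ + X - _](eq_bigr (fun k : 'I_e./2 =>
  (c k.+1)%:C *: ((xbar x ^+ (e - 2 * k.+1) * rsq x ^+ k.+1)%:C *: B x))); last first.
  by move=> k _; rewrite scalerA -rmorphM.
rewrite addrK -/(c 0%N) c0 muln0 subn0 expr0 mulr1 scalerA -rmorphM.
by rewrite mulrA mulVf // mul1r.
Qed.

Lemma top0 s : top 0 (Phi hN 0 s).
Proof.
have hb : S (body0 hN a d s) by apply: bodies => l; exact: Fam0.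
apply: (bterm_top (Base0 hN s) (leq0n d) (esym (subn0 d)) _ _ hb); last by sizes.
by apply: P_at_N1; lia.
Qed.

Lemma top1 s : (1 <= d)%N -> top 1 (Phi hN 1 s).
Proof.
move=> d1; have hb : S (body1 hN a d s) by apply: bodies => l; exact: Fam1.
have h0 := top_bterm (Base0 hN s) (leq0n d) (esym (subn0 d)) (top0 s).
apply: (bterm_top (p := P d 1 0 (d - 1)./2) (Base1 hN s) d1 erefl).
- by apply: P_at_N1; lia.
- by sizes.
apply: (sub_ext hS _ (sub_add hS hb (h0 (P d 1 0 (d - 1)./2) _))); last by sizes.
by move=> x _; rewrite body1E // subrK.
Qed.

Lemma top2_body s p B : (2 <= d)%N -> base 2 B -> (size p <= d./2.+1)%N ->
  S (body2 hN a d s B p) -> top 2 B.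
Proof.
move=> d2 hB sp hb.
have h0 := top_bterm (Base0 hN s) (leq0n d) (esym (subn0 d)) (top0 s) sp.
have h1 := top_bterm (Base1 hN s) (ltnW d2) erefl (top1 s (ltnW d2)).
apply: (bterm_top (p := P d 2 0 (d./2 - 1)) hB d2 erefl).
- by apply: P_at_N1; lia.
- by sizes.
apply: (sub_ext hS _ (sub_add hS (sub_add hS hb (sub_opp hS h0))
  (sub_scale hS 2%:C (h1 (P d 2 0 (d./2 - 1)) _)))); last by sizes.
by move=> x _; rewrite body2E // addrK subrK.
Qed.

Lemma top2 s : (2 <= d)%N -> top 2 (Phi hN 2 s).
Proof.
move=> d2; apply: (top2_body (s := s) (p := P d 2 0 (d./2 - 1)
  - coef2 N a d *: P d 1 0 (d./2 - 1)) d2 (Base2 hN s)); first by sizes.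
by apply: bodies => l; exact: Fam2.
Qed.

Lemma top2t s : (2 <= d)%N -> Sigma' hN s -> top 2 (Phi2t hN s).
Proof.
move=> d2 hs; have hs' := Sigma'_sym hs.
have ss : swap (half_sym 1 s) = half_sym 1 s.
  by apply/ffunP => u; rewrite swap_half_sym ?mulr1 ?mul1r.
have : top 2 (Phi2t hN (half_sym 1 s)).
  apply: (top2_body (s := half_sym 1 s) (p := P d 2 0 (d./2 - 1)
    + coef2t N a d *: P d 1 0 (d./2 - 1)) d2 (Base2t hs')); first by sizes.
  by apply: bodies => l; exact: Fam2t.
by apply: (sub_ext hS) => x _; rewrite Phi2t_sym.
Qed.

Lemma top3 s : (3 <= d)%N -> top 3 (fun x => (cubes x)%:C *: Phi hN 0 s x).
Proof.
move=> d3; have hb : S (body3 hN a d s) by apply: bodies => l; exact: Fam3.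
have h0 := top_bterm (Base0 hN s) (leq0n d) (esym (subn0 d)) (top0 s)
  (size_varphi hN ha d3).
apply: (bterm_top (p := P d 3 0 (d - 3)./2) (Base3 hN s) d3 erefl).
- by apply: P_at_N1; lia.
- by sizes.
apply: (sub_ext hS _ (sub_scale hS (3 * N%:R / 2)%:C (sub_add hS hb (sub_opp hS h0)))).
move=> x _; rewrite body3E // addrK scalerA -rmorphM.
rewrite (_ : _ * _ = 1 :> R) ?scale1r // .
by field; rewrite (@N_neq0 R N hN).
Qed.

Lemma top3h s : (3 <= d)%N -> top 3 (Phi3h hN s).
Proof.
move=> d3; pose s' := half_sym (-1) s.
have ss : swap s' = - s'.
  apply/ffunP => u; rewrite [RHS]ffunE swap_half_sym ?mulN1r //.
  by rewrite opprK.
have hb : S (body3h hN a d s') by apply: bodies => l; exact: Fam3h.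
have h0 := top_bterm (Base0 hN s') (leq0n d) (esym (subn0 d)) (top0 s')
  (size_poly3h0 d3).
have h1 := top_bterm (Base1 hN s') (ltnW (ltnW d3)) erefl (top1 s' (ltnW (ltnW d3)))
  (size_poly3h1 d3).
have h2 := top_bterm (Base2 hN s') (ltnW d3) erefl (top2 s' (ltnW d3)).
have : top 3 (Phi3h hN s').
  apply: (bterm_top (p := P d 3 0 (d - 3)./2) (Base3h hN s') d3 erefl).
  - by apply: P_at_N1; lia.
  - by sizes.
  apply: (sub_ext hS _ (sub_add hS (sub_add hS (sub_add hS hb
    (sub_scale hS 2%:C h0)) (sub_opp hS (sub_scale hS 2%:C h1)))
    (sub_scale hS 2%:C (h2 (P d 3 0 (d - 3)./2) _)))); last by sizes.
  move=> x _; rewrite body3hE //.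
  have K (A B C D : Sg) : A - B + C - D + D - C + B = A by rewrite subrK addrK subrK.
  exact: K.
by apply: (sub_ext hS) => x _; rewrite Phi3h_antisym.
Qed.

Lemma top4 s : (4 <= d)%N -> top 4 (fun x => (cubes x)%:C *: Phi hN 1 s x).
Proof.
move=> d4; have hb : S (body4 hN a d s) by apply: bodies => l; exact: Fam4.
have h0 := top_bterm (Base0 hN s) (leq0n d) (esym (subn0 d)) (top0 s)
  (size_chi hN ha d4).
have h1 := top_bterm (Base1 hN s) (ltnW (ltnW (ltnW d4))) erefl
  (top1 s (ltnW (ltnW (ltnW d4)))) (size_phi hN ha d4).
have h2 := top_bterm (Base2 hN s) (ltnW (ltnW d4)) erefl (top2 s (ltnW (ltnW d4))).
have h3 := top_bterm (Base3 hN s) (ltnW d4) erefl (top3 s (ltnW d4)).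
apply: (bterm_top (p := P d 4 0 (d./2 - 2)) (Base4 hN s) d4 erefl).
- by apply: P_at_N1; lia.
- by sizes.
(* The scalar -N undoes the coefficient -1 / N of the term in [body4] that is being isolated. *)
apply: (sub_ext hS _ (sub_scale hS (- N%:R)%:C (sub_add hS (sub_add hS (sub_add hS
  (sub_add hS hb (sub_opp hS (sub_scale hS (3 / 2)%:C h0)))
  (sub_opp hS (sub_scale hS (N%:R^-1)%:C (h3 (P d 4 0 (d./2 - 2)) _))))
  (sub_opp hS (sub_scale hS (3 / 2)%:C h1)))
  (sub_opp hS (sub_scale hS (coef4 R d)%:C (h2 (P d 3 0 (d./2 - 2)) _)))))); try by sizes.
move=> x _; rewrite body4E //.
have K (A B C D X : Sg) : A + B - (N%:R^-1)%:C *: X + C + D - D - C - B - A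
    = - ((N%:R^-1)%:C *: X).
  by rewrite !addrK [A + B - _]addrAC addrK addrAC subrr add0r.
apply: etrans (congr1 (GRing.scale (- N%:R)%:C) (K _ _ _ _ _)) _.
rewrite scalerN -scaleNr -rmorphN opprK scalerA -rmorphM mulfV ?scale1r //.
exact: (@N_neq0 R N hN).
Qed.

Lemma top_base b B : base b B -> (b <= d)%N -> top b B.
Proof.
case=> [s|s|s|s hs|s|s|s].
- by move=> _; exact: top0.
- exact: top1.
- exact: top2.
- by move=> d2; exact: top2t.
- exact: top3.
- exact: top3h.
- exact: top4.
Qed.

Lemma monomial_triangular F : monomial d F -> S F.
Proof.
case=> i [|k] b B hB hd; last by apply: low hB hd _.
have bd : (b <= d)%N by lia.
have -> : i = (d - b)%N by lia.
by apply: (sub_ext hS _ (top_base hB bd)) => x _; rewrite expr0 mulr1.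
Qed.

End Triangular.

Section Spanned.
Variable n : nat.

Definition families : wf -> Prop := fun F =>
  exists l m, (2 * l + m <= n)%N /\ family l m F.
Definition spanned : wf -> Prop :=
  fun F => lin_span families (fun x => (mu a omega x)%:C *: F x).

Lemma spanned_subspace : is_subspace spanned.
Proof.
exact: (pull_subspace (fun x => (mu a omega x)%:C) (lin_span_subspace _)).
Qed.

Hypothesis omega_gt0 : 0 < omega.

(* L_l(omega r^2) is (r^2)^l times a nonzero constant, up to lower powers of
   r^2. *)
Lemma spanned_rsq m Q :
    (forall l, family l m (fun x => (radial a omega l m x)%:C *: Q x)) ->
  forall l, (2 * l + m <= n)%N -> spanned (fun x => (rsq x ^+ l)%:C *: Q x).
Proof.
move=> fQ l; have hS := spanned_subspace.
elim/ltn_ind: l => l IH lmn.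
pose c k := (laguerre (- beta N a m) l)`_k * omega ^+ k.
have cl : c l != 0.
  by rewrite mulf_neq0 ?laguerre_lead // expf_neq0 // gt_eqF.
have full : spanned (fun x => (\sum_(k < l.+1) c k * rsq x ^+ k)%:C *: Q x).
  have gen : families (fun x => (radial a omega l m x)%:C *: Q x) by exists l, m.
  apply: (sub_ext (lin_span_subspace _) _ (lin_span_gen gen)) => x _.
  by rewrite radialE rmorphM -scalerA.
have low : spanned (fun x => \sum_(k < l) (c k)%:C *: ((rsq x ^+ k)%:C *: Q x)).
  apply: (sub_sum (F := fun (k : 'I_l) x => (c k)%:C *: ((rsq x ^+ k)%:C *: Q x)) hS).
  move=> k _; apply: (sub_scale hS); apply: IH => //.
  by have := ltn_ord k; lia.
apply: (sub_ext hS _ (sub_scale hS ((c l)^-1)%:C (sub_add hS full (sub_opp hS low)))).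
clearbody c => x _; rewrite big_ord_recr /= rmorphD scalerDl.
have -> : (\sum_(k < l) c k * rsq x ^+ k)%:C *: Q x
    = \sum_(k < l) (c k)%:C *: ((rsq x ^+ k)%:C *: Q x).
  rewrite rmorph_sum scaler_suml; apply: eq_bigr => k _.
  by rewrite rmorphM -scalerA.
by rewrite addrAC subrr add0r scalerA -rmorphM mulrA mulVf // mul1r.
Qed.

(* Induction on d; r^2-multiples in degree d come from degree d - 2. *)
Lemma spanned_monomial d j F : (2 * j + d <= n)%N -> monomial d F ->
  spanned (fun x => (rsq x ^+ j)%:C *: F x).
Proof.
elim/ltn_ind: d j F => d IH j F jd.
have hS := pull_subspace (fun x => (rsq x ^+ j)%:C) spanned_subspace.
apply: (monomial_triangular hS) => [i [//|k] b B hB hd _|Q fQ]; last exact: spanned_rsq.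
have d2 : (d - 2 < d)%N by lia.
(* Moving one factor r^2 from the monomial to the prefactor preserves the total degree 2 j + d. *)
have jd2 : (2 * j.+1 + (d - 2) <= n)%N by lia.
have hm : (i + 2 * k + b = d - 2)%N by lia.
apply: (sub_ext spanned_subspace _ (IH _ d2 _ _ jd2 (Monomial hB hm))) => x _.
rewrite !scalerA -!rmorphM; congr (_%:C *: _).
by rewrite !exprS; ring.
Qed.

Lemma Hspace_spanned F : Hspace hN n F -> spanned F.
Proof.
apply: lin_span_min; first exact: spanned_subspace.
apply: Hspace_gen_min; first exact: spanned_subspace.
move=> d G dn hG; have := @spanned_monomial d 0 G dn hG.
by apply: (sub_ext spanned_subspace) => x _; rewrite expr0 scale1r.
Qed.

Lemma mu_Hspace_subspace : is_subspace (@mu_Hspace R N hN twoM a omega n).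
Proof.
have hS := lin_span_subspace (@Hspace_gen R N hN twoM n).
split.
- by exists (fun=> 0) => [|x _]; [exact: sub0 hS | rewrite scaler0].
- move=> F F' [G hG FG] [G' hG' FG']; exists (fun x => G x + G' x) => [|x cx].
    exact: sub_add hS _ _ hG hG'.
  by rewrite FG // FG' // scalerDr.
- move=> c F [G hG FG]; exists (fun x => c *: G x) => [|x cx].
    exact: sub_scale hS _ _ hG.
  by rewrite (FG _ cx) [LHS]scalerA [RHS]scalerA; congr (_ *: _); exact: mulrC.
- by move=> F F' FF' [G hG FG]; exists G => // x cx; rewrite -FF' // FG.
Qed.

Lemma families_mu_Hspace F : lin_span families F <-> mu_Hspace hN a omega n F.
Proof.
split.
  apply: lin_span_min; first exact: mu_Hspace_subspace.
  by move=> G [l [m [lmn]]]; exact: family_mu_Hspace.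
move=> [G /Hspace_spanned hG FG].
by apply: (sub_ext (lin_span_subspace _) _ hG) => x cx; rewrite FG.
Qed.
End Spanned.
End Completeness.

(** * Linearity of the Hamiltonian and invariance of the spaces *)

Section Linearity.
Variables (R : realType) (N twoM : nat).
Variables (a omega : R).
Local Notation V := 'rV[R]_N.
Local Notation wf := (wavefun R N twoM).
Implicit Types (x : V) (F : wf) (k : nat).

(** A complex coefficient mixes the real and imaginary parts on which [dpart] is computed, so both
    must be differentiable. *)
Lemma dpart_lin k (c : 'I_k -> R[i]) (g : 'I_k -> wf) i x :
  (forall j u, differentiable (fun y : V => complex.Re (g j y u)) x /\
    differentiable (fun y : V => complex.Im (g j y u)) x) ->
  dpart i (fun y => \sum_j c j *: g j y) x = \sum_j c j *: dpart i (g j) x.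
Proof.
move=> dg; apply/ffunP => u; rewrite ffunE sum_ffunE.
have gu y : (\sum_j c j *: g j y) u = \sum_j c j * g j y u.
  by rewrite sum_ffunE; apply: eq_bigr => j _; rewrite ffunE.
have hre j : hasD (fun y : V => complex.Re (g j y u)) i x
    ('D_(delta_mx 0 i) (fun y : V => complex.Re (g j y u)) x).
  by split=> //; have [] := dg j u.
have him j : hasD (fun y : V => complex.Im (g j y u)) i x
    ('D_(delta_mx 0 i) (fun y : V => complex.Im (g j y u)) x).
  by split=> //; have [] := dg j u.
have hr j := hasD_add (hasD_mul (hasD_cst (complex.Re (c j)) i x) (hre j))
  (hasD_opp (hasD_mul (hasD_cst (complex.Im (c j)) i x) (him j))).
have hi j := hasD_add (hasD_mul (hasD_cst (complex.Re (c j)) i x) (him j))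
  (hasD_mul (hasD_cst (complex.Im (c j)) i x) (hre j)).
have [_ Hr] := hasD_sum (index_enum 'I_k) (P := xpredT) (fun j _ => hr j).
have [_ Hi] := hasD_sum (index_enum 'I_k) (P := xpredT) (fun j _ => hi j).
have -> : (fun y : V => complex.Re ((\sum_j c j *: g j y) u))
    = fun y => \sum_j (complex.Re (c j) * complex.Re (g j y u)
        - complex.Im (c j) * complex.Im (g j y u)).
  apply/funext => y; rewrite gu raddf_sum; apply: eq_bigr => j _.
  by case: (c j) (g j y u) => [u1 v1] [u2 v2].
have -> : (fun y : V => complex.Im ((\sum_j c j *: g j y) u))
    = fun y => \sum_j (complex.Re (c j) * complex.Im (g j y u)
        + complex.Im (c j) * complex.Re (g j y u)).
  apply/funext => y; rewrite gu raddf_sum; apply: eq_bigr => j _.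
  by case: (c j) (g j y u) => [u1 v1] [u2 v2].
rewrite Hr Hi.
apply/eqP; rewrite eq_complex; apply/andP; split; apply/eqP.
  rewrite /= raddf_sum; apply: eq_bigr => j _; rewrite !ffunE.
  by case: (c j) => u1 v1 /=; rewrite !mul0r !add0r.
rewrite /= raddf_sum; apply: eq_bigr => j _; rewrite !ffunE.
by case: (c j) => u1 v1 /=; rewrite !mul0r !add0r.
Qed.

Lemma H0_lin k (c : 'I_k -> R[i]) (g : 'I_k -> wf) F x :
    (forall j, smooth (g j)) ->
    (forall y, config y -> F y = \sum_j c j *: g j y) -> config x ->
  H0 a omega F x = \sum_j c j *: H0 a omega (g j) x.
Proof.
move=> sg Fg cx.
have dd i y : config y -> dpart i F y = \sum_j c j *: dpart i (g j) y.
  move=> cy; rewrite (@dpart_near _ _ _ _ (fun y => \sum_j c j *: g j y)).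
    (* Smoothness at the empty list of derivations is differentiability of the function itself; the
       singleton list serves for the second derivatives. *)
    by apply: dpart_lin => j u; exact: (sg j [::]).
  by apply: filterS (config_near cy) => z; exact: Fg.
have d2 i : dpart i (dpart i F) x = \sum_j c j *: dpart i (dpart i (g j)) x.
  rewrite (@dpart_near _ _ _ _ (fun y => \sum_j c j *: dpart i (g j) y)).
    by apply: dpart_lin => j u; exact: (sg j [:: i]).
  by apply: filterS (config_near cx) => z; exact: dd.
have scale (r : R[i]) (h : 'I_k -> Sigma R N twoM) :
    r *: (\sum_j c j *: h j) = \sum_j c j *: (r *: h j).
  by rewrite scaler_sumr; apply: eq_bigr => j _; rewrite !scalerA mulrC.
have sw i j : spin_swap i j (F x) = \sum_l c l *: spin_swap i j (g l x).
  rewrite (Fg _ cx) /spin_swap spin_perm_sum; apply: eq_bigr => l _.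
  by rewrite spin_permZ.
have E1 : - (\sum_i dpart i (dpart i F) x)
    = \sum_j c j *: - (\sum_i dpart i (dpart i (g j)) x).
  transitivity (- (\sum_i \sum_j c j *: dpart i (dpart i (g j)) x)).
    by congr (- _); apply: eq_bigr => i _.
  rewrite exchange_big -sumrN; apply: eq_bigr => j _.
  by rewrite scalerN scaler_sumr.
have E2 (r : R[i]) : r *: F x = \sum_j c j *: (r *: g j x).
  exact: etrans (congr1 (GRing.scale r) (Fg _ cx)) (scale _ _).
have E3 : \sum_i (2 * a / (x 0 i - x 0 (ordS i)) ^+ 2)%:C *:
      (a%:C *: F x - spin_swap i (ordS i) (F x))
    = \sum_j c j *: \sum_i (2 * a / (x 0 i - x 0 (ordS i)) ^+ 2)%:C *:
      (a%:C *: g j x - spin_swap i (ordS i) (g j x)).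
  transitivity (\sum_i \sum_j c j *: ((2 * a / (x 0 i - x 0 (ordS i)) ^+ 2)%:C *:
      (a%:C *: g j x - spin_swap i (ordS i) (g j x)))).
    apply: eq_bigr => i _; rewrite -scale; congr (_ *: _).
    rewrite E2 sw -sumrB; apply: eq_bigr => j _.
    by rewrite scalerBr.
  by rewrite exchange_big; apply: eq_bigr => j _; rewrite scaler_sumr.
have add (A B : Sigma R N twoM) (f h : 'I_k -> Sigma R N twoM) :
    A = \sum_j c j *: f j -> B = \sum_j c j *: h j ->
    A + B = \sum_j c j *: (f j + h j).
  by move=> -> ->; rewrite -big_split; apply: eq_bigr => j _; rewrite scalerDr.
exact: (add _ _ _ _ (add _ _ _ _ (add _ _ _ _ E1 (E2 _)) (E2 _)) E3).
Qed.

(** On a combination of eigenfunctions H0 only rescales the coefficients. Applied to the spanning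
    families, this gives the invariance of the spaces. *)
Lemma span_eigen_H0 (fam : wf -> Prop) F :
  (forall G, fam G -> exists e, eigenfunction a omega G e) ->
  lin_span fam F -> lin_span fam (H0 a omega F).
Proof.
move=> eig [k [c [g [fg Fg]]]].
have /choice[e he] : forall j, exists e, eigenfunction a omega (g j) e.
  by move=> j; apply: eig.
exists k, (fun j => c j * (e j)%:C), g; split=> // x cx.
rewrite (H0_lin (fun j => (he j).1) Fg cx); apply: eq_bigr => j _.
by rewrite ((he j).2 _ cx) scalerA.
Qed.
End Linearity.

Lemma family_eigenfunction (R : realType) (N : nat) (hN : (2 < N)%N) (twoM : nat)
    (a omega : R) (l m : nat) (F : wavefun R N twoM) : 2^-1 < a ->
  spin_eigenfamily hN a omega l m F -> eigenfunction a omega F (E N a omega l m).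
Proof.
move=> ha; case=> [s|s m1|s m2|s m2 ss hs|s m3|s m3 ss|s m4].
- exact: eigen_Psi0.
- exact: eigen_Psi1.
- exact: eigen_Psi2.
- exact: eigen_Psi2t.
- exact: eigen_Psi3.
- exact: eigen_Psi3h.
- exact: eigen_Psi4.
Qed.

Theorem theorem2 (R : realType) (N : nat) (hN : (2 < N)%N) (twoM : nat)
    (a omega : R) (ha : 2^-1 < a) (homega : 0 < omega) :
  (forall (l m : nat) (Psi : wavefun R N twoM),
     spin_eigenfamily hN a omega l m Psi ->
     eigenfunction a omega Psi (E N a omega l m))
  /\ (forall (n : nat) (F : wavefun R N twoM),
        mu_Hspace hN a omega n F -> mu_Hspace hN a omega n (H0 a omega F))
  /\ (forall (n : nat) (F : wavefun R N twoM),
        lin_span (fun Psi => exists l m : nat,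
                    (2 * l + m <= n)%N /\ spin_eigenfamily hN a omega l m Psi) F
        <-> mu_Hspace hN a omega n F).
Proof.
have eig l m (F : wavefun R N twoM) := @family_eigenfunction R N hN twoM a omega l m F ha.
have span n F := @families_mu_Hspace R N hN twoM a omega ha n homega F.
split=> //; split=> [n F|//].
move=> /span hF; apply/span; apply: span_eigen_H0 hF => G [l [m [_ fG]]].
by exists (E N a omega l m); exact: eig.
Qed.
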